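(* Let $a\in(-1,0)$. There exists a unique $\zeta_a\in\mathbb{R}$ such that $\beta_a=\mu_a(\zeta_a)$. Furthermore: (1) $\zeta_a<0$ and $\mu_a''(\zeta_a)>0$; (2) $|a|\Theta_0<\beta_a<\Theta_0$; (3) the positive $L^2$-normalized ground state $\phi_a:=\varphi_{a,\zeta_a}$ satisfies $\phi_a'(0)<0$.
   Context: For $a\in[-1,1)\setminus\{0\}$ let $\sigma(\tau)=1$ for $\tau>0$ and $\sigma(\tau)=a$ for $\tau<0$. Let $B^1(\mathbb{R})=\{u\in L^2(\mathbb{R}): u'\in L^2(\mathbb{R}),\ \tau u\in L^2(\mathbb{R})\}$. For $\xi\in\mathbb{R}$, $\mathfrak h_a[\xi]=-\frac{d^2}{d\tau^2}+(\xi+\sigma(\tau)\tau)^2$ is the self-adjoint operator on $L^2(\mathbb{R})$ associated with the quadratic form $q_a[\xi](u)=\int_{\mathbb{R}}\big(|u'|^2+(\xi+\sigma(\tau)\tau)^2|u|^2\big)d\tau$ on $B^1(\mathbb{R})$; it has compact resolvent. Its lowest eigenvalue is $\mu_a(\xi)=\inf_{u\in B^1(\mathbb{R})\setminus\{0\}} q_a[\xi](u)/\|u\|^2_{L^2(\mathbb{R})}$; it is simple, and $\varphi_{a,\xi}$ denotes the unique positive $L^2$-normalized eigenfunction. The maps $\xi\mapsto\mu_a(\xi)$ and $\xi\mapsto\varphi_{a,\xi}$ are $C^\infty$. Set $\beta_a=\inf_{\xi\in\mathbb{R}}\mu_a(\xi)$. The de Gennes constant $\Theta_0$ is $\inf_{\xi\in\mathbb{R}}\lambda^N(\xi)$,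 where $\lambda^N(\xi)$ is the lowest eigenvalue of the Neumann realization of $-\frac{d^2}{d\tau^2}+(\tau+\xi)^2$ on $L^2(\mathbb{R}_+)$ (equivalently $\Theta_0=\beta_{-1}$). *)

(* Defs.v *)
From mathcomp Require Import all_boot all_order all_algebra.
From mathcomp Require Import all_classical all_reals all_analysis.
Import Order.TTheory GRing.Theory Num.Theory.
Import numFieldNormedType.Exports.
Local Open Scope classical_set_scope.
Local Open Scope ring_scope.

Section Defs.
Context {R : realType}.
Local Notation leb := (@lebesgue_measure R).

Definition smooth (f : R -> R) : Prop :=
  forall (n : nat) (x : R), derivable (iter n (@derive1 R R) f) x 1.

Definition test_fun (D : set R) (phi : R -> R) : Prop :=
  smooth phi /\ exists m M : R, [set x | m <= x <= M] `<=` D /\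
    forall x, x < m \/ M < x -> phi x = 0.

Definition L2on (D : set R) (f : R -> R) : Prop :=
  measurable_fun D f /\ leb.-integrable D (fun x => (f x ^+ 2)%:E).

Definition weak_deriv (D : set R) (u v : R -> R) : Prop :=
  forall phi, test_fun D phi ->
    (\int[leb]_(x in D) (u x * derive1 phi x)%:E
     = - \int[leb]_(x in D) (v x * phi x)%:E)%E.

Definition form_dom (D : set R) (u v : R -> R) : Prop :=
  L2on D u /\ L2on D v /\ L2on D (fun x => x * u x) /\ weak_deriv D u v.

Definition qform (D : set R) (W : R -> R) (u v : R -> R) : R :=
  fine (\int[leb]_(x in D) (v x ^+ 2 + W x * u x ^+ 2)%:E).

Definition norm2 (D : set R) (u : R -> R) : R :=
  fine (\int[leb]_(x in D) (u x ^+ 2)%:E).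

(* lowest eigenvalue = infimum of the Rayleigh quotient over the form domain *)
Definition lowest (D : set R) (W : R -> R) : R :=
  inf [set r | exists u v, form_dom D u v /\ norm2 D u != 0 /\
                 r = qform D W u v / norm2 D u].

(* u is an eigenfunction, with eigenvalue lam, of the self-adjoint operator
   associated with the form (weak eigenvalue equation) *)
Definition eigenfun (D : set R) (W : R -> R) (lam : R) (u : R -> R) : Prop :=
  exists v, form_dom D u v /\
    forall w w', form_dom D w w' ->
      fine (\int[leb]_(x in D) (v x * w' x + W x * u x * w x)%:E)
      = lam * fine (\int[leb]_(x in D) (u x * w x)%:E).

Definition sigma (a t : R) : R := if 0 < t then 1 else a.

Definition Wa (a xi : R) (t : R) : R := (xi + sigma a t * t) ^+ 2.

Definition mu_a (a xi : R) : R := lowest setT (Wa a xi).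

Definition beta (a : R) : R := inf (range (mu_a a)).

(* Neumann realization of -d^2/dt^2 + (t+xi)^2 on R_+ *)
Definition lambdaN (xi : R) : R := lowest [set t | 0 < t] (fun t => (t + xi) ^+ 2).

Definition Theta0 : R := inf (range lambdaN).

(* positive L^2-normalized ground state (continuous representative) *)
Definition ground_state (a xi : R) (u : R -> R) : Prop :=
  continuous u /\ (forall x, 0 < u x) /\ norm2 setT u = 1 /\
  eigenfun setT (Wa a xi) (mu_a a xi) u.

End Defs.

(* Main.v *)
(* Write a = - b^2. Let m(lam, x) be the logarithmic derivative of the solution of - U'' + x^2 U = lam U
   decaying at +oo, given for lam < 1 by an explicit Laplace integral; m solves the Riccati equation
   m' = x^2 - lam - m^2 and is strictly increasing in lam. After translation and dilation, m describes
   the decaying solutions on both half-lines, so for lam < b^2 the ground state energy mu(xi) equals lam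
   iff G(lam, xi) = m(lam, xi) + b m(lam / b^2, xi / b) vanishes, and mu(xi) >= lam iff G <= 0
   (complete the square in the form with v - m u). Likewise for the Neumann problem with m instead of G.
   Let beta be the least lam for which G(lam, .) reaches 0. By the Riccati equation, at a zero of
   G(beta, .) both terms of G are critical, and m(beta, .) has only one critical point, which is negative;
   this gives uniqueness of zeta. Comparing the maxima of m(beta, .) < 0 < m(beta / b^2, .) yields
   beta < Theta_0 < beta / b^2 and u'(0) / u(0) = m(beta, zeta) < 0. Finally mu'' (zeta) comes from implicit
   differentiation of G(mu(xi), xi) = 0. *)

Require Import Defs.
From mathcomp Require Import all_boot all_order all_algebra.
From mathcomp Require Import all_classical all_reals all_analysis.
From mathcomp Require Import measurable_realfun.
From mathcomp Require Import ring lra.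
Import Order.TTheory GRing.Theory Num.Theory.
Import numFieldNormedType.Exports.
Set Implicit Arguments.
Unset Strict Implicit.
Unset Printing Implicit Defensive.
Local Open Scope classical_set_scope.
Local Open Scope ring_scope.

(** * Absolutely continuous functions *)

Section AC.
Context {R : realType}.
Local Notation leb := (@lebesgue_measure R).
Implicit Types (f g : R -> R) (D : set R).

(** Elements of the form domain are only L2 classes with a weak derivative, while the argument reads
    values at 0 and integrates by parts. So each one is first replaced by an absolutely continuous
    representative, obtained by testing the weak derivative against smooth approximations of
    indicator functions. The restriction lam < b^2 makes both Laplace integrals converge: their
    exponents (1 - lam) / 2 and (1 - lam / b^2) / 2 must be positive. That beta lies below b^2 is
    therefore a point to prove. As lam tends to b^2, the second exponent tends to 0 and its solution
    becomes a Gaussian, so G(lam, x) tends to m(b^2, x) - x, which is positive for some x < 0. Both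
    terms of G are critical at zeta because G = 0 forces the Riccati slope of the second term to be
    that of the first divided by b^2, while their sum is the derivative of G at a maximum. The same
    proportionality gives mu' = - (1 + b^-2) slope / (dG/dlam); along mu the derivative of the slope
    at zeta is 2 zeta, whence the sign of mu''. *)

Definition Rint D f : Prop := leb.-integrable D (EFin \o f).

(* Cousin's lemma: an additive property that holds near every point holds on every interval. *)
Lemma interval_ind (P : R -> R -> Prop) :
  (forall a b c, a <= b -> b <= c -> P a b -> P b c -> P a c) ->
  (forall x, exists2 d, 0 < d &
     forall s t, x - d < s -> s <= x -> x <= t -> t < x + d -> P s t) ->
  forall a b, a <= b -> P a b.
Proof.
move=> Ptrans Ploc a b ab.
pose S := [set t | a <= t <= b /\ P a t].
have Sa : S a.
  split; first by rewrite lexx.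
  by have [d d0 +] := Ploc a; apply; lra.
have ubS : has_ubound S by exists b => t [] /andP[].
have hS : has_sup S by split; [exists a|].
set c := sup S.
have ac : a <= c by exact: ub_le_sup.
have cb : c <= b by apply: ge_sup; [exists a|move=> t [] /andP[]].
have [d d0 Pd] := Ploc c.
have [s [/andP[as_ sb] Pas] cs] := sup_adherent d0 hS.
have sc : s <= c by apply: ub_le_sup => //; split; [apply/andP|].
have Pat t : c <= t -> t < c + d -> P a t.
  by move=> ct td; apply: (Ptrans a s t) => //; [lra|exact: Pd].
have [cb'|bc] := ltP c b; last by apply: Pat; lra.
pose t := Num.min b (c + d / 2).
have ct : c < t by rewrite lt_min cb'/=; lra.
have td : t < c + d by rewrite gt_min; apply/orP; right; lra.
have : t <= c.
  apply: ub_le_sup => //; split; last exact: Pat (ltW _) _.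
  by rewrite ge_min lexx/=; apply/andP; split => //; lra.
lra.
Qed.

Lemma Rint_le D f g : measurable D -> measurable_fun D f -> Rint D g ->
  (forall x, D x -> `|f x| <= g x) -> Rint D f.
Proof.
move=> mD mf ig fg; apply: (le_integrable _ _ _ ig) => //.
- exact/measurable_EFinP.
- by move=> x Dx /=; rewrite lee_fin (le_trans (fg _ Dx)) ?ler_norm.
Qed.

Lemma Rint_measurable D f : Rint D f -> measurable_fun D f.
Proof. by move=> /integrableP[/measurable_EFinP]. Qed.

Lemma RintS D E f : measurable D -> measurable E -> E `<=` D ->
  Rint D f -> Rint E f.
Proof. by move=> mD mE ED; exact: integrableS. Qed.

Lemma RintD D f g : measurable D -> Rint D f -> Rint D g ->
  Rint D (fun x => f x + g x).
Proof. by move=> mD fi gi; exact: (integrableD _ fi gi). Qed.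

Lemma RintB D f g : measurable D -> Rint D f -> Rint D g ->
  Rint D (fun x => f x - g x).
Proof. by move=> mD fi gi; exact: (integrableB _ fi gi). Qed.

Lemma RintZ D (c : R) f : measurable D -> Rint D f ->
  Rint D (fun x => c * f x).
Proof. by move=> mD fi; exact: (integrableZl _ c fi). Qed.

Lemma Rint_abs D f : Rint D f -> Rint D (fun x => `|f x|).
Proof. by move=> fi; exact: (integrable_abse fi). Qed.

Lemma Rint_eq D f g : measurable D -> (forall x, D x -> f x = g x) ->
  Rint D f -> Rint D g.
Proof.
move=> mD fg; apply: eq_integrable => // x /set_mem Dx /=.
by rewrite fg.
Qed.

Lemma Rint_continuous f (a b : R) : continuous f -> Rint `[a, b] f.
Proof.
move=> cf; apply: continuous_compact_integrable; first exact: segment_compact.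
exact: continuous_subspaceT.
Qed.

Lemma Rint_mulc f g (a b : R) : continuous g -> Rint `[a, b] f ->
  Rint `[a, b] (fun x => f x * g x).
Proof.
move=> cg fi; apply: (integrableMl _ fi) => //.
  exact: (measurable_funS measurableT _ (continuous_measurable_fun cg)).
have /compact_bounded : compact (g @` `[a, b]).
  apply: continuous_compact; last exact: segment_compact.
  exact: continuous_subspaceT.
move=> [M [_ HM]]; exists M; split; first exact: num_real.
by move=> x Mx y yab /=; apply: HM => //; exists y.
Qed.

(* f is absolutely continuous with almost everywhere derivative f'. *)
Definition AC f f' := forall a b, a <= b ->
  Rint `[a, b] f' /\ f b - f a = \int[leb]_(x in `[a, b]) f' x.

Lemma Rintegral_cat f (a b c : R) : a <= b -> b <= c -> Rint `[a, c] f ->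
  \int[leb]_(x in `[a, c]) f x =
  \int[leb]_(x in `[a, b]) f x + \int[leb]_(x in `[b, c]) f x.
Proof.
move=> ab bc fi.
rewrite -[X in _ + X]Rintegral_itv_obnd_cbnd; last first.
  by apply: RintS fi => //; apply: subset_itv; rewrite bnd_simp.
rewrite -(@Rintegral_itvB _ f (BLeft a) (BRight c) b) ?bnd_simp//.
by rewrite addrC subrK.
Qed.

Lemma AC_Rint f f' a b : AC f f' -> Rint `[a, b] f'.
Proof.
move=> acf; have [ab|ba] := leP a b; first by have [] := acf _ _ ab.
by rewrite set_itv_ge ?bnd_simp -?ltNge//; apply: integrable_set0.
Qed.

Lemma AC_continuous f f' : AC f f' -> continuous f.
Proof.
move=> acf x.
have xl : x - 1 <= x + 1 by lra.
have [fi _] := acf _ _ xl.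
have cF := @parameterized_integral_continuous _ (x - 1) (x + 1) f' xl fi.
apply: (@within_continuous_continuous _ _ _ (x - 1) (x + 1)); [lra| |by rewrite in_itv/=; lra].
pose F t := f (x - 1) + parameterized_integral leb (x - 1) t f'.
apply: (@subspace_eq_continuous _ _ _ F) => /=.
  move=> t /set_mem/=; rewrite in_itv/= => /andP[xt tx].
  by have [_ E] := acf _ _ xt; rewrite /F /parameterized_integral -E addrC subrK.
move=> t; apply: cvgD; [exact: cvg_cst|exact: cF].
Qed.

Lemma AC_C1 f f' : (forall x : R, is_derive x 1 f (f' x)) -> continuous f' -> AC f f'.
Proof.
move=> df cf a b; rewrite le_eqVlt => /predU1P[->|ab].
  by rewrite set_itv1 Rintegral_set1 subrr; split => //; rewrite -set_itv1; exact: Rint_continuous.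
split; first exact: Rint_continuous.
have cf0 : continuous f.
  by move=> x; apply/differentiable_continuous/derivable1_diffP; case: (df x).
rewrite /Rintegral (@continuous_FTC2 _ f' f) //.
- exact: continuous_subspaceT.
- split=> [x _||]; [by case: (df x)| |].
  + by apply: cvg_at_right_filter; exact: cf0.
  + by apply: cvg_at_left_filter; exact: cf0.
- by move=> x _; rewrite derive1E; case: (df x).
Qed.

(** With [g] frozen at [y] and [f] at [x], the product rule is exact: the integral of
    [f' t * g y + g' t * f x] equals the increment of [f * g]. The error of unfreezing is the
    oscillation [e] times the integral of [|f'| + |g'|]. *)
Lemma AC_mul_step f f' g g' (e x y : R) : AC f f' -> AC g g' -> x <= y ->
  (forall s, x <= s <= y -> `|g y - g s| <= e /\ `|f x - f s| <= e) ->
  `|f y * g y - f x * g x - \int[leb]_(t in `[x, y]) (f' t * g t + g' t * f t)| <=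
  e * \int[leb]_(t in `[x, y]) (`|f' t| + `|g' t|).
Proof.
move=> acf acg xy H.
have cf := AC_continuous acf; have cg := AC_continuous acg.
have [fi Ef] := acf _ _ xy; have [gi Eg] := acg _ _ xy.
have fgi : Rint `[x, y] (fun t => f' t * g t + g' t * f t).
  by apply: RintD => //; exact: Rint_mulc.
have -> : f y * g y - f x * g x = \int[leb]_(t in `[x, y]) (f' t * g y + g' t * f x).
  rewrite RintegralD//; last 2 first.
  - by apply: Rint_mulc => //; exact: cst_continuous.
  - by apply: Rint_mulc => //; exact: cst_continuous.
  by rewrite !RintegralZr// -Ef -Eg; ring.
rewrite -RintegralB//; last first.
  by apply: RintD => //; apply: Rint_mulc => //; exact: cst_continuous.
have ii : Rint `[x, y] (fun t => f' t * g y + g' t * f x - (f' t * g t + g' t * f t)).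
  by apply: RintB => //; apply: RintD => //; apply: Rint_mulc => //; exact: cst_continuous.
have nn : Rint `[x, y] (fun t => `|f' t| + `|g' t|).
  by apply: RintD => //; exact: Rint_abs.
apply: le_trans (le_normr_Rintegral _ _) _ => //.
rewrite -RintegralZl//; apply: le_Rintegral => //.
- exact: Rint_abs.
- exact: RintZ.
move=> t /=; rewrite in_itv/= => xty; have [H1 H2] := H t xty.
have -> : f' t * g y + g' t * f x - (f' t * g t + g' t * f t) =
  (g y - g t) * f' t + (f x - f t) * g' t by ring.
rewrite (le_trans (ler_normD _ _))// !normrM mulrDr.
by apply: lerD; apply: ler_wpM2r.
Qed.

(** Both the defect of the product rule and its bound [e] times the integral of [|f'| + |g'|] behave
    well under concatenation of intervals, so [interval_ind] reduces to short intervals, where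
    [AC_mul_step] applies by continuity. *)
Lemma AC_mul f f' g g' : AC f f' -> AC g g' ->
  AC (fun x => f x * g x) (fun x => f' x * g x + g' x * f x).
Proof.
move=> acf acg.
have cf := AC_continuous acf; have cg := AC_continuous acg.
have hi a b : Rint `[a, b] (fun x => f' x * g x + g' x * f x).
  by apply: RintD => //; apply: Rint_mulc => //; [exact: AC_Rint acf|exact: AC_Rint acg].
move=> a b ab; split => //; apply/eqP; rewrite -subr_eq0 -normr_le0.
have ni c d : Rint `[c, d] (fun t => `|f' t| + `|g' t|).
  by apply: RintD => //; apply: Rint_abs; [exact: AC_Rint acf|exact: AC_Rint acg].
set N := \int[leb]_(t in `[a, b]) (`|f' t| + `|g' t|).
have N0 : 0 <= N by apply: Rintegral_ge0 => t _; rewrite addr_ge0.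
suff key e : 0 < e -> `|f b * g b - f a * g a -
    \int[leb]_(t in `[a, b]) (f' t * g t + g' t * f t)| <= e * N.
  apply/ler_addgt0Pl => e e0; rewrite addr0.
  have eN : 0 < e / (N + 1) by rewrite divr_gt0//; lra.
  apply: le_trans (key _ eN) _.
  by rewrite mulrAC ler_pdivrMr; nra.
move=> e0; rewrite /N.
apply: (@interval_ind (fun s t => `|f t * g t - f s * g s -
    \int[leb]_(t in `[s, t]) (f' t * g t + g' t * f t)| <=
    e * \int[leb]_(t in `[s, t]) (`|f' t| + `|g' t|))) => //.
- move=> x y z xy yz H1 H2.
  rewrite (Rintegral_cat xy yz (hi _ _)) (Rintegral_cat xy yz (ni _ _)) mulrDr.
  apply: le_trans (lerD H1 H2); apply: le_trans (ler_normD _ _).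
  by rewrite le_eqVlt; apply/predU1P; left; congr `|_|; ring.
- move=> x; have e20 : 0 < e / 2 by lra.
  have /cvgrPdist_lt/(_ _ e20)/= [d1 /= d10 H1] := cf x.
  have /cvgrPdist_lt/(_ _ e20)/= [d2 /= d20 H2] := cg x.
  exists (Num.min d1 d2); first by rewrite lt_min d10.
  move=> s t xs sx xt tx; apply: AC_mul_step => //; first lra.
  have B r : s <= r <= t -> `|f x - f r| < e / 2 /\ `|g x - g r| < e / 2.
    move=> /andP[sr rt]; split; [apply: H1|apply: H2] => /=;
    (have /andP[? ?] : (Num.min d1 d2 <= d1) && (Num.min d1 d2 <= d2) by
      rewrite !ge_min !lexx orbT); rewrite ltr_norml; apply/andP; split; lra.
  move=> r srt; have [B1 B2] := B r srt.
  have [B3 _] := B s ltac:(lra); have [_ B4] := B t ltac:(lra).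
  split.
    have -> : g t - g r = (g x - g r) - (g x - g t) by ring.
    by apply: le_trans (ler_normB _ _) _; lra.
  have -> : f s - f r = (f x - f r) - (f x - f s) by ring.
  by apply: le_trans (ler_normB _ _) _; lra.
Qed.

End AC.

(** * Integration over unbounded intervals *)

Section ACinfinity.
Context {R : realType}.
Local Notation leb := (@lebesgue_measure R).
Implicit Types (f g : R -> R) (D : set R).

(** Dominated convergence: each point eventually leaves the sets [E n], so the restrictions of [|f|]
    tend pointwise to 0. *)
Lemma Rint_tail D f (E : (set R)^nat) : measurable D ->
  (forall n, measurable (E n)) -> (forall n, E n `<=` D) ->
  (forall x, \forall n \near \oo, ~ E n x) -> Rint D f ->
  \int[leb]_(x in E n) `|f x| @[n --> \oo] --> (0 : R).
Proof.
move=> mD mE ED Eoo fi.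
have fE n : \int[leb]_(x in E n) `|f x| = \int[leb]_(x in D) ((fun x => `|f x|) \_ (E n)) x.
  by rewrite -Rintegral_mkcondr setIidr.
under eq_fun do rewrite fE.
suff : fine (\int[leb]_(x in D) (((fun x => `|f x|) \_ (E n)) x)%:E)%E @[n --> \oo] -->
  fine (\int[leb]_(x in D) (cst 0%E) x)%E by rewrite integral0.
apply: fine_cvg; rewrite fineK; last by rewrite integral0.
have mf := Rint_measurable fi.
have [|||||_ _ //] := @dominated_convergence _ _ _ leb D mD
  (fun n => EFin \o ((fun x => `|f x|) \_ (E n))) (cst 0%E) (fun x => `|f x|%:E).
- move=> n; apply/measurable_EFinP; apply/measurable_restrict => //.
    exact: mE.
  apply: measurable_funS mD (@subIsetl _ _ _) _.
  exact: measurableT_comp.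
- exact: measurable_cst.
- apply: aeW => x Dx; apply: cvg_EFin; first exact: nearW.
  apply: (@cvg_trans _ ((fun=> 0 : R) @ \oo)); last exact: cvg_cst.
  apply: near_eq_cvg; near=> n.
  rewrite /= patchE ifF//; apply/negbTE/negP => /set_mem.
  by near: n; exact: Eoo.
- exact: Rint_abs.
- apply: aeW => x n Dx /=; rewrite lee_fin patchE; case: ifP => _.
    by rewrite normr_id.
  by rewrite normr0.
Unshelve. all: by end_near. Qed.

(* The limit of f at infinity exists because f' is integrable, and it vanishes because f is integrable. *)
Lemma AC_integral_right f f' (a : R) : AC f f' ->
  Rint `[a, +oo[ f -> Rint `[a, +oo[ f' ->
  \int[leb]_(x in `[a, +oo[) f' x = - f a.
Proof.
(* [L] is the limit of [f] at infinity. If it were nonzero, [|f|] would stay above [|L| / 2] beyond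
   some [a + n], whereas its integral over the unit interval starting there is below [|L| / 2]. *)
move=> acf fi f'i; apply/eqP; rewrite -addr_eq0; set L := _ + _.
apply/negPn/negP => L0; have L20 : 0 < `|L| / 2 by rewrite divr_gt0// normr_gt0.
have tl (g : R -> R) (E : (set R)^nat) : Rint `[a, +oo[ g -> (forall n, measurable (E n)) ->
    (forall n, E n `<=` `[a + n%:R, +oo[%classic) ->
    \int[leb]_(x in E n) `|g x| @[n --> \oo] --> (0 : R).
  move=> gi mE ED; apply: (Rint_tail (D := `[a, +oo[%classic)) => //.
    move=> n x /ED /=; rewrite !in_itv/= !andbT; apply: le_trans.
    by rewrite lerDl.
  move=> x; near=> n => /ED /=; rewrite in_itv/= andbT; apply/negP; rewrite -ltNge.
  rewrite -ltrBlDl; near: n; exact: nbhs_infty_gtr.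
have t1 : \int[leb]_(x in `]a + n%:R, +oo[) `|f' x| @[n --> \oo] --> (0 : R).
  by apply: tl => // n; apply: subset_itvr; rewrite bnd_simp.
have t2 : \int[leb]_(x in `[a + n%:R, a + n%:R + 1]) `|f x| @[n --> \oo] --> (0 : R).
  by apply: tl => // n; apply: subset_itvl.
have [n] : exists n : nat, \int[leb]_(x in `]a + n%:R, +oo[) `|f' x| < `|L| / 2 /\
   \int[leb]_(x in `[a + n%:R, a + n%:R + 1]) `|f x| < `|L| / 2.
  near \oo => n; exists n; split; near: n.
    by move/cvgrPdist_lt : t1 => /(_ _ L20); apply: filterS => n /=;
      rewrite sub0r normrN ger0_norm// Rintegral_ge0.
  by move/cvgrPdist_lt : t2 => /(_ _ L20); apply: filterS => n /=;
      rewrite sub0r normrN ger0_norm// Rintegral_ge0.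
move=> [H1 H2].
have fx x : a + n%:R <= x -> `|L| / 2 <= `|f x|.
  move=> nx; have n0 : (0 : R) <= n%:R by [].
  have ax : a <= x by lra.
  have [_ E] := acf _ _ ax.
  have : `|L - f x| <= `|L| / 2.
    have -> : L - f x = \int[leb]_(x in `]x, +oo[) f' x.
      rewrite -(@Rintegral_itvB _ f' (BLeft a) +oo%O x) ?bnd_simp//.
      by rewrite -E /L; ring.
    have sub : `]x, +oo[ `<=` `[a, +oo[%classic.
      by apply: subset_itvr; rewrite bnd_simp.
    apply: le_trans (le_normr_Rintegral _ _) _ => //.
      exact: RintS f'i.
    apply: le_trans (ltW H1).
    rewrite /Rintegral fine_le//.
    + apply: integrable_fin_num => //; apply: Rint_abs; exact: RintS f'i.
    + apply: integrable_fin_num => //; apply: Rint_abs; apply: RintS f'i => //.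
      by apply: subset_itvr; rewrite bnd_simp; lra.
    + apply: ge0_subset_integral => //.
        apply/measurable_EFinP; apply: measurableT_comp => //.
        apply: Rint_measurable; apply: RintS f'i => //.
        by apply: subset_itvr; rewrite bnd_simp; lra.
      by apply: subset_itvr; rewrite bnd_simp.
  have := ler_normD (L - f x) (f x); rewrite subrK => A B; lra.
have : `|L| / 2 <= \int[leb]_(x in `[a + n%:R, a + n%:R + 1]) `|f x|.
  have -> : `|L| / 2 = \int[leb]_(x in `[a + n%:R, a + n%:R + 1]) (`|L| / 2).
    rewrite Rintegral_cst//.
    have /= := @lebesgue_measure_itv R `[a + n%:R, a + n%:R + 1]%R.
    by rewrite lte_fin ltrDl ltr01 -EFinB => ->/=; ring.
  apply: le_Rintegral => //.
  - exact: Rint_continuous (@cst_continuous _ _ _).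
  - by apply: Rint_abs; apply: Rint_continuous; exact: AC_continuous acf.
  - by move=> x /=; rewrite in_itv/= => /andP[? _]; exact: fx.
by rewrite leNgt H2.
Unshelve. all: by end_near. Qed.

(** Mirror image of [AC_integral_right]; here [L] is the limit of [f] at minus infinity. *)
Lemma AC_integral_left f f' (a : R) : AC f f' ->
  Rint `]-oo, a] f -> Rint `]-oo, a] f' ->
  \int[leb]_(x in `]-oo, a]) f' x = f a.
Proof.
move=> acf fi f'i; apply/eqP; rewrite -subr_eq0 -oppr_eq0; set L := - _.
apply/negPn/negP => L0; have L20 : 0 < `|L| / 2 by rewrite divr_gt0// normr_gt0.
have tl (g : R -> R) (E : (set R)^nat) : Rint `]-oo, a] g -> (forall n, measurable (E n)) ->
    (forall n, E n `<=` `]-oo, a - n%:R]%classic) ->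
    \int[leb]_(x in E n) `|g x| @[n --> \oo] --> (0 : R).
  move=> gi mE ED; apply: (Rint_tail (D := `]-oo, a]%classic)) => //.
    move=> n x /ED /=; rewrite !in_itv/= => /le_trans; apply.
    by rewrite gerBl.
  move=> x; near=> n => /ED /=; rewrite in_itv/=; apply/negP; rewrite -ltNge ltrBlDr -ltrBlDl; near: n; exact: nbhs_infty_gtr.
have t1 : \int[leb]_(x in `]-oo, a - n%:R[) `|f' x| @[n --> \oo] --> (0 : R).
  by apply: tl => // n; apply: subset_itvl; rewrite bnd_simp.
have t2 : \int[leb]_(x in `[a - n%:R - 1, a - n%:R]) `|f x| @[n --> \oo] --> (0 : R).
  by apply: tl => // n; apply: subset_itvr.
have [n] : exists n : nat, \int[leb]_(x in `]-oo, a - n%:R[) `|f' x| < `|L| / 2 /\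
   \int[leb]_(x in `[a - n%:R - 1, a - n%:R]) `|f x| < `|L| / 2.
  near \oo => n; exists n; split; near: n.
    by move/cvgrPdist_lt : t1 => /(_ _ L20); apply: filterS => n /=;
      rewrite sub0r normrN ger0_norm// Rintegral_ge0.
  by move/cvgrPdist_lt : t2 => /(_ _ L20); apply: filterS => n /=;
      rewrite sub0r normrN ger0_norm// Rintegral_ge0.
move=> [H1 H2].
have fx x : x <= a - n%:R -> `|L| / 2 <= `|f x|.
  move=> nx; have n0 : (0 : R) <= n%:R by [].
  have ax : x <= a by lra.
  have [_ E] := acf _ _ ax.
  have : `|L - f x| <= `|L| / 2.
    have -> : L - f x = - \int[leb]_(x in `]-oo, x[) f' x.
      rewrite Rintegral_itv_bndo_bndc; last first.
        by apply: RintS f'i => //; apply: subset_itvl; rewrite bnd_simp.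
      have := @Rintegral_itvB _ f' -oo%O (BRight a) x f'i.
      rewrite !bnd_simp => /(_ isT ax) B.
      have B2 : \int[leb]_(t in `]x, a]) f' t = f a - f x.
        rewrite E Rintegral_itv_obnd_cbnd//.
        by apply: RintS f'i => //; apply: subset_itv; rewrite bnd_simp.
      by move: B; rewrite B2 /L; lra.
    rewrite normrN.
    have sub : `]-oo, x[ `<=` `]-oo, a]%classic.
      by apply: subset_itvl; rewrite bnd_simp.
    apply: le_trans (le_normr_Rintegral _ _) _ => //.
      exact: RintS f'i.
    apply: le_trans (ltW H1).
    rewrite /Rintegral fine_le//.
    + apply: integrable_fin_num => //; apply: Rint_abs; exact: RintS f'i.
    + apply: integrable_fin_num => //; apply: Rint_abs; apply: RintS f'i => //.
      by apply: subset_itvl; rewrite bnd_simp; lra.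
    + apply: ge0_subset_integral => //.
        apply/measurable_EFinP; apply: measurableT_comp => //.
        apply: Rint_measurable; apply: RintS f'i => //.
        by apply: subset_itvl; rewrite bnd_simp; lra.
      by apply: subset_itvl; rewrite bnd_simp.
  have := ler_normD (L - f x) (f x); rewrite subrK => A B; lra.
have : `|L| / 2 <= \int[leb]_(x in `[a - n%:R - 1, a - n%:R]) `|f x|.
  have -> : `|L| / 2 = \int[leb]_(x in `[a - n%:R - 1, a - n%:R]) (`|L| / 2).
    rewrite Rintegral_cst//.
    have /= := @lebesgue_measure_itv R `[a - n%:R - 1, a - n%:R]%R.
    by rewrite lte_fin gtrBl ltr01 -EFinB => ->/=; ring.
  apply: le_Rintegral => //.
  - exact: Rint_continuous (@cst_continuous _ _ _).
  - by apply: Rint_abs; apply: Rint_continuous; exact: AC_continuous acf.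
  - by move=> x /=; rewrite in_itv/= => /andP[_ ?]; exact: fx.
by rewrite leNgt H2.
Unshelve. all: by end_near. Qed.


Lemma setT_halves : [set: R] = `]-oo, 0] `|` `]0, +oo[.
Proof. by rewrite -(@itv_bndbnd_setU _ _ -oo%O (BRight 0) +oo%O) ?set_itvNyy. Qed.

Lemma Rintegral_halves f : Rint setT f ->
  \int[leb]_x f x = \int[leb]_(x in `]-oo, 0]) f x + \int[leb]_(x in `]0, +oo[) f x.
Proof.
move=> fi; rewrite [in LHS]setT_halves Rintegral_setU//.
- by rewrite -setT_halves.
- apply/disj_set2P; apply/seteqP; split => // x [] /=.
  by rewrite !in_itv/= andbT => x0; rewrite ltNge x0.
Qed.

Lemma AC_integral_line f f' : AC f f' -> Rint setT f -> Rint setT f' ->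
  \int[leb]_x f' x = 0.
Proof.
move=> acf fi f'i; rewrite Rintegral_halves//.
rewrite Rintegral_itv_obnd_cbnd; last exact: RintS f'i.
by rewrite (AC_integral_left acf) ?(AC_integral_right acf) ?subrr//; apply: (RintS measurableT).
Qed.

(** A nonempty open set contains a ball and so is not null; it cannot lie inside the exceptional
    set. *)
Lemma ae_exists D (P : R -> Prop) p : open D -> D p -> {ae leb, forall x, P x} ->
  exists2 x, D x & P x.
Proof.
move=> oD Dp [N [mN N0 PN]].
have /nbhs_ballP[e /= e0 eD] : nbhs p D by exact: open_nbhs_nbhs.
apply/not_exists2P => H.
have sub : ball p e `<=` N.
  move=> x /eD Dx; apply: PN => /= Px; by case: (H x).
have : (leb (ball p e) <= leb N)%E.
  by apply: le_measure; rewrite ?inE//; exact: measurable_ball.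
have := lebesgue_measure_ball p (ltW e0); rewrite N0 => ->.
by rewrite lee_fin leNgt mulrn_wgt0.
Qed.

End ACinfinity.

(** * Weak derivatives *)

Section Derivatives.
Context {R : realType}.
Implicit Types (f g : R -> R) (x a b c : R).

Lemma dvD f g x a b : is_derive x 1 f a -> is_derive x 1 g b ->
  is_derive x 1 (fun y => f y + g y) (a + b).
Proof. exact: is_deriveD. Qed.

Lemma dvB f g x a b : is_derive x 1 f a -> is_derive x 1 g b ->
  is_derive x 1 (fun y => f y - g y) (a - b).
Proof. exact: is_deriveB. Qed.

Lemma dvN f x a : is_derive x 1 f a -> is_derive x 1 (fun y => - f y) (- a).
Proof. exact: is_deriveN. Qed.

Lemma dvM f g x a b : is_derive x 1 f a -> is_derive x 1 g b ->
  is_derive x 1 (fun y => f y * g y) (a * g x + f x * b).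
Proof.
move=> df dg; have := is_deriveM df dg.
by rewrite addrC (mulrC a).
Qed.

Lemma dvZ c f x a : is_derive x 1 f a -> is_derive x 1 (fun y => c * f y) (c * a).
Proof. exact: is_deriveZ. Qed.

Lemma dvV f x a : f x != 0 -> is_derive x 1 f a ->
  is_derive x 1 (fun y => (f y)^-1) (- a / f x ^+ 2).
Proof.
move=> fx0 df; split; first by apply: derivableV => //; case: df.
rewrite deriveV//.
rewrite (@derive_val _ _ _ _ _ _ _ df) /GRing.scale/= -exprVn; ring.
Qed.

Lemma dv_comp f g x a b : is_derive (g x) 1 f a -> is_derive x 1 g b ->
  is_derive x 1 (fun y => f (g y)) (a * b).
Proof. exact: is_derive1_comp. Qed.

Lemma dv_id x : is_derive x 1 (fun y => y) 1.
Proof. exact: is_derive_id. Qed.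

Lemma dv_cst c x : is_derive x 1 (fun=> c) 0.
Proof. exact: is_derive_cst. Qed.

Lemma dv_exp f x a : is_derive x 1 f a ->
  is_derive x 1 (fun y => expR (f y)) (a * expR (f x)).
Proof.
move=> df; rewrite mulrC; apply: (dv_comp (f := expR)) => //.
Qed.

Lemma dv_sqr f x a : is_derive x 1 f a ->
  is_derive x 1 (fun y => f y ^+ 2) (2 * f x * a).
Proof. by move=> df; have := is_deriveX 2 df; rewrite /= expr1. Qed.

Lemma dv_affine f c b x a : is_derive (c * x + b) 1 f a ->
  is_derive x 1 (fun y => f (c * y + b)) (c * a).
Proof.
move=> df; rewrite mulrC; apply: (@dv_comp f (fun y => c * y + b)) => //.
rewrite -[X in is_derive _ _ _ X]addr0 -[X in X + 0]mulr1.
exact: (dvD (dvZ c (dv_id x)) (dv_cst b x)).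
Qed.

Lemma dv_continuous f x a : is_derive x 1 f a -> {for x, continuous f}.
Proof.
by move=> df; apply/differentiable_continuous/derivable1_diffP; case: df.
Qed.

Lemma dv_derive1 f x a : is_derive x 1 f a -> derive1 f x = a.
Proof. by move=> df; rewrite derive1E; case: df. Qed.

Lemma derivable_dv f x : derivable f x 1 -> is_derive x 1 f (derive1 f x).
Proof. by move=> df; rewrite derive1E; split. Qed.

Lemma dv_zero f x c : (forall y, `|f y - f x| <= c * (y - x) ^+ 2) ->
  is_derive x 1 f 0.
Proof.
move=> H.
have L : h^-1 *: (f (h *: 1 + x) - f x) @[h --> 0^'] --> (0 : R).
  apply/cvgrPdist_le => e e0; near=> h.
  have h0 : h != 0 by near: h; exact: nbhs_dnbhs_neq.
  rewrite sub0r normrN normrZ normfV ler_pdivrMl ?normr_gt0//.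
  apply: le_trans (H _) _; rewrite addrK [h *: _]mulr1.
  rewrite -(real_normK (num_real h)) expr2 mulrA mulrC ler_wpM2l//.
  have c0 : 0 < `|c| + 1 by have := normr_ge0 c; lra.
  have : `|h| <= e / (`|c| + 1) by near: h; apply: dnbhs0_le; rewrite divr_gt0.
  rewrite ler_pdivlMr// => A; apply: le_trans A.
  rewrite mulrC ler_wpM2l//; have := ler_norm c; lra.
by split; [apply/cvg_ex; exists 0|exact: cvg_lim L].
Unshelve. all: by end_near. Qed.

Lemma mean_value f (df : R -> R) a b : a < b ->
  (forall t, a <= t <= b -> is_derive t 1 f (df t)) ->
  exists2 c, a < c < b & f b - f a = df c * (b - a).
Proof.
move=> ab dvf.
have [||c] := @MVT R f df a b ab.
- by move=> t; rewrite in_itv/= => /andP[at_ tb]; apply: dvf; rewrite !ltW.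
- apply: derivable_within_continuous => t; rewrite in_itv/= => tab.
  by case: (dvf t tab).
by rewrite in_itv/=; exists c.
Qed.

End Derivatives.

(** * Smooth functions and a bump function *)

Section Smooth.
Context {R : realType}.
Implicit Types (f g : R -> R) (p : {poly R}).

(** Induction principle that avoids formulas for iterated derivatives: smoothness is proved by
    exhibiting a class of differentiable functions stable under [derive1]. *)
Lemma smooth_class (C : (R -> R) -> Prop) :
  (forall f, C f -> (forall x, derivable f x 1) /\ C (derive1 f)) ->
  forall f, C f -> smooth f.
Proof.
move=> HC f Cf n; suff : C (iter n (@derive1 R R) f) by move=> /HC[].
by elim: n => //= n /HC[].
Qed.

Lemma smooth_derivable f (x : R) : smooth f -> derivable f x 1.
Proof. by move=> sf; exact: (sf 0%N). Qed.

Lemma smooth_derive1 f : smooth f -> smooth (derive1 f).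
Proof. by move=> sf n x; have := sf n.+1 x; rewrite iterSr. Qed.

Lemma smooth_dv f (x : R) : smooth f -> is_derive x 1 f (derive1 f x).
Proof. by move=> sf; apply/derivable_dv/smooth_derivable. Qed.

Lemma smooth_continuous f : smooth f -> continuous f.
Proof. by move=> sf x; apply: dv_continuous; exact: smooth_dv. Qed.

Lemma smooth_antiderivative f g : (forall x : R, is_derive x 1 f (g x)) -> smooth g ->
  smooth f.
Proof.
move=> dfg sg; have Ef : derive1 f = g by apply/funext => x; exact: dv_derive1.
by case=> [|n] x; [case: (dfg x)|rewrite iterSr Ef; exact: sg].
Qed.

Lemma smooth_affine f (k c d : R) : smooth f -> smooth (fun x => k * f (c * x + d)).
Proof.
move=> sf; apply: (smooth_class (C := fun h => exists k f, smooth f /\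
   h = (fun x => k * f (c * x + d)))); last by exists k, f.
move=> _ [{}k [{}f [{}sf ->]]].
have dv (x : R) : is_derive x 1 (fun x => k * f (c * x + d)) (k * (c * derive1 f (c * x + d))).
  by apply/dvZ/dv_affine; exact: smooth_dv.
split; first by move=> x; case: (dv x).
exists (k * c), (derive1 f); split; first exact: smooth_derive1.
by apply/funext => x; rewrite (dv_derive1 (dv x)) mulrA.
Qed.

Lemma smoothB f g : smooth f -> smooth g -> smooth (fun x => f x - g x).
Proof.
move=> sf sg; apply: (smooth_class (C := fun h => exists f g, [/\ smooth f, smooth g &
   h = (fun x => f x - g x)])); last by exists f, g.
move=> _ [{}f [{}g [{}sf {}sg ->]]].
have dv x := dvB (smooth_dv x sf) (smooth_dv x sg).
split; first by move=> x; case: (dv x).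
exists (derive1 f), (derive1 g); split; try exact: smooth_derive1.
by apply/funext => x; rewrite (dv_derive1 (dv x)).
Qed.

(** Products of smooth functions are not stable under differentiation, but finite sums of them are;
    this is the class fed to [smooth_class]. *)
Inductive sum_of_products : (R -> R) -> Prop :=
| Sop_prod f g : smooth f -> smooth g -> sum_of_products (fun x => f x * g x)
| Sop_add f g : sum_of_products f -> sum_of_products g ->
    sum_of_products (fun x => f x + g x).

Lemma smoothM f g : smooth f -> smooth g -> smooth (fun x => f x * g x).
Proof.
move=> sf sg; apply: (smooth_class (C := sum_of_products)); last exact: Sop_prod.
move=> h; elim=> {f g h sf sg} [f g sf sg|f g _ [df Cf] _ [dg Cg]].
  have dv x := dvM (smooth_dv x sf) (smooth_dv x sg).
  split; first by move=> x; case: (dv x).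
  rewrite (_ : derive1 _ = fun x => derive1 f x * g x + f x * derive1 g x); last first.
    by apply/funext => x; rewrite (dv_derive1 (dv x)).
  exact: (Sop_add (Sop_prod (smooth_derive1 sf) sg) (Sop_prod sf (smooth_derive1 sg))).
have dv x := dvD (derivable_dv (df x)) (derivable_dv (dg x)).
split; first by move=> x; case: (dv x).
rewrite (_ : derive1 _ = fun x => derive1 f x + derive1 g x); last first.
  by apply/funext => x; rewrite (dv_derive1 (dv x)).
exact: Sop_add.
Qed.

(* Indexed by polynomials so that the family is closed under differentiation. *)
Definition flat p (x : R) : R := if 0 < x then p.[x^-1] * expR (- x^-1) else 0.

Lemma expR_ge_pow n (y : R) : 0 <= y -> y ^+ n <= n`!%:R * expR y.
Proof.
move=> y0; case: n => [|n].
  by rewrite expr0 fact0 mul1r -expR0 ler_expR.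
have := expR_ge1Dxn n y0; have f0 : 0 < n.+1`!%:R :> R by rewrite ltr0n fact_gt0.
move=> H; have : y ^+ n.+1 / n.+1`!%:R <= expR y by lra.
by rewrite ler_pdivrMr// mulrC.
Qed.

Lemma poly_expR_bounded p : exists C : R, forall y, 0 <= y -> `|p.[y]| * expR (- y) <= C.
Proof.
exists (\sum_(i < size p) `|p`_i| * i`!%:R) => y y0.
rewrite expRN ler_pdivrMr ?expR_gt0// horner_coef mulr_suml.
apply: le_trans (ler_norm_sum _ _ _) _; apply: ler_sum => i _.
by rewrite normrM normrX (ger0_norm y0) -mulrA ler_wpM2l// expR_ge_pow.
Qed.

Lemma flat_dv p (x : R) : is_derive x 1 (flat p) (flat ('X^2 * (p - p^`())) x).
Proof.
have [x0|x0|<-] := ltgtP 0 x.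
- rewrite {2}/flat x0; pose g (t : R) := p.[t^-1] * expR (- t^-1).
  apply: (@near_eq_is_derive _ _ _ g).
    by near=> t; rewrite /g /flat ifT//; near: t; exact: lt_nbhsr.
  have x0' : x != 0 by rewrite gt_eqF.
  have dV := dvV (f := fun t => t) x0' (dv_id x).
  have d1 := @dv_comp _ (horner p) (fun t => t^-1) x _ _ (is_derive_poly p _) dV.
  have d2 := dv_exp (dvN dV).
  apply: is_derive_eq (dvM d1 d2) _.
  by rewrite hornerM hornerXn hornerD hornerN; field.
- rewrite (_ : flat _ x = 0); last by rewrite /flat ltNge ltW.
  apply: (@near_eq_is_derive _ _ _ (fun=> 0)).
    near=> t; rewrite /flat ifF//; apply/negbTE; rewrite -leNgt ltW//.
    by near: t; exact: lt_nbhsl.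
- rewrite [X in is_derive _ _ _ X](_ : _ = 0); last by rewrite /flat ltxx.
  (* Bounding ['X^2 * p] instead of [p] produces the factor [y ^+ 2] required by [dv_zero]. *)
  have [C HC] := poly_expR_bounded ('X^2 * p).
  have C0 : 0 <= C by apply: le_trans (HC 0 (lexx _)); rewrite mulr_ge0// expR_ge0.
  apply: (@dv_zero _ _ _ C) => y; rewrite /flat ltxx !subr0.
  case: ifPn => y0; last by rewrite normr0 mulr_ge0// sqr_ge0.
  have := HC y^-1; rewrite invr_ge0 ltW// => /(_ isT).
  rewrite hornerM hornerXn normrM (ger0_norm (x := y^-1 ^+ 2)) ?sqr_ge0// normrM.
  rewrite (ger0_norm (expR_ge0 _)) exprVn -mulrA.
  by rewrite mulrC ler_pdivrMr// exprn_gt0.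
Unshelve. all: by end_near. Qed.

Lemma flat_smooth p : smooth (flat p).
Proof.
apply: (smooth_class (C := fun f => exists p, f = flat p)); last by exists p.
move=> _ [{}p ->]; split; first by move=> x; case: (flat_dv p x).
exists ('X^2 * (p - p^`())); apply/funext => x; exact: (dv_derive1 (flat_dv p x)).
Qed.

Definition bump (x : R) : R := flat 1 (1 + x) * flat 1 (1 - x).

Lemma bump_smooth : smooth bump.
Proof.
have -> : bump = fun x => (1 * flat 1 (1 * x + 1)) * (1 * flat 1 (-1 * x + 1)).
  by apply/funext => x; rewrite /bump !mul1r mulN1r addrC (addrC 1 (- x)).
by apply: smoothM; apply: smooth_affine; exact: flat_smooth.
Qed.

Lemma bump_ge0 x : 0 <= bump x.
Proof.
by rewrite /bump /flat; apply: mulr_ge0; case: ifPn => // _; rewrite hornerE ?mul1r expR_ge0.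
Qed.

Lemma bump_gt0 x : `|x| < 1 -> 0 < bump x.
Proof.
rewrite ltr_norml => /andP[x1 x2]; rewrite /bump /flat !ifT; try lra.
by rewrite !hornerE ?mul1r !mulr_gt0 ?ltr01 ?expR_gt0.
Qed.

Lemma bump_eq0 x : 1 <= `|x| -> bump x = 0.
Proof.
rewrite ler_normr /bump /flat => /orP[x1|x1].
  by rewrite [X in _ * X]ifF ?mulr0//; apply/negbTE; rewrite -leNgt; lra.
by rewrite ifF ?mul0r//; apply/negbTE; rewrite -leNgt; lra.
Qed.

End Smooth.

(** * A smooth step function *)

Section Ramp.
Context {R : realType}.
Local Notation leb := (@lebesgue_measure R).

(** The base point -2 lies to the left of the support of [bump], so that every point from -1 on is
    interior for the fundamental theorem of calculus. *)
Let F (x : R) := \int[leb]_(t in `[-2, x]) bump t.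

Let F0 x : x <= -1 -> F x = 0.
Proof.
move=> x1; rewrite /F (@eq_Rintegral _ _ _ _ _ (fun=> 0)).
  by rewrite Rintegral_cst// mul0r.
move=> t /set_mem/=; rewrite in_itv/= => /andP[t2 tx].
by rewrite bump_eq0// ler0_norm; lra.
Qed.

Let dF (x : R) : is_derive x 1 F (bump x).
Proof.
have [x2|x2] := ltP x (-1).
  rewrite bump_eq0; last by rewrite ler0_norm; lra.
  apply: (@near_eq_is_derive _ _ _ (fun=> 0)).
  near=> t; rewrite F0// ltW//; near: t; exact: lt_nbhsl.
have [||||] := @continuous_FTC1_closed R bump (-2) x (x + 1).
- lra.
- exact/Rint_continuous/smooth_continuous/bump_smooth.
- lra.
- exact/smooth_continuous/bump_smooth.
by move=> d e; rewrite -e derive1E; split.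
Unshelve. all: by end_near. Qed.

Let F1_gt0 : 0 < F 1.
Proof.
have m1 : -1 < 1 :> R by lra.
have [c c1] := @mean_value _ F bump (-1) 1 m1 (fun t _ => dF t).
rewrite (F0 (lexx _)) subr0 => ->; apply: mulr_gt0; last lra.
by apply: bump_gt0; rewrite ltr_norml.
Qed.

(** Source of both families used below: its rescaled derivative is an approximate identity
    ([pulse]), and differences of two translates are test functions ([plateau]). *)
Definition ramp (x : R) : R := (F 1)^-1 * F x.

Lemma ramp_dv (x : R) : is_derive x 1 ramp ((F 1)^-1 * bump x).
Proof. exact: dvZ. Qed.

Lemma ramp_smooth : smooth ramp.
Proof.
apply: (smooth_antiderivative ramp_dv).
have -> : (fun x => (F 1)^-1 * bump x) = fun x => (F 1)^-1 * bump (1 * x + 0).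
  by apply/funext => x; rewrite mul1r addr0.
exact/smooth_affine/bump_smooth.
Qed.

Lemma ramp_derive1 x : derive1 ramp x = (F 1)^-1 * bump x.
Proof. exact: dv_derive1 (ramp_dv x). Qed.

Lemma ramp_derive1_eq0 x : 1 <= `|x| -> derive1 ramp x = 0.
Proof. by move=> x1; rewrite ramp_derive1 bump_eq0// mulr0. Qed.

Lemma ramp_eq0 x : x <= -1 -> ramp x = 0.
Proof. by move=> x1; rewrite /ramp (F0 x1) mulr0. Qed.

Lemma ramp_eq1 x : 1 <= x -> ramp x = 1.
Proof.
have r1 : ramp 1 = 1 by rewrite /ramp mulVf// gt_eqF.
rewrite le_eqVlt => /predU1P[<-//|x1].
have [c c1 /eqP] := @mean_value _ ramp _ 1 x x1 (fun t _ => ramp_dv t).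
rewrite (bump_eq0 (x := c)); last by rewrite ger0_norm; lra.
by rewrite mulr0 mul0r r1 subr_eq0 => /eqP.
Qed.

Lemma ramp_ndecr : {homo ramp : x y / x <= y}.
Proof.
move=> x y; rewrite le_eqVlt => /predU1P[<-//|xy].
have [c _ e] := @mean_value _ ramp _ x y xy (fun t _ => ramp_dv t).
rewrite -subr_ge0 e; apply: mulr_ge0; last by rewrite subr_ge0 ltW.
by apply: mulr_ge0 (bump_ge0 _); rewrite invr_ge0 ltW.
Qed.

Lemma ramp_ge0 x : 0 <= ramp x.
Proof.
have [x1|x1] := leP x (-1); first by rewrite ramp_eq0.
by rewrite -(ramp_eq0 (lexx (-1))) ramp_ndecr// ltW.
Qed.

Lemma ramp_le1 x : ramp x <= 1.
Proof.
have [x1|x1] := leP 1 x; first by rewrite ramp_eq1.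
by rewrite -(ramp_eq1 (lexx 1)) ramp_ndecr// ltW.
Qed.

Lemma ramp_derive1_bounded : exists2 C : R, 0 < C & forall x, `|derive1 ramp x| <= C.
Proof.
exists (F 1)^-1; first by rewrite invr_gt0.
move=> x; rewrite ramp_derive1 normrM ger0_norm; last by rewrite invr_ge0 ltW.
rewrite ger0_norm ?bump_ge0//; apply: ler_piMr; first by rewrite invr_ge0 ltW.
rewrite /bump /flat; case: ifPn => x1; case: ifPn => x2; rewrite ?mulr0 ?mul0r//.
rewrite -!polyC1 !hornerC !mul1r. rewrite mulr_ile1 ?expR_ge0// expR_le1 oppr_le0 invr_ge0; lra.
Qed.

End Ramp.

(** * Increments of a function from its weak derivative *)

Section WeakDerivative.
Context {R : realType}.
Local Notation leb := (@lebesgue_measure R).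
Implicit Types (f u v : R -> R) (D : set R).

Lemma Rintegral_support D E f : E `<=` D -> (forall x, D x -> ~ E x -> f x = 0) ->
  \int[leb]_(x in D) f x = \int[leb]_(x in E) f x.
Proof.
move=> ED f0; rewrite -[in RHS](setIidr ED) Rintegral_mkcondr.
apply: eq_Rintegral => x /set_mem Dx; rewrite patchE; case: ifPn => // /negP Ex.
by apply: f0 => // ?; apply: Ex; exact/mem_set.
Qed.

(** Approximate identity at [x]: a derivative of mass one concentrated within [k^-1] of [x]. *)
Definition pulse (k x t : R) := k * derive1 ramp (k * (t - x)).

Lemma step_smooth (k x : R) : smooth (fun t => ramp (k * (t - x))).
Proof.
rewrite (_ : (fun _ => _) = fun t => 1 * ramp (k * t + - (k * x))).
  exact/smooth_affine/ramp_smooth.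
by apply/funext => t; rewrite mul1r mulrBr.
Qed.

Lemma pulse_derive1 (k x : R) : derive1 (fun t => ramp (k * (t - x))) = pulse k x.
Proof.
apply/funext => t; apply: dv_derive1.
rewrite (_ : (fun _ => _) = fun t => ramp (k * t + - (k * x))); last first.
  by apply/funext => s; rewrite mulrBr.
by rewrite /pulse mulrBr; apply: dv_affine; exact: smooth_dv ramp_smooth.
Qed.

Lemma pulse_continuous (k x : R) : continuous (pulse k x).
Proof. by rewrite -pulse_derive1; exact/smooth_continuous/smooth_derive1/step_smooth. Qed.

Lemma pulse_eq0 (k x t : R) : 0 < k -> k^-1 <= `|t - x| -> pulse k x t = 0.
Proof.
move=> k0 kt; rewrite /pulse ramp_derive1_eq0 ?mulr0//.
by rewrite normrM (gtr0_norm k0) mulrC -ler_pdivrMr// div1r.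
Qed.

Lemma pulse_integral (k x a b : R) : 0 < k -> a <= x - k^-1 -> x + k^-1 <= b ->
  \int[leb]_(t in `[a, b]) pulse k x t = 1.
Proof.
move=> k0 ax xb; have ki : 0 < k^-1 by rewrite invr_gt0.
have ac : AC (fun t => ramp (k * (t - x))) (pulse k x).
  apply: AC_C1; last exact: pulse_continuous.
  by move=> t; rewrite -pulse_derive1; exact/smooth_dv/step_smooth.
have ab : a <= b by lra.
have [_ <-] := ac _ _ ab.
rewrite ramp_eq1; last by rewrite -ler_pdivrMl// mulr1; lra.
rewrite ramp_eq0 ?subr0//.
by rewrite -ler_pdivlMl// mulrN1; lra.
Qed.

Lemma pulse_lebesgue_pt f (x a b : R) : a < x < b -> Rint `[a, b] f -> lebesgue_pt f x ->
  \int[leb]_(t in `[a, b]) (f t * pulse n.+1%:R x t) @[n --> \oo] --> f x.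
Proof.
move=> /andP[ax xb] fi fx; have [C C0 HC] := @ramp_derive1_bounded R.
apply/cvgrPdist_lt => e e0.
(* On the ball of radius [k^-1] the pulse is at most [k * C], while [davg] is [k / 2] times the
   integral over that ball; the quotient of the two factors is [2 * C]. *)
have eC : 0 < e / (2 * C) by rewrite divr_gt0// mulr_gt0.
have /fine_cvgP[_ /cvgrPdist_lt/(_ _ eC)[d /= d0 Hd]] := fx.
pose d' := Num.min d (Num.min (x - a) (b - x)).
have d'0 : 0 < d' by rewrite !lt_min d0/=; apply/andP; split; lra.
near=> n.
have : n.+1%:R^-1 < d'.
  near: n; have /cvgrPdist_lt/(_ _ d'0) := @cvg_harmonic R; apply: filterS => n /=.
  by rewrite sub0r normrN ger0_norm ?harmonic_ge0.
set k := n.+1%:R; have k0 : 0 < k by rewrite ltr0n.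
have ki : 0 < k^-1 by rewrite invr_gt0.
rewrite /d' !lt_min => /andP[kd /andP[kxa kbx]].
have kb : ball_ Num.norm 0 d k^-1 by rewrite /ball_/= sub0r normrN gtr0_norm.
have := Hd _ kb ki; rewrite sub0r normrN => Hdavg.
have pi : Rint `[a, b] (fun t => f t * pulse k x t) by apply: Rint_mulc => //; exact: pulse_continuous.
have fxi : Rint `[a, b] (fun t => f t - f x) by apply: RintB => //; exact/Rint_continuous/cst_continuous.
have E : f x - \int[leb]_(t in `[a, b]) (f t * pulse k x t) =
    - \int[leb]_(t in `[a, b]) ((f t - f x) * pulse k x t).
  have -> : \int[leb]_(t in `[a, b]) ((f t - f x) * pulse k x t) =
    \int[leb]_(t in `[a, b]) (f t * pulse k x t - f x * pulse k x t).
    by apply: eq_Rintegral => t _; rewrite mulrBl.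
  have ip : Rint `[a, b] (pulse k x) by exact/Rint_continuous/pulse_continuous.
  rewrite RintegralB//; last exact: RintZ.
  have l1 : a <= x - k^-1 by rewrite ltW// ltrBrDl -ltrBrDr.
  have l2 : x + k^-1 <= b by rewrite ltW// -ltrBrDl.
  by rewrite RintegralZl// (pulse_integral k0 l1 l2); ring.
rewrite E normrN.
have pfi : Rint `[a, b] (fun t => (f t - f x) * pulse k x t).
  by apply: Rint_mulc => //; exact: pulse_continuous.
apply: le_lt_trans (le_normr_Rintegral _ _) _ => //.
have sub : ball x k^-1 `<=` `[a, b]%classic.
  move=> t; rewrite ball_itv /= !in_itv/= => /andP[? ?].
  by apply/andP; split; [rewrite ltW// (lt_trans _ (_ : x - k^-1 < t))// ltrBrDl -ltrBrDr|rewrite ltW// (@lt_trans _ _ (x + k^-1))// -ltrBrDl].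
rewrite (Rintegral_support sub); last first.
  move=> t _; rewrite /ball/= => /negP; rewrite -leNgt distrC => kt.
  by rewrite pulse_eq0// mulr0 normr0.
have mb : measurable (ball x k^-1) by exact: measurable_ball.
have fbi : Rint (ball x k^-1) (fun t => `|f t - f x|).
  by apply: Rint_abs; exact: RintS fxi.
apply: (@le_lt_trans _ _ (\int[leb]_(t in ball x k^-1) (k * C * `|f t - f x|))).
  apply: le_Rintegral => //.
  - by apply: Rint_abs; exact: RintS pfi.
  - exact: RintZ.
  - move=> t _; rewrite normrM mulrC ler_wpM2r// /pulse normrM (gtr0_norm k0).
    by rewrite ler_wpM2l// ltW.
rewrite RintegralZl//.
have : `|fine (davg f x k^-1)| = k / 2 * \int[leb]_(t in ball x k^-1) `|f t - f x|.
  rewrite /davg /iavg /= (lebesgue_measure_ball _ (ltW ki)).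
  rewrite -[X in (_ * X)%E]fineK; last exact: integrable_fin_num fbi.
  rewrite inver mulrn_eq0/= gt_eqF// -EFinM/= ger0_norm.
    by congr (_ * _); rewrite -(mulr_natr k^-1) invfM invrK.
  apply: mulr_ge0; first by rewrite invr_ge0 mulrn_wge0// ltW.
  by apply: fine_ge0; apply: integral_ge0 => t _; rewrite lee_fin.
move=> D; move: Hdavg; rewrite D ltr_pdivlMr; last by rewrite mulr_gt0.
by apply: le_lt_trans; rewrite le_eqVlt; apply/predU1P; left; field.
Unshelve. all: by end_near. Qed.

(** Smooth approximation of the indicator of [x, y]. Its derivative is a pulse at [x] minus a pulse
    at [y], which makes it the test function that reads off an increment. *)
Definition plateau (x y k t : R) := ramp (k * (t - x)) - ramp (k * (t - y)).

Lemma plateau_smooth x y k : smooth (plateau x y k).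
Proof. by apply: smoothB; exact: step_smooth. Qed.

Lemma plateau_derive1 x y k t : derive1 (plateau x y k) t = pulse k x t - pulse k y t.
Proof.
rewrite -!pulse_derive1; apply: dv_derive1.
by apply: dvB; apply: smooth_dv; exact: step_smooth.
Qed.

Lemma plateau_bounded x y k t : `|plateau x y k t| <= 1.
Proof.
rewrite /plateau ler_norml.
have := @ramp_ge0 R; have := @ramp_le1 R => H1 H2.
have := H1 (k * (t - x)); have := H1 (k * (t - y)).
have := H2 (k * (t - x)); have := H2 (k * (t - y)); lra.
Qed.

Lemma plateau_eq0 x y k t : 0 < k -> x <= y -> t < x - k^-1 \/ y + k^-1 < t ->
  plateau x y k t = 0.
Proof.
move=> k0 xy; rewrite /plateau => -[tx|ty].
  have h : t - x < - k^-1 by lra.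
  have h' : t - y < - k^-1 by lra.
  by rewrite !ramp_eq0 ?subrr// -ler_pdivlMl// mulrN1 ltW.
have h : k^-1 < t - x by lra.
have h' : k^-1 < t - y by lra.
by rewrite !ramp_eq1 ?subrr// -ler_pdivrMl// mulr1 ltW.
Qed.

Lemma plateau_cvg x y t : x < y -> t != x -> t != y ->
  plateau x y n.+1%:R t @[n --> \oo] --> (\1_(`[x, y]%classic) t : R).
Proof.
move=> xy tx ty.
have far c : t != c -> \forall n \near \oo, n.+1%:R^-1 < `|t - c|.
  move=> tc; have tc0 : 0 < `|t - c| by rewrite normr_gt0 subr_eq0.
  have /cvgrPdist_lt/(_ _ tc0) := @cvg_harmonic R; apply: filterS => n /=.
  by rewrite sub0r normrN ger0_norm ?harmonic_ge0.
have st (n : nat) c : n.+1%:R^-1 < `|t - c| ->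
    ramp (n.+1%:R * (t - c)) = (c < t)%R%:R :> R.
  have k0 : (0 : R) < n.+1%:R by rewrite ltr0n.
  have [ct|tc|->] := ltgtP c t.
  - by rewrite ger0_norm ?subr_ge0 1?ltW// => h; rewrite ramp_eq1// -ler_pdivrMl// mulr1 ltW.
  - rewrite ler0_norm ?subr_le0 1?ltW// => h; rewrite ramp_eq0// -ler_pdivlMl// mulrN1.
    by rewrite lerNr ltW.
  - by rewrite subrr normr0 invr_lt0 ltNge (ltW k0).
apply: (@cvg_trans _ ((fun=> (\1_(`[x, y]%classic) t : R)) @ \oo)); last exact: cvg_cst.
apply: near_eq_cvg; near=> n.
rewrite /plateau !st; [|by near: n; exact: far..].
rewrite indicE; case: (boolP (t \in _)).
  rewrite inE/= in_itv/= => /andP[xt ty'].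
  by rewrite lt_neqAle eq_sym tx xt/= ltNge ty' subr0.
rewrite notin_setE/= in_itv/= => /negP; rewrite negb_and -!ltNge => /orP[h|h].
  by rewrite ltNge (ltW h) ltNge (ltW (lt_trans h xy)) subrr.
by rewrite h (lt_trans xy h) subrr.
Unshelve. all: by end_near. Qed.

Lemma ae_neq (x : R) : {ae leb, forall t, t != x}.
Proof.
exists [set x]; split => //; first exact: lebesgue_measure_set1.
by move=> t /= /negP; rewrite negbK => /eqP.
Qed.

(** Testing with [plateau x y k] equates a difference of two pulse averages of [u] with minus a
    truncated integral of [v]. As k grows, the averages converge at Lebesgue points and the plateau,
    bounded by 1, converges off the two endpoints. *)
Lemma weak_deriv_increment D u v (a x y b : R) : measurable D ->
  a < x -> x < y -> y < b -> `[a, b]%classic `<=` D ->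
  Rint `[a, b] u -> Rint `[a, b] v -> weak_deriv D u v ->
  lebesgue_pt u x -> lebesgue_pt u y ->
  u y - u x = \int[leb]_(t in `[x, y]) v t.
Proof.
move=> mD ax xy yb abD ui vi wd ux uy.
have lx : a < x < b by rewrite ax (lt_trans xy).
have ly : a < y < b by rewrite yb (lt_trans ax).
have cvL := cvgB (pulse_lebesgue_pt lx ui ux) (pulse_lebesgue_pt ly ui uy).
have cvR : \int[leb]_(t in `[a, b]) (v t * plateau x y n.+1%:R t) @[n --> \oo] -->
    \int[leb]_(t in `[x, y]) v t.
  have -> : \int[leb]_(t in `[x, y]) v t =
    \int[leb]_(t in `[a, b]) (v t * (\1_(`[x, y]%classic) t : R)).
    rewrite -[in LHS](@setIidr _ `[a, b] `[x, y]); last first.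
      by apply: subset_itv; rewrite bnd_simp ltW.
    rewrite Rintegral_mkcondr; apply: eq_Rintegral => t _.
    by rewrite patchE indicE; case: ifP => _; rewrite ?mulr1 ?mulr0.
  have m1 : measurable_fun `[a, b] (\1_(`[x, y]%classic) : R -> R).
    exact: measurable_indic.
  have mv := Rint_measurable vi.
  apply: fine_cvg; rewrite fineK; last first.
    apply: integrable_fin_num => //; apply: (Rint_le _ _ (Rint_abs vi)) => //.
      exact: measurable_funM.
    by move=> t _; rewrite normrM ler_piMr// indicE; case: (_ \in _); rewrite /= ?normr1 ?normr0 ?lexx ?ler01.
  have [|||||_ _ //] := @dominated_convergence _ _ _ leb `[a, b] (measurable_itv _)
    (fun n t => (v t * plateau x y n.+1%:R t)%:E)
    (fun t => (v t * (\1_(`[x, y]%classic) t : R))%:E) (fun t => `|v t|%:E).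
  - move=> n; apply/measurable_EFinP; apply: measurable_funM => //.
    apply: (measurable_funS measurableT) => //; apply: continuous_measurable_fun.
    exact/smooth_continuous/plateau_smooth.
  - by apply/measurable_EFinP; exact: measurable_funM.
  - apply: (@filterS2 _ _ (ae_filter_ringOfSetsType leb) _ _ _ _ (ae_neq x) (ae_neq y)).
    move=> s sx sy _ /=; apply: cvg_EFin; first exact: nearW.
    by apply: cvgM; [exact: cvg_cst|exact: plateau_cvg].
  - exact: Rint_abs.
  - apply: aeW; move=> s n _; rewrite /= lee_fin normrM ler_piMr//.
    exact: plateau_bounded.
have eqn : \forall n \near \oo,
    (\int[leb]_(t in `[a, b]) (u t * pulse n.+1%:R x t)) -
    (\int[leb]_(t in `[a, b]) (u t * pulse n.+1%:R y t)) =
    - (\int[leb]_(t in `[a, b]) (v t * plateau x y n.+1%:R t)).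
  pose d := Num.min (x - a) (b - y).
  have d0 : 0 < d by rewrite lt_min; apply/andP; split; lra.
  near=> n.
  have : n.+1%:R^-1 < d.
    near: n; have /cvgrPdist_lt/(_ _ d0) := @cvg_harmonic R; apply: filterS => n /=.
    by rewrite sub0r normrN ger0_norm ?harmonic_ge0.
  have : (0 : R) < n.+1%:R by rewrite ltr0n.
  move: (n.+1%:R : R) => k k0; rewrite /d lt_min => /andP[k1 k2].
  rewrite -RintegralB//; last 2 first.
  - by apply: Rint_mulc => //; exact: pulse_continuous.
  - by apply: Rint_mulc => //; exact: pulse_continuous.
  have out t : D t -> ~ `[a, b]%classic t -> t < x - k^-1 \/ y + k^-1 < t.
    move=> _ /negP; rewrite /= in_itv/= negb_and -!ltNge => /orP[h|h]; [left|right]; lra.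
  have tf : test_fun D (plateau x y k).
    split; first exact: plateau_smooth.
    exists (x - k^-1), (y + k^-1); split => [t /= ht|t]; last exact: plateau_eq0 (ltW xy).
    by apply: abD => /=; rewrite in_itv/=; lra.
  have := congr1 fine (wd _ tf); rewrite fineN.
  rewrite -/(Rintegral leb D (fun t => v t * plateau x y k t)).
  rewrite -/(Rintegral leb D (fun t => u t * derive1 (plateau x y k) t)).
  rewrite (Rintegral_support abD); last first.
    move=> t Dt nt; rewrite plateau_derive1.
    have ki : 0 < k^-1 by rewrite invr_gt0.
    have far c : x <= c <= y -> k^-1 <= `|t - c|.
      by move=> /andP[? ?]; case: (out _ Dt nt) => h; rewrite ler_normr; apply/orP;
        [right|left]; lra.
    by rewrite !pulse_eq0 ?subrr ?mulr0// far//; lra.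
  rewrite (Rintegral_support abD); last first.
    by move=> t Dt nt; rewrite (plateau_eq0 k0 (ltW xy) (out _ Dt nt)) mulr0.
  move=> <-; apply: eq_Rintegral => t _.
  by rewrite plateau_derive1 mulrBr.
have H1 : - (\int[leb]_(t in `[a, b]) (v t * plateau x y n.+1%:R t)) @[n --> \oo] -->
    u x - u y by apply: cvg_trans (near_eq_cvg eqn) _; exact: cvL.
have H2 : - (\int[leb]_(t in `[a, b]) (v t * plateau x y n.+1%:R t)) @[n --> \oo] -->
    - \int[leb]_(t in `[x, y]) v t by exact: cvgN.
have := cvg_lim (@Rhausdorff R) H1; rewrite (cvg_lim (@Rhausdorff R) H2).
by move=> E; rewrite -opprB -E opprK.
Unshelve. all: by end_near. Qed.

End WeakDerivative.

(** * Absolutely continuous representatives *)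

Section WeakAC.
Context {R : realType}.
Local Notation leb := (@lebesgue_measure R).
Implicit Types (u v w : R -> R) (D : set R).

Lemma L2on_measurable_restrict D u : measurable D -> L2on D u ->
  measurable_fun setT (u \_ D).
Proof.
move=> mD [mu_ _]; apply/(measurable_restrictT _ _).1 => //.
Qed.

Lemma L2on_Rint_restrict D u a b : measurable D -> L2on D u -> Rint `[a, b] (u \_ D).
Proof.
move=> mD u2; have mu_ := L2on_measurable_restrict mD u2; case: u2 => _ u2.
have i2 : Rint setT ((fun x => u x ^+ 2) \_ D).
  by move: u2; rewrite integrable_mkcond// restrict_EFin.
apply: (@Rint_le _ _ _ (fun x => 1 + ((fun x => u x ^+ 2) \_ D) x)) => //.
- exact: (measurable_funS measurableT).
- apply: RintD => //; first exact/Rint_continuous/cst_continuous.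
  exact: RintS i2.
- move=> x _; rewrite !patchE; case: ifP => _; last by rewrite normr0 addr0.
  have := sqr_ge0 (`|u x| - 1); rewrite sqrrB real_normK ?num_real//.
  have := normr_ge0 (u x); lra.
Qed.

Lemma L2on_locally_integrable D u : measurable D -> L2on D u ->
  locally_integrable setT (u \_ D).
Proof.
move=> mD u2; split; [exact: L2on_measurable_restrict|exact: openT|].
move=> K _ cK; have /compact_bounded [M [Mr HM]] := cK.
have sub : K `<=` `[- (M + 1), M + 1]%classic.
  have M1 : M < M + 1 by rewrite ltrDl.
  by move=> x Kx; have /= := HM (M + 1) M1 x Kx; rewrite ler_norml in_itv/=.
have /integrableP[_] := RintS (measurable_itv _) (compact_measurable cK) sub
  (L2on_Rint_restrict (- (M + 1)) (M + 1) mD u2).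
by [].
Qed.

Lemma open_below D x : open D -> D x -> exists2 a, a < x & D a.
Proof.
move=> oD Dx; have /nbhs_ballP[e /= e0 eD] : nbhs x D by exact: open_nbhs_nbhs.
exists (x - e / 2); first lra.
by apply: eD; rewrite /ball/= opprB addrC subrK gtr0_norm; lra.
Qed.

Lemma open_above D x : open D -> D x -> exists2 b, x < b & D b.
Proof.
move=> oD Dx; have /nbhs_ballP[e /= e0 eD] : nbhs x D by exact: open_nbhs_nbhs.
exists (x + e / 2); first lra.
by apply: eD; rewrite /ball/= opprD addrA subrr sub0r normrN gtr0_norm; lra.
Qed.

(** The representative is the integral of [v] from one Lebesgue point of [u]; it agrees with [u] at
    every Lebesgue point in [D]. Since [v] is extended by zero, [w] is absolutely continuous on the
    whole line, in particular at an endpoint of [D], where boundary values are read. *)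
Lemma weak_deriv_AC D u v p : open D -> D p ->
  (forall x y, D x -> D y -> `[x, y]%classic `<=` D) ->
  L2on D u -> L2on D v -> weak_deriv D u v ->
  exists2 w, AC w (v \_ D) & {ae leb, forall x, D x -> u x = w x}.
Proof.
move=> oD Dp cD u2 v2 wd; have mD : measurable D by exact: open_measurable.
have wd0 : weak_deriv D (u \_ D) (v \_ D).
  move=> phi /wd E; transitivity (\int[leb]_(x in D) (u x * derive1 phi x)%:E)%E.
    by apply: eq_integral => x Dx; rewrite patchE Dx.
  by rewrite E; congr (- _)%E; apply: eq_integral => x Dx; rewrite patchE Dx.
have aeL := lebesgue_differentiation (L2on_locally_integrable mD u2).
have ui a b := L2on_Rint_restrict a b mD u2.
have vi a b := L2on_Rint_restrict a b mD v2.
have [x0 Dx0 Lx0] := ae_exists oD Dp aeL.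
have incr x y : D x -> D y -> lebesgue_pt (u \_ D) x -> lebesgue_pt (u \_ D) y -> x < y ->
    (u \_ D) y - (u \_ D) x = \int[leb]_(t in `[x, y]) (v \_ D) t.
  move=> Dx Dy Lx Ly xy.
  have [a ax Da] := open_below oD Dx; have [b yb Db] := open_above oD Dy.
  exact: (weak_deriv_increment mD ax xy yb (cD _ _ Da Db) (ui _ _) (vi _ _) wd0 Lx Ly).
set v0 := v \_ D in incr vi *.
pose w t := (u \_ D) x0 + (if x0 <= t then \int[leb]_(s in `[x0, t]) v0 s
                           else - \int[leb]_(s in `[t, x0]) v0 s).
exists w.
  move=> a b ab; split => //; rewrite /w.
  have [xa|ax] := leP x0 a.
    rewrite (le_trans xa ab) (Rintegral_cat xa ab (vi _ _)); ring.
  have [xb|bx] := leP x0 b.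
    rewrite (Rintegral_cat (ltW ax) xb (vi _ _)); ring.
  rewrite (Rintegral_cat ab (ltW bx) (vi _ _)); ring.
apply: (@filterS _ _ (ae_filter_ringOfSetsType leb) _ _ _ aeL) => x Lx Dx.
have ux : (u \_ D) x = u x by rewrite patchE mem_set.
rewrite /w -ux; have [xx|xx|<-] := ltgtP x0 x.
- by rewrite -(incr _ _ Dx0 Dx Lx0 Lx xx) addrC subrK.
- by rewrite -(incr _ _ Dx Dx0 Lx Lx0 xx); ring.
- by rewrite set_itv1 Rintegral_set1 addr0.
Qed.

End WeakAC.

(** * The Laplace integral *)

Section Kernel.
Context {R : realType}.
Local Notation leb := (@lebesgue_measure R).
Implicit Types (q x y c : R).

(** An integrable majorant of order e^(-c|y|), chosen because it is smooth, even and has an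
    elementary antiderivative. *)
Definition hump c y : R := expR (c * y) / (1 + expR (c * y)) ^+ 2.

Let den_gt0 c y : 0 < 1 + expR (c * y).
Proof. by rewrite ltr_wpDl// expR_gt0. Qed.

Lemma hump_ge0 c y : 0 <= hump c y.
Proof. by rewrite divr_ge0 ?expR_ge0// sqr_ge0. Qed.

Lemma dv_lin c y : is_derive y 1 (fun y : R => c * y) c.
Proof. by have := dvZ c (dv_id y); rewrite mulr1. Qed.

Lemma hump_dv c y : c != 0 -> is_derive y 1 (fun y => - (c * (1 + expR (c * y)))^-1) (hump c y).
Proof.
move=> c0; have d0 : c * (1 + expR (c * y)) != 0 by rewrite mulf_neq0// gt_eqF.
have d1 := dvZ c (dvD (dv_cst 1 y) (dv_exp (dv_lin c y))).
apply: (is_derive_eq (dvN (dvV (f := fun y => c * (1 + expR (c * y))) d0 d1))).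
by rewrite /hump; field; rewrite c0 gt_eqF.
Qed.

Lemma hump_continuous c : continuous (hump c).
Proof.
move=> y; have de := dv_exp (dv_lin c y).
have n0 : (1 + expR (c * y)) ^+ 2 != 0 by rewrite expf_neq0// gt_eqF.
exact: dv_continuous (dvM de (dvV (f := fun y => (1 + expR (c * y)) ^+ 2) n0
  (dv_sqr (dvD (dv_cst 1 y) de)))).
Qed.

Lemma hump_even c : hump c =1 hump c \o -%R.
Proof.
move=> y; rewrite /hump /= mulrN expRN; field.
by rewrite gt_eqF ?expR_gt0//= gt_eqF//= addrC gt_eqF.
Qed.

Lemma hump_Rint c : 0 < c -> Rint setT (hump c).
Proof.
move=> c0; apply/integrableP; split.
  apply/measurable_EFinP; exact: continuous_measurable_fun (@hump_continuous c).
under eq_integral do rewrite /= ger0_norm ?hump_ge0//.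
rewrite (ge0_symfun_integralT (hump_ge0 c) (@hump_continuous c) (hump_even c)).
rewrite (_ : [set x | (0 <= x)%R] = `[0, +oo[%classic); last by rewrite set_itvcy.
rewrite (@ge0_continuous_FTC2y _ (hump c) (fun y => - (c * (1 + expR (c * y)))^-1) 0 0).
- by rewrite -EFinB -EFinM ltry.
- by move=> ? _; exact: hump_ge0.
- exact: continuous_subspaceT (@hump_continuous c).
- rewrite -[X in _ --> X]oppr0; apply: cvgN.
  apply/gtr0_cvgV0.
    by near=> y; rewrite mulr_gt0.
  apply: (@ger_cvgy _ _ _ _ (fun y => c * (c * y))); last first.
    by apply: gt0_cvgMry => //; apply: gt0_cvgMry => //; exact: cvg_id.
  near=> y; rewrite ler_pM2l//.
  have := expR_ge1Dx (c * y); lra.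
- by move=> y _; case: (hump_dv y (lt0r_neq0 c0)).
- apply: cvg_at_right_filter; exact: dv_continuous (hump_dv 0 (lt0r_neq0 c0)).
- by move=> y _; rewrite derive1E; case: (hump_dv y (lt0r_neq0 c0)).
Unshelve. all: by end_near. Qed.

(* exp (- x^2 / 2) times the integral of kern q x over y solves - U'' + x^2 U = (1 - 2 q) U: it is the
   integral representation of the parabolic cylinder function after the substitution s = exp y. *)
Definition kern q x y : R := expR (q * y - expR y ^+ 2 / 4 - x * expR y).

Lemma kern_gt0 q x y : 0 < kern q x y. Proof. exact: expR_gt0. Qed.

Lemma kern_ge0 q x y : 0 <= kern q x y. Proof. exact: expR_ge0. Qed.

(** From y <= e^y the denominator of [hump] is at most 4 exp(2 q e^y). With s = e^y the remaining
    exponent is (2 q - x) s - s^2 / 4, and completing the square bounds it by (2 q - x)^2. *)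
Lemma kern_hump q x y : 0 < q -> kern q x y <= 4 * expR ((2 * q - x) ^+ 2) * hump q y.
Proof.
move=> q0; rewrite /hump mulrA ler_pdivlMr ?exprn_gt0//.
have ys : y <= expR y by have := expR_ge1Dx y; lra.
have B : (1 + expR (q * y)) ^+ 2 <= (2 * expR (q * expR y)) ^+ 2.
  rewrite ler_sqr ?nnegrE ?mulr_ge0 ?expR_ge0 ?(ltW (den_gt0 _ _))//.
  have : 1 <= expR (q * expR y) by rewrite -expR0 ler_expR mulr_ge0 ?expR_ge0// ltW.
  have : expR (q * y) <= expR (q * expR y) by rewrite ler_expR ler_pM2l.
  lra.
apply: le_trans (ler_wpM2l (kern_ge0 q x y) B) _.
rewrite exprMn -expRM_natl /kern mulrCA -expRD -mulrA -expRD.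
rewrite (_ : 2 ^+ 2 = 4 :> R); last by rewrite expr2; ring.
rewrite ler_pM2l// ler_expR.
have := sqr_ge0 (2 * q - x - expR y / 2); nra.
Qed.

Lemma kern_continuous q x : continuous (kern q x).
Proof.
move=> y; have d := is_derive_expR y.
exact: dv_continuous (dv_exp (dvB (dvB (dv_lin q y) (dvM (dv_sqr d) (dv_cst _ y))) (dvZ x d))).
Qed.

Lemma kern_measurable D q x : measurable_fun D (kern q x).
Proof.
apply: (measurable_funS measurableT) => //.
exact: continuous_measurable_fun (@kern_continuous q x).
Qed.

Lemma kern_Rint q x : 0 < q -> Rint setT (kern q x).
Proof.
move=> q0; apply: (Rint_le _ _ (RintZ (4 * expR ((2 * q - x) ^+ 2)) _ (hump_Rint q0))) => //.
  exact: kern_measurable.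
by move=> y _; rewrite ger0_norm ?kern_ge0// kern_hump.
Qed.

(* The logarithmic factor and a small change of exponent are absorbed by shifting the exponent q both ways. *)
Lemma kern_bound q e x0 q' x' y : 0 < e -> `|q' - q| <= e -> x0 <= x' ->
  (1 + e * `|y|) * kern q' x' y <= kern (q - 2 * e) x0 y + kern (q + 2 * e) x0 y.
Proof.
move=> e0 qq xx.
have H1 : 1 + e * `|y| <= expR (e * `|y|) by exact: expR_ge1Dx.
have H2 : kern q' x' y <= expR (e * `|y|) * kern q x0 y.
  rewrite /kern -expRD ler_expR.
  have A : (q' - q) * y <= e * `|y|.
    by apply: le_trans (ler_norm _) _; rewrite normrM ler_wpM2r.
  have B : x0 * expR y <= x' * expR y by rewrite ler_wpM2r// expR_ge0.
  nra.
apply: (@le_trans _ _ (expR (e * `|y|) * (expR (e * `|y|) * kern q x0 y))).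
  by apply: ler_pM => //; rewrite ?kern_ge0// addr_ge0// mulr_ge0// ltW.
rewrite /kern -!expRD; have [y0|y0] := leP 0 y.
  apply: (@le_trans _ _ (0 + kern (q + 2 * e) x0 y)); last first.
    by rewrite lerD2r kern_ge0.
  by rewrite add0r ler_expR ger0_norm//; nra.
apply: (@le_trans _ _ (kern (q - 2 * e) x0 y + 0)); last first.
  by rewrite lerD2l kern_ge0.
by rewrite addr0 ler_expR ler0_norm; nra.
Qed.

Lemma ykern_Rint q x : 0 < q -> Rint setT (fun y => y * kern q x y).
Proof.
move=> q0; have e0 : 0 < q / 4 by lra.
have i1 : Rint setT (kern (q - 2 * (q / 4)) x) by apply: kern_Rint; lra.
have i2 : Rint setT (kern (q + 2 * (q / 4)) x) by apply: kern_Rint; lra.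
apply: (Rint_le _ _ (RintZ (q / 4)^-1 _ (RintD _ i1 i2))) => //.
  by apply: measurable_funM => //; exact: kern_measurable.
move=> y _; rewrite normrM (ger0_norm (kern_ge0 _ _ _)) -ler_pdivrMl ?invr_gt0// invrK.
have := @kern_bound q (q / 4) x q x y e0 _ (lexx x); rewrite subrr normr0 ltW// => /(_ isT).
have := kern_ge0 q x y; rewrite mulrDl mul1r mulrA; lra.
Qed.

End Kernel.

(** * Continuity and derivatives of the integrals in their parameters *)

Section ParameterIntegrals.
Context {R : realType}.
Local Notation leb := (@lebesgue_measure R).
Implicit Types (q x y : R).

(** Dominated convergence is sequential, so a failure of continuity is first turned into a sequence
    tending to [p] along which the integrals stay at distance [e]. Continuity is joint because the
    implicit function argument later moves both parameters. *)
Lemma integral_continuous2 (f : R * R -> R -> R) (p : R * R) (g : R -> R) (d : R) :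
  0 < d -> Rint setT g ->
  (forall z, measurable_fun setT (f z)) ->
  (forall z y, `|z.1 - p.1| < d -> `|z.2 - p.2| < d -> `|f z y| <= g y) ->
  (forall y, {for p, continuous (f^~ y)}) ->
  {for p, continuous (fun z => \int[leb]_y f z y)}.
Proof.
move=> d0 gi mf fg cf; apply/cvgrPdist_lt => e e0.
apply/not_notP => nH.
have ex (n : nat) : exists z : R * R, [/\ `|z.1 - p.1| < d / n.+1%:R,
    `|z.2 - p.2| < d / n.+1%:R & e <= `|\int[leb]_y f p y - \int[leb]_y f z y|].
  apply/not_notP => nex; apply: nH.
  have dn : 0 < d / n.+1%:R by rewrite divr_gt0.
  exists (ball p.1 (d / n.+1%:R), ball p.2 (d / n.+1%:R)) => /=.
    by split; exact: nbhsx_ballx.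
  move=> z [z1 z2]; rewrite ltNge; apply/negP => ez; apply: nex.
  by exists z; split => //; rewrite distrC.
have [u Hu] := choice ex.
have dle (n : nat) : d / n.+1%:R <= d by rewrite ler_pdivrMr ?ltr0n// ler_pMr// ler1n.
have uc : u n @[n --> \oo] --> p.
  have dh : d / n.+1%:R @[n --> \oo] --> (0 : R).
    by rewrite -(mulr0 d); apply: cvgMr; exact: cvg_harmonic.
  rewrite [p]surjective_pairing.
  have cvi (v : nat -> R) c : (forall n : nat, `|v n - c| < d / n.+1%:R) -> v n @[n --> \oo] --> c.
    move=> Hv; apply/cvgrPdist_lt => r r0.
    have /cvgrPdist_lt/(_ _ r0) := dh; apply: filterS => n.
    rewrite sub0r normrN distrC => H; apply: lt_trans (Hv n) _.
    by apply: le_lt_trans H; exact: ler_norm.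
  have -> : u = fun n => ((u n).1, (u n).2) by apply/funext => n; exact: surjective_pairing.
  have c1 : (u n).1 @[n --> \oo] --> p.1 by apply: cvi => n; have [] := Hu n.
  have c2 : (u n).2 @[n --> \oo] --> p.2 by apply: cvi => n; have [] := Hu n.
  exact: cvg_pair c1 c2.
have fi : Rint setT (f p).
  apply: (Rint_le _ _ gi) => // y _; apply: fg; by rewrite subrr normr0.
have [|||||_ _] := @dominated_convergence _ _ _ leb setT measurableT
  (fun n y => (f (u n) y)%:E) (EFin \o f p) (EFin \o g).
- move=> n; apply/measurable_EFinP; exact: mf.
- by apply/measurable_EFinP; exact: mf.
- apply: aeW => y _; apply: cvg_EFin; first exact: nearW.
  exact: (cvg_comp _ _ uc (cf y)).
- exact: gi.
- apply: aeW => y n _ /=; rewrite lee_fin; have [H1 H2 _] := Hu n.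
  by apply: fg; [apply: lt_le_trans H1 _|apply: lt_le_trans H2 _].
move=> /= H.
have : \int[leb]_y f (u n) y @[n --> \oo] --> \int[leb]_y f p y.
  apply: fine_cvg; rewrite fineK//; exact: integrable_fin_num.
move=> /cvgrPdist_lt/(_ _ e0)[N _ /(_ N (leqnn _))].
by rewrite /= ltNge; case: (Hu N) => _ _ ->.
Qed.

Definition Iker q x : R := \int[leb]_y kern q x y.
Definition Jker q x : R := \int[leb]_y (y * kern q x y).

Lemma kern_continuous2 y (p : R * R) : {for p, continuous (fun z => kern z.1 z.2 y)}.
Proof.
apply: (@continuous_comp _ _ _ (fun z : R * R => z.1 * y - expR y ^+ 2 / 4 - z.2 * expR y) expR).
  apply: cvgB; [apply: cvgB|].
  - by apply: cvgMl; exact: cvg_fst.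
  - exact: cvg_cst.
  - by apply: cvgMl; exact: cvg_snd.
exact: continuous_expR.
Qed.

(** Common majorant of the kernel and of |y| times the kernel near (q, x). It is [kern_bound] with e
    = q / 4, so that the smaller exponent q - 2 e = q / 2 is still positive. *)
Let dom q x y := (1 + (q / 4)^-1) * (kern (q - 2 * (q / 4)) (x - 1) y + kern (q + 2 * (q / 4)) (x - 1) y).

Let dom_Rint q x : 0 < q -> Rint setT (dom q x).
Proof.
move=> q0; apply: RintZ => //; apply: RintD => //; apply: kern_Rint; lra.
Qed.

Let kern_dom q x q' x' y : 0 < q -> `|q' - q| <= q / 4 -> x - 1 <= x' ->
  kern q' x' y <= dom q x y /\ `|y| * kern q' x' y <= dom q x y.
Proof.
move=> q0 qq xx; have e0 : 0 < q / 4 by lra.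
have := kern_bound y e0 qq xx; have := kern_ge0 q' x' y.
have : 0 <= kern (q - 2 * (q / 4)) (x - 1) y + kern (q + 2 * (q / 4)) (x - 1) y.
  by rewrite addr_ge0 ?kern_ge0.
rewrite /dom; move: (kern _ _ _ + kern _ _ _) (kern q' x' y) => S k S0 k0.
rewrite mulrDl mul1r -mulrA => H.
have e'0 : 0 < (q / 4)^-1 by rewrite invr_gt0.
have ky : 0 <= `|y| * k by rewrite mulr_ge0.
have S'0 : 0 <= (q / 4)^-1 * S by rewrite mulr_ge0// ltW.
have eky : 0 <= q / 4 * (`|y| * k) by rewrite mulr_ge0// ltW.
have kS : `|y| * k <= (q / 4)^-1 * S by rewrite ler_pdivlMl//; lra.
rewrite mulrDl mul1r; move: S'0 kS eky H; move: ((q / 4)^-1 * S) (`|y| * k) => A B.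
by move: (q / 4 * B) => C *; split; lra.
Qed.

Lemma Iker_continuous2 q x : 0 < q -> {for (q, x), continuous (fun z => Iker z.1 z.2)}.
Proof.
move=> q0; have e0 : 0 < Num.min (q / 4) 1 by rewrite lt_min; lra.
apply: (integral_continuous2 (f := fun z => kern z.1 z.2) e0 (dom_Rint x q0)).
- by move=> z; exact: kern_measurable.
- move=> z y /=; rewrite !lt_min => /andP[z1 _] /andP[_ z2].
  rewrite ger0_norm ?kern_ge0//; apply: (kern_dom _ _ _ _).1 => //; first exact: ltW.
  by move: z2; rewrite ltr_norml; lra.
- by move=> y; exact: kern_continuous2.
Qed.

Lemma Jker_continuous2 q x : 0 < q -> {for (q, x), continuous (fun z => Jker z.1 z.2)}.
Proof.
move=> q0; have e0 : 0 < Num.min (q / 4) 1 by rewrite lt_min; lra.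
apply: (integral_continuous2 (f := fun z y => y * kern z.1 z.2 y) e0 (dom_Rint x q0)).
- by move=> z; apply: measurable_funM => //; exact: kern_measurable.
- move=> z y /=; rewrite !lt_min => /andP[z1 _] /andP[_ z2].
  rewrite normrM (ger0_norm (kern_ge0 _ _ _)); apply: (kern_dom _ _ _ _).2 => //; first exact: ltW.
  by move: z2; rewrite ltr_norml; lra.
- by move=> y; apply: cvgMr; exact: kern_continuous2.
Qed.

Lemma kern_dvq q x y : is_derive q 1 (fun q => kern q x y) (y * kern q x y).
Proof.
have d : is_derive q 1 (fun q => q * y - expR y ^+ 2 / 4 - x * expR y) y.
  apply: (is_derive_eq (dvB (dvB (dvM (dv_id q) (dv_cst y q)) (dv_cst (expR y ^+ 2 / 4) q)) (dv_cst (x * expR y) q))).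
  ring.
exact: dv_exp.
Qed.

Lemma kernS q x y : expR y * kern q x y = kern (q + 1) x y.
Proof. by rewrite /kern -expRD; congr expR; ring. Qed.

Lemma kern_dvx q x y : is_derive x 1 (fun x => kern q x y) (- kern (q + 1) x y).
Proof.
have d : is_derive x 1 (fun x => q * y - expR y ^+ 2 / 4 - x * expR y) (- expR y).
  apply: (is_derive_eq (dvB (dv_cst (q * y - expR y ^+ 2 / 4) x) (dvM (dv_id x) (dv_cst (expR y) x)))).
  ring.
by rewrite -kernS -mulNr; exact: dv_exp.
Qed.

Lemma integral_dv (f f' : R -> R -> R) (g : R -> R) (a d : R) : 0 < d ->
  (forall t, `|t - a| < d -> Rint setT (f t)) ->
  (forall t y : R, is_derive t 1 (f^~ y) (f' t y)) ->
  Rint setT g -> (forall t y, `|t - a| < d -> `|f' t y| <= g y) ->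
  is_derive a 1 (fun t => \int[leb]_y f t y) (\int[leb]_y f' a y).
Proof.
move=> d0 fi df gi fg.
have Ia : [set` `](a - d), (a + d)[] a by rewrite /= in_itv/=; lra.
have near_a t : [set` `](a - d), (a + d)[] t -> `|t - a| < d.
  by rewrite /= in_itv/= ltr_norml => /andP[? ?]; lra.
have g0 y : 0 <= g y.
  by apply: le_trans (fg a y _) => //; rewrite subrr normr0.
have E y : partial1of2 f a y = f' a y by rewrite /partial1of2; exact: dv_derive1.
have H := @derivable_under_integral R _ _ leb f setT measurableT a _ _ Ia
  (fun t It => fi t (near_a t It)) (fun t y _ _ => @ex_derive _ _ _ _ _ _ _ (df t y)) g g0 gi.
have H' := @differentiation_under_integral R _ _ leb f setT measurableT a _ _ Ia
  (fun t It => fi t (near_a t It)) (fun t y _ _ => @ex_derive _ _ _ _ _ _ _ (df t y)) g g0 gi.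
have B t y : [set` `](a - d), (a + d)[] t -> setT y -> `|partial1of2 f t y| <= g y.
  move=> It _; rewrite /partial1of2 (dv_derive1 (df t y)); exact: fg (near_a t It).
split; first exact: H.
rewrite -derive1E H' //; apply: eq_Rintegral => y _; exact: E.
Qed.

Lemma Iker_dvq q x : 0 < q -> is_derive q 1 (fun q => Iker q x) (Jker q x).
Proof.
move=> q0; have e0 : 0 < q / 4 by lra.
apply: (integral_dv (f := fun q => kern q x) (f' := fun q y => y * kern q x y) e0 _ _ (dom_Rint x q0)).
- by move=> t; rewrite ltr_norml => /andP[? ?]; apply: kern_Rint; lra.
- by move=> t y; exact: kern_dvq.
- move=> t y tq; rewrite normrM (ger0_norm (kern_ge0 _ _ _)).
  by apply: (kern_dom _ _ _ _).2 => //; [exact: ltW|lra].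
Qed.

Lemma Iker_dvx q x : 0 < q -> is_derive x 1 (fun x => Iker q x) (- Iker (q + 1) x).
Proof.
move=> q0; have q10 : 0 < q + 1 by lra.
rewrite (_ : - Iker (q + 1) x = \int[leb]_y (- kern (q + 1) x y)); last first.
  rewrite /Iker -mulN1r -RintegralZl//; last exact: kern_Rint.
  by apply: eq_Rintegral => y _; rewrite mulN1r.
apply: (integral_dv (f := fun x => kern q x) (f' := fun x y => - kern (q + 1) x y) ltr01 _ _ (dom_Rint x q10)).
- by move=> t _; exact: kern_Rint.
- by move=> t y; exact: kern_dvx.
- move=> t y; rewrite ltr_norml => /andP[? ?]; rewrite normrN ger0_norm ?kern_ge0//.
  by apply: (kern_dom _ _ _ _).1 => //; rewrite ?subrr ?normr0; lra.
Qed.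

(** The y-derivative of the kernel integrates to zero, and each factor e^y raises q by one.
    Differentiation in x also raises q by one, up to sign, so this recurrence is the equation I'' -
    2 x I' - 2 q I = 0 for I = [Iker q]. *)
Lemma Iker_rec q x : 0 < q -> q * Iker q x = Iker (q + 2) x / 2 + x * Iker (q + 1) x.
Proof.
have lin (u v w : R) : q * u - 2^-1 * w - x * v = 0 -> q * u = w / 2 + x * v by lra.
move=> q0; have [i0 i1 i2] : [/\ Rint setT (kern q x), Rint setT (kern (q + 1) x) & Rint setT (kern (q + 2) x)].
  by split; apply: kern_Rint; lra.
have ac : AC (kern q x) (fun y => q * kern q x y - 2^-1 * kern (q + 2) x y - x * kern (q + 1) x y).
  apply: AC_C1 => [y|].
    have d := is_derive_expR y.
    apply: (is_derive_eq (dv_exp (dvB (dvB (dv_lin q y) (dvM (dv_sqr d) (dv_cst 4^-1 y))) (dvZ x d)))).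
    rewrite -/(kern q x y) (_ : q + 2 = q + 1 + 1); last ring.
    by rewrite -!kernS; field.
  move=> y; apply: cvgB; [apply: cvgB|]; apply: cvgMr; exact: kern_continuous.
have ii : Rint setT (fun y => q * kern q x y - 2^-1 * kern (q + 2) x y).
  by apply: RintB => //; exact: RintZ.
have := AC_integral_line ac i0 (RintB _ ii (RintZ x _ i1)) => /(_ measurableT measurableT).
rewrite RintegralB//; last exact: RintZ.
rewrite RintegralB ?RintegralZl//; last 2 first.
- exact: RintZ.
- exact: RintZ.
rewrite -/(Iker q x) -/(Iker (q + 1) x) -/(Iker (q + 2) x).
exact: lin.
Qed.

End ParameterIntegrals.

(** * Inequalities for the Laplace integral *)

Section KernelInequalities.
Context {R : realType}.
Local Notation leb := (@lebesgue_measure R).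
Implicit Types (q x y r : R).

Lemma Rintegral_gt0 (D : set R) (f : R -> R) (y0 : R) : open D -> D y0 ->
  continuous f -> Rint D f -> (forall y, 0 <= f y) -> 0 < f y0 ->
  0 < \int[leb]_(y in D) f y.
Proof.
move=> oD Dy0 cf fi f0 fy0; have mD : measurable D by exact: open_measurable.
rewrite lt_neqAle Rintegral_ge0 ?andbT//.
apply/eqP => E.
have of0 : open [set y | 0 < f y].
  have -> : [set y | 0 < f y] = f @^-1` [set z | 0 < z] by [].
  by apply: open_comp; [move=> y _; exact: cf|exact: open_gt].
have mf : measurable_fun D (EFin \o f) by apply/measurable_EFinP; exact: Rint_measurable fi.
have ae0 : {ae leb, forall y, D y -> f y = 0}.
  have : (\int[leb]_(y in D) `|(EFin \o f) y| = 0)%E.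
    rewrite -[RHS]/(0%:E) E /Rintegral fineK; last exact: integrable_fin_num fi.
    by apply: eq_integral => y _ /=; rewrite ger0_norm.
  move=> /(ae_eq_integral_abs leb mD mf).1.
  apply: (@filterS _ _ (ae_filter_ringOfSetsType leb)) => y H /H /=.
  by case.
have [y [Dy /= + y0']] := ae_exists (openI oD of0) (conj Dy0 fy0) ae0.
by rewrite (y0' Dy) ltxx.
Qed.

Lemma Iker_gt0 q x : 0 < q -> 0 < Iker q x.
Proof.
move=> q0; apply: (@Rintegral_gt0 setT _ 0) => //; [exact: openT|exact: kern_continuous|exact: kern_Rint| |].
- by move=> y; exact: kern_ge0.
- exact: kern_gt0.
Qed.

(** Minus the logarithmic derivative of [Iker q] in x, and also the mean of e^y under the weight
    [kern q x]. *)
Definition ratio q x : R := Iker (q + 1) x / Iker q x.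

Lemma ratio_gt0 q x : 0 < q -> 0 < ratio q x.
Proof. by move=> q0; rewrite divr_gt0// Iker_gt0//; lra. Qed.

(** Cauchy-Schwarz, from the integral of (e^y - r)^2 against the kernel with r the mean of e^y. It
    says that [Iker q] is log-convex in x, hence that [ratio q] is nonincreasing. *)
Lemma Iker_sqr_le q x : 0 < q -> Iker (q + 1) x ^+ 2 <= Iker q x * Iker (q + 2) x.
Proof.
move=> q0; have I0 := Iker_gt0 x q0; set r := ratio q x.
have [i0 i1 i2] : [/\ Rint setT (kern q x), Rint setT (kern (q + 1) x) & Rint setT (kern (q + 2) x)].
  by split; apply: kern_Rint; lra.
have : 0 <= \int[leb]_y (kern (q + 2) x y - (2 * r) * kern (q + 1) x y + r ^+ 2 * kern q x y).
  apply: Rintegral_ge0 => y _.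
  rewrite (_ : _ + _ = (expR y - r) ^+ 2 * kern q x y).
    by rewrite mulr_ge0 ?sqr_ge0 ?kern_ge0.
  by rewrite (_ : q + 2 = q + 1 + 1) -?kernS; ring.
have i2r := RintB measurableT i2 (RintZ (2 * r) measurableT i1).
rewrite (RintegralD measurableT i2r (RintZ _ measurableT i0)).
rewrite (RintegralB measurableT i2 (RintZ _ measurableT i1)).
rewrite (RintegralZl _ measurableT i0) (RintegralZl _ measurableT i1).
rewrite -/(Iker q x) -/(Iker (q + 1) x) -/(Iker (q + 2) x).
rewrite /r /ratio; move: (Iker q x) (Iker (q + 1) x) (Iker (q + 2) x) I0 => a b c a0.
have -> : c - 2 * (b / a) * b + (b / a) ^+ 2 * a = (a * c - b ^+ 2) / a.
  by field; rewrite gt_eqF.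
by rewrite pmulr_lge0 ?invr_gt0// subr_ge0.
Qed.

(* This is the covariance of e^y and y under the weight kern q x, up to normalisation. *)
Lemma Iker_cov_gt0 q x : 0 < q ->
  Iker (q + 1) x * Jker q x < Jker (q + 1) x * Iker q x.
Proof.
move=> q0; have I0 := Iker_gt0 x q0; have r0 := ratio_gt0 x q0; set r := ratio q x in r0.
have q10 : 0 < q + 1 by lra.
have [i0 i1] : Rint setT (kern q x) /\ Rint setT (kern (q + 1) x).
  by split; apply: kern_Rint.
have j0 := ykern_Rint x q0; have j1 := ykern_Rint x q10.
(* Both factors change sign at [ln r], so [f] is nonnegative. As r is the mean of e^y, the terms
   carrying [ln r] integrate to zero and only the covariance is left. *)
pose f y := (expR y - r) * (y - ln r) * kern q x y.
have fE y : f y = (y * kern (q + 1) x y - r * (y * kern q x y)) -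
    (ln r * kern (q + 1) x y - (ln r * r) * kern q x y).
  by rewrite /f -kernS; ring.
have mono y : 0 <= (expR y - r) * (y - ln r).
  have [h|h] := leP (ln r) y.
    by apply: mulr_ge0; rewrite subr_ge0// -[r]lnK ?posrE// ler_expR.
  by apply: mulr_le0; rewrite subr_le0 ltW// -[r]lnK ?posrE// ltr_expR.
have ia : Rint setT (fun y => y * kern (q + 1) x y - r * (y * kern q x y)).
  by apply: RintB => //; exact: RintZ.
have ib : Rint setT (fun y => ln r * kern (q + 1) x y - (ln r * r) * kern q x y).
  by apply: RintB => //; exact: RintZ.
have : 0 < \int[leb]_y f y.
  apply: (@Rintegral_gt0 setT _ (ln r + 1)) => //; first exact: openT.
  - move=> y; apply: cvgM; last exact: kern_continuous.
    by apply: cvgM; apply: cvgB; [exact: continuous_expR|exact: cvg_cst|exact: cvg_id|exact: cvg_cst].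
  - by apply: (Rint_eq measurableT (fun y _ => esym (fE y))); exact: RintB.
  - by move=> y; rewrite mulr_ge0 ?kern_ge0.
  - rewrite /f mulr_gt0 ?kern_gt0// addrAC subrr add0r mulr1 expRD lnK ?posrE//.
    have : 1 < expR 1 :> R by rewrite -expR0 ltr_expR.
    by move=> e1; rewrite subr_gt0 ltr_pMr.
rewrite (_ : \int[leb]_y f y = \int[leb]_y ((y * kern (q + 1) x y - r * (y * kern q x y)) -
    (ln r * kern (q + 1) x y - (ln r * r) * kern q x y))); last first.
  by apply: eq_Rintegral => y _; exact: fE.
rewrite RintegralB//.
rewrite (RintegralB measurableT j1 (RintZ r measurableT j0)).
rewrite (RintegralB measurableT (RintZ _ measurableT i1) (RintZ _ measurableT i0)).
rewrite (RintegralZl _ measurableT j0) (RintegralZl _ measurableT i1) (RintegralZl _ measurableT i0).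
rewrite -/(Iker q x) -/(Iker (q + 1) x) -/(Jker q x) -/(Jker (q + 1) x).
rewrite /r /ratio; move: (Iker q x) (Iker (q + 1) x) (Jker q x) (Jker (q + 1) x) (ln _) I0.
move=> a b c d l a0.
have -> : d - b / a * c - (l * b - l * (b / a) * a) = (d * a - b * c) / a.
  by field; rewrite gt_eqF.
by rewrite pmulr_lgt0 ?invr_gt0// subr_gt0.
Qed.

(** For y <= 0 the kernel is at least e^(q y) times a constant, and q e^(q y) has integral 1 there:
    [Iker q x] grows at least like 1 / q as q tends to 0. *)
Lemma Iker_lower q x : 0 < q -> q <= 1 -> expR (- (1 + `|x|)) <= q * Iker q x.
Proof.
move=> q0 q1; set D := `]-oo, (0:R)]%classic.
have mD : measurable D by exact: measurable_itv.
have ei : Rint D (fun y => expR (q * y)).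
  apply: (Rint_le mD _ (RintZ 4 mD (RintS measurableT mD (@subsetT _ _) (hump_Rint q0)))).
    apply: (measurable_funS measurableT) => //; apply: continuous_measurable_fun => y.
    exact: dv_continuous (dv_exp (dv_lin q y)).
  move=> y; rewrite /D/= in_itv/= => y0; rewrite ger0_norm ?expR_ge0// /hump mulrA.
  have e1 : expR (q * y) <= 1 by rewrite expR_le1 pmulr_rle0.
  have e0 := expR_gt0 (q * y).
  have d0 : 0 < 1 + expR (q * y) by lra.
  by rewrite ler_pdivlMr ?exprn_gt0// mulrC ler_pM2r//; nra.
have : \int[leb]_(y in D) (q * expR (q * y)) = 1.
  rewrite (@AC_integral_left _ (fun y => expR (q * y)) (fun y => q * expR (q * y))) ?mulr0 ?expR0//.
  - apply: AC_C1 => y; first exact: dv_exp (dv_lin q y).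
    by apply: cvgMr; exact: dv_continuous (dv_exp (dv_lin q y)).
  - exact: RintZ.
rewrite RintegralZl// => E.
have ki := kern_Rint x q0.
apply: (@le_trans _ _ (q * \int[leb]_(y in D) kern q x y)); last first.
  rewrite ler_pM2l// /Iker Rintegral_halves//.
  by rewrite lerDl; apply: Rintegral_ge0 => y _; exact: kern_ge0.
apply: (@le_trans _ _ (q * (expR (- (1 + `|x|)) * \int[leb]_(y in D) expR (q * y)))).
  by rewrite mulrCA E mulr1.
rewrite ler_pM2l// -RintegralZl//; apply: le_Rintegral => //.
- exact: RintZ.
- exact: RintS ki.
move=> y; rewrite /D/= in_itv/= => y0; rewrite /kern -expRD ler_expR.
have e1 : expR y <= 1 by rewrite expR_le1.
have e0 := expR_gt0 y.
have : x * expR y <= `|x|.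
  apply: le_trans (ler_norm _) _; rewrite normrM (gtr0_norm e0); have := normr_ge0 x; nra.
nra.
Qed.

Lemma Iker_upper q x : 0 <= q <= 1 -> Iker (q + 1) x <= Iker 1 x + Iker 2 x.
Proof.
move=> /andP[q0 q1].
have [i0 i1 i2] : [/\ Rint setT (kern 1 x), Rint setT (kern (q + 1) x) & Rint setT (kern 2 x)].
  by split; apply: kern_Rint; lra.
rewrite /Iker -RintegralD//; apply: le_Rintegral => //; first exact: RintD.
move=> y _; have [y0|y0] := leP 0 y.
  apply: (@le_trans _ _ (kern 2 x y)); last by rewrite lerDr kern_ge0.
  by rewrite ler_expR; nra.
apply: (@le_trans _ _ (kern 1 x y)); last by rewrite lerDl kern_ge0.
by rewrite ler_expR; nra.
Qed.

(** As q tends to 0 the denominator of [ratio] blows up like 1 / q while the numerator stays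
    bounded. In terms of lam = 1 - 2 q, the logarithmic derivative tends to - x, that of the
    Gaussian. *)
Lemma ratio_small x : exists2 C : R, 0 < C & forall q, 0 < q -> q <= 1 -> ratio q x <= C * q.
Proof.
exists ((Iker 1 x + Iker 2 x) / expR (- (1 + `|x|))).
  by rewrite divr_gt0 ?expR_gt0// addr_gt0// Iker_gt0.
move=> q q0 q1; rewrite /ratio ler_pdivrMr ?Iker_gt0//.
have U := @Iker_upper q x; rewrite (ltW q0) q1 in U; apply: le_trans (U isT) _.
have S0 : 0 <= Iker 1 x + Iker 2 x by rewrite addr_ge0// ltW// Iker_gt0.
have := Iker_lower x q0 q1; move: (Iker 1 x + _) (Iker q x) S0 => S a S0 L.
rewrite (_ : _ * q * a = S * (q * a / expR (- (1 + `|x|)))); last by ring.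
by rewrite ler_peMr// ler_pdivlMr ?expR_gt0// mul1r.
Qed.

Lemma ratio_dvx q x : 0 < q ->
  is_derive x 1 (ratio q) (ratio q x ^+ 2 + 2 * x * ratio q x - 2 * q).
Proof.
move=> q0; have I0 := Iker_gt0 x q0; have n0 : Iker q x != 0 by rewrite gt_eqF.
have q10 : 0 < q + 1 by lra.
apply: (is_derive_eq (dvM (Iker_dvx x q10) (dvV n0 (Iker_dvx x q0)))).
have rec := Iker_rec x q0.
have q2 : q + 1 + 1 = q + 2 by ring.
move: rec n0; rewrite /ratio q2; move: (Iker q x) (Iker (q + 1) x) (Iker (q + 2) x) => a b c rec a0.
have -> : c = 2 * q * a - 2 * x * b by lra.
by field.
Qed.

Lemma ratio_dvx_le0 q x : 0 < q -> ratio q x ^+ 2 + 2 * x * ratio q x - 2 * q <= 0.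
Proof.
move=> q0; have I0 := Iker_gt0 x q0; have := Iker_sqr_le x q0; have rec := Iker_rec x q0.
move: I0 rec; rewrite /ratio; move: (Iker q x) (Iker (q + 1) x) (Iker (q + 2) x) => a b c a0 rec.
have -> : c = 2 * q * a - 2 * x * b by lra.
rewrite -subr_ge0 => H.
have -> : (b / a) ^+ 2 + 2 * x * (b / a) - 2 * q =
  - ((a * (2 * q * a - 2 * x * b) - b ^+ 2) / a ^+ 2) by field; rewrite gt_eqF.
by rewrite oppr_le0 divr_ge0// sqr_ge0.
Qed.

Definition ratio_q q x : R :=
  (Jker (q + 1) x * Iker q x - Iker (q + 1) x * Jker q x) / Iker q x ^+ 2.

Lemma ratio_dvq q x : 0 < q -> is_derive q 1 (ratio^~ x) (ratio_q q x).
Proof.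
move=> q0; have I0 := Iker_gt0 x q0; have n0 : Iker q x != 0 by rewrite gt_eqF.
have q10 : 0 < q + 1 by lra.
have d1 : is_derive q 1 (fun q => Iker (q + 1) x) (Jker (q + 1) x).
  rewrite -[Jker _ _]mulr1; apply: (@dv_comp _ (Iker^~ x) (fun q => q + 1)).
    exact: Iker_dvq.
  by apply: (is_derive_eq (dvD (dv_id q) (dv_cst 1 q))); rewrite addr0.
apply: (is_derive_eq (dvM d1 (dvV (f := Iker^~ x) n0 (Iker_dvq x q0)))).
rewrite /ratio_q; move: (Iker q x) (Iker (q + 1) x) (Jker q x) (Jker (q + 1) x) n0 => a b c d a0.
by field.
Qed.

Lemma ratio_q_gt0 q x : 0 < q -> 0 < ratio_q q x.
Proof.
by move=> q0; rewrite divr_gt0 ?exprn_gt0 ?Iker_gt0// subr_gt0 Iker_cov_gt0.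
Qed.

Lemma shift_continuous2 (F : R -> R -> R) q x :
  {for (q + 1, x), continuous (fun z : R * R => F z.1 z.2)} ->
  {for (q, x), continuous (fun z : R * R => F (z.1 + 1) z.2)}.
Proof.
move=> cF; apply: (@continuous_comp _ _ _ (fun z : R * R => (z.1 + 1, z.2)) (fun z => F z.1 z.2)).
  have c1 : z.1 + 1 @[z --> (q, x)] --> q + 1 by apply: cvgD; [exact: cvg_fst|exact: cvg_cst].
  have c2 : z.2 @[z --> (q, x)] --> x by exact: cvg_snd.
  exact: cvg_pair c1 c2.
exact: cF.
Qed.

Lemma ratio_q_continuous2 q x : 0 < q -> {for (q, x), continuous (fun z : R * R => ratio_q z.1 z.2)}.
Proof.
move=> q0; have q10 : 0 < q + 1 by lra.
have cI := Iker_continuous2 (x := x) q0; have cJ := Jker_continuous2 (x := x) q0.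
have cI1 := shift_continuous2 (F := Iker) (Iker_continuous2 (x := x) q10).
have cJ1 := shift_continuous2 (F := Jker) (Jker_continuous2 (x := x) q10).
have n0 : Iker q x ^+ 2 != 0 by rewrite gt_eqF// exprn_gt0// Iker_gt0.
exact: (cvgM (cvgB (cvgM cJ1 cI) (cvgM cI1 cJ)) (cvgV n0 (cvgM cI cI))).
Qed.

End KernelInequalities.

(** * The Riccati equation *)

Section Riccati.
Context {R : realType}.
Implicit Types (lam x y : R).

(* U' / U for the solution U = psi lam of - U'' + x^2 U = lam U that decays at +oo. *)
Definition logd lam x : R := - x - ratio ((1 - lam) / 2) x.

Definition logd_lam lam x : R := ratio_q ((1 - lam) / 2) x / 2.

(* The derivative of logd lam, by the Riccati equation. *)
Definition slope lam x : R := x ^+ 2 - lam - logd lam x ^+ 2.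

Lemma logd_dvx lam x : lam < 1 -> is_derive x 1 (logd lam) (slope lam x).
Proof.
move=> l1; have q0 : 0 < (1 - lam) / 2 by lra.
apply: (is_derive_eq (dvB (dvN (dv_id x)) (ratio_dvx x q0))).
by rewrite /slope /logd; field.
Qed.

Lemma logd_dvlam lam x : lam < 1 -> is_derive lam 1 (logd^~ x) (logd_lam lam x).
Proof.
move=> l1; have q0 : 0 < (1 - lam) / 2 by lra.
have d : is_derive lam 1 (fun l => (1 - l) / 2) (- 2^-1).
  by apply: (is_derive_eq (dvM (dvB (dv_cst 1 lam) (dv_id lam)) (dv_cst 2^-1 lam))); ring.
apply: (is_derive_eq (dvB (dv_cst (- x) lam) (@dv_comp _ (ratio^~ x) (fun l => (1 - l) / 2) _ _ _ (ratio_dvq x q0) d))).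
by rewrite /logd_lam; ring.
Qed.

Lemma logd_lt lam x : lam < 1 -> logd lam x < - x.
Proof.
move=> l1; have q0 : 0 < (1 - lam) / 2 by lra.
by rewrite /logd gtrBl ratio_gt0.
Qed.

Lemma logd_lam_gt0 lam x : lam < 1 -> 0 < logd_lam lam x.
Proof.
move=> l1; have q0 : 0 < (1 - lam) / 2 by lra.
by rewrite divr_gt0// ratio_q_gt0.
Qed.

Lemma half_continuous2 (F : R -> R -> R) lam x :
  {for ((1 - lam) / 2, x), continuous (fun z : R * R => F z.1 z.2)} ->
  {for (lam, x), continuous (fun z : R * R => F ((1 - z.1) / 2) z.2)}.
Proof.
move=> cF; apply: (@continuous_comp _ _ _ (fun z : R * R => ((1 - z.1) / 2, z.2)) (fun z => F z.1 z.2)).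
  have c1 : (1 - z.1) / 2 @[z --> (lam, x)] --> (1 - lam) / 2.
    by apply: cvgMl; apply: cvgB; [exact: cvg_cst|exact: cvg_fst].
  have c2 : z.2 @[z --> (lam, x)] --> x by exact: cvg_snd.
  exact: cvg_pair c1 c2.
exact: cF.
Qed.

Lemma logd_lam_continuous2 lam x : lam < 1 ->
  {for (lam, x), continuous (fun z : R * R => logd_lam z.1 z.2)}.
Proof.
move=> l1; have q0 : 0 < (1 - lam) / 2 by lra.
have c := half_continuous2 (F := ratio_q) (ratio_q_continuous2 (x := x) q0).
exact: (cvgMl c).
Qed.

Lemma slope_continuous lam : lam < 1 -> continuous (slope lam).
Proof.
move=> l1 x; have d := dv_sqr (dv_id x); have d2 := dv_sqr (logd_dvx x l1).
exact: dv_continuous (dvB (dvB d (dv_cst lam x)) d2).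
Qed.

Lemma logd_incr lam mu x : lam < mu -> mu < 1 -> logd lam x < logd mu x.
Proof.
move=> lm m1; have [c /andP[lc cm] e] := @mean_value _ (logd^~ x) (logd_lam^~ x) lam mu lm
  (fun t tlm => logd_dvlam x (le_lt_trans (andP tlm).2 m1)).
rewrite -subr_gt0 e mulr_gt0 ?subr_gt0// logd_lam_gt0//; exact: lt_trans cm m1.
Qed.

Lemma ratio_nincr q x y : 0 < q -> x <= y -> ratio q y <= ratio q x.
Proof.
move=> q0; rewrite le_eqVlt => /predU1P[->//|xy].
have [c _ e] := @mean_value _ (ratio q) _ x y xy (fun t _ => ratio_dvx t q0).
rewrite -subr_le0 e; apply: mulr_le0_ge0; first exact: ratio_dvx_le0.
by rewrite subr_ge0 ltW.
Qed.

Lemma logd_bound lam x0 : lam < 1 -> exists C : R, forall x, x0 <= x -> `|logd lam x| <= C + `|x|.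
Proof.
move=> l1; have q0 : 0 < (1 - lam) / 2 by lra.
exists (ratio ((1 - lam) / 2) x0) => x xx.
rewrite /logd addrC; apply: le_trans (ler_normB _ _) _; rewrite normrN lerD//.
by rewrite gtr0_norm ?ratio_gt0// ratio_nincr.
Qed.

Definition psi lam x : R := expR (- (x ^+ 2 / 2)) * Iker ((1 - lam) / 2) x.

Lemma psi_gt0 lam x : lam < 1 -> 0 < psi lam x.
Proof. by move=> l1; rewrite mulr_gt0 ?expR_gt0// Iker_gt0//; lra. Qed.

Lemma psi_dv lam x : lam < 1 -> is_derive x 1 (psi lam) (logd lam x * psi lam x).
Proof.
move=> l1; have q0 : 0 < (1 - lam) / 2 by lra.
have d := dv_exp (dvN (dvM (dv_sqr (dv_id x)) (dv_cst 2^-1 x))).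
apply: (is_derive_eq (dvM d (Iker_dvx x q0))).
have := Iker_gt0 x q0; rewrite /logd /psi /ratio.
move: (Iker _ x) (Iker _ x) (expR _) => b a E a0; field; rewrite gt_eqF//.
Qed.

Lemma slope_lt0 lam x : 0 <= lam < 1 -> 0 <= x -> slope lam x < 0.
Proof.
move=> /andP[l0 l1] x0; have := logd_lt x l1; rewrite /slope => H; nra.
Qed.

Lemma slope_gt0_exists lam : 0 <= lam < 1 -> exists2 x, x < 0 & 0 < slope lam x.
Proof.
move=> /andP[l0 l1]; apply/not_exists2P => nH.
have q0 : 0 < (1 - lam) / 2 by lra.
set r0 := ratio ((1 - lam) / 2) 0; have r00 : 0 < r0 by exact: ratio_gt0.
(* Write r for the ratio at - y, so the slope there is r (2 y - r) - lam. If no slope were positive,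
   r0 <= r <= r0 + y would follow, hence r (2 y - r) >= r0 (y - r0). This choice of y makes the last
   product 1, and 1 > lam. *)
pose y := r0 + r0^-1; have y0 : 0 < y by rewrite addr_gt0 ?invr_gt0.
have ny : - y < 0 by lra.
have sl t : t < 0 -> slope lam t <= 0 by move=> t0; rewrite leNgt; apply/negP => h; case: (nH t).
have m0 : logd lam 0 <= logd lam (- y).
  have [c /andP[c1 c2] e] := @mean_value _ (logd lam) _ (- y) 0 ny (fun t _ => logd_dvx t l1).
  by rewrite -subr_le0 e; apply: mulr_le0_ge0; [exact: sl|lra].
have := sl _ ny; rewrite leNgt => /negP; apply.
have ry : r0 <= ratio ((1 - lam) / 2) (- y) by apply: ratio_nincr => //; lra.
move: m0 ry; rewrite /slope /logd -/r0; move: (ratio _ (- y)) => r m0 ry.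
have yr : r0 * (y - r0) = 1 by rewrite /y addrAC subrr add0r divff ?gt_eqF.
have h1 : r <= r0 + y by lra.
have yr0 : 0 <= y - r0 by rewrite /y addrAC subrr add0r invr_ge0 ltW.
have : r0 * (y - r0) <= r * (2 * y - r) by apply: ler_pM; lra.
have -> : (- y) ^+ 2 - lam - (- - y - r) ^+ 2 = r * (2 * y - r) - lam by ring.
by rewrite yr; lra.
Qed.

(** The function is (x^2 - lam) psi^2 - psi'^2; by psi'' = (x^2 - lam) psi every term of its
    derivative cancels except the one from x^2. *)
Lemma slope_psi_dv lam x : lam < 1 ->
  is_derive x 1 (fun x => slope lam x * psi lam x ^+ 2) (2 * x * psi lam x ^+ 2).
Proof.
move=> l1; have d := logd_dvx x l1.
have ds := dvB (dvB (dv_sqr (dv_id x)) (dv_cst lam x)) (dv_sqr d).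
apply: (is_derive_eq (dvM ds (dv_sqr (psi_dv x l1)))).
by rewrite /slope; move: (logd _ _) (psi _ _) => m p; ring.
Qed.

(* The slope times psi^2 is strictly decreasing on the negative axis, so logd has at most one critical point there. *)
Lemma logd_crit lam : 0 <= lam < 1 -> exists x0, [/\ x0 < 0, slope lam x0 = 0,
  (forall x, slope lam x = 0 -> x = x0),
  (forall x, x < x0 -> 0 < slope lam x) &
  (forall x, x != x0 -> logd lam x < logd lam x0)].
Proof.
move=> /[dup] l01 /andP[l0 l1].
have [x1 x10 s1] := slope_gt0_exists l01.
have s0 := slope_lt0 l01 (lexx 0).
have [x0 x0I e0] : exists2 x0, x0 \in `[x1, 0] & slope lam x0 = 0.
  apply: IVT; first exact: ltW.
    exact: continuous_subspaceT (slope_continuous l1).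
  apply/andP; split; rewrite ?ge_min ?le_max; apply/orP; [right|left]; exact: ltW.
have x00 : x0 < 0.
  by rewrite ltNge; apply/negP => /(slope_lt0 l01); rewrite e0 ltxx.
have p2 x : 0 < psi lam x ^+ 2 by rewrite exprn_gt0 ?psi_gt0.
have decr x y : x < y -> y <= 0 -> slope lam y * psi lam y ^+ 2 < slope lam x * psi lam x ^+ 2.
  move=> xy y0.
  have [c /andP[c1 c2] e] := @mean_value _ (fun x => slope lam x * psi lam x ^+ 2) _ x y xy
    (fun t _ => slope_psi_dv t l1).
  have c0 : c < 0 by exact: lt_le_trans c2 y0.
  rewrite -subr_lt0 e; have := p2 c; move: (psi lam c ^+ 2) => p p0.
  have cp : 2 * c * p < 0 by clear -p0 c0; nra.
  by rewrite (nmulr_rlt0 _ cp) subr_gt0.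
have pos x : x < x0 -> 0 < slope lam x.
  by move=> /decr/(_ (ltW x00)); rewrite e0 mul0r pmulr_lgt0.
have neg x : x0 < x -> slope lam x < 0.
  move=> x0x; have [xn|xp] := ltP x 0; last exact: slope_lt0.
  by have := decr _ _ x0x (ltW xn); rewrite e0 mul0r pmulr_llt0.
exists x0; split => //.
- move=> x ex; have [/pos|/neg|//] := ltgtP x x0; by rewrite ex ltxx.
- move=> x; have [xx|xx|//] := ltgtP x x0 => _.
    have [c /andP[c1 c2] e] := @mean_value _ (logd lam) _ x x0 xx (fun t _ => logd_dvx t l1).
    by rewrite -subr_gt0 e; apply: mulr_gt0; [exact: pos|rewrite subr_gt0].
  have [c /andP[c1 c2] e] := @mean_value _ (logd lam) _ x0 x xx (fun t _ => logd_dvx t l1).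
  rewrite -subr_lt0 e; have := neg c c1; move: (slope lam c) => s s0'.
  by rewrite (nmulr_rlt0 _ s0') subr_gt0.
Qed.

(* Left of the critical point logd increases; it cannot stay in [0, M] as its slope there is at least 1. *)
Lemma logd_far lam : 0 <= lam < 1 -> exists2 C : R, 0 < C & forall x, x <= - C -> logd lam x < 0.
Proof.
move=> /[dup] l01 /andP[l0 l1]; have [x0 [x00 _ _ pos mx]] := logd_crit l01.
set M := `|logd lam x0|; have M0 : 0 <= M by exact: normr_ge0.
have mM x : logd lam x <= M.
  have [->|/mx/ltW h] := eqVneq x x0; first exact: ler_norm.
  by apply: le_trans h _; exact: ler_norm.
(* For c < z one has - c > M + 2, so c^2 - lam - m^2 >= 1 when 0 <= m <= M. The extra length M + 1
   to the left of z then forces a growth larger than M. *)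
pose z := - (M + 2) + x0; have z0 : z < 0 by rewrite /z; lra.
exists (- z + (M + 1)); first lra.
move=> x xC; rewrite ltNge; apply/negP => mx0.
have xz : x < z by lra.
have mono c : x < c -> c < x0 -> 0 <= logd lam c.
  move=> xc cx; apply: le_trans mx0 _.
  have [d /andP[d1 d2] e] := @mean_value _ (logd lam) _ x c xc (fun t _ => logd_dvx t l1).
  rewrite -subr_ge0 e; apply: mulr_ge0; last by rewrite subr_ge0 ltW.
  by apply/ltW/pos; exact: lt_trans d2 cx.
have [c /andP[c1 c2] e] := @mean_value _ (logd lam) _ x z xz (fun t _ => logd_dvx t l1).
have cx0 : c < x0 by apply: lt_trans c2 _; rewrite /z; clear -M0; lra.
have mc0 := mono _ c1 cx0; have mcM := mM c; have mzM := mM z.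
have sc : 1 <= slope lam c.
  have h : M + 2 <= - c by move: c2; rewrite /z; clear -x00; lra.
  rewrite /slope; move: (logd lam c) mc0 mcM => m mc0 mcM.
  by clear -M0 l1 h mc0 mcM; nra.
have : z - x <= logd lam z - logd lam x by rewrite e ler_peMl// subr_ge0 ltW.
by clear -xC mzM mx0; lra.
Qed.

(** At the maximum x0 the slope vanishes, so m(0, x0) is x0 or - x0; the bound m < - x excludes -
    x0, and x0 is negative. *)
Lemma logd0_lt0 x : logd 0 x < 0.
Proof.
have l01 : ((0 : R) <= 0) && ((0 : R) < 1) by rewrite lexx ltr01.
have [x0 [x00 e0 _ _ mx]] := logd_crit l01.
have m0 : logd 0 x0 < 0.
  have := logd_lt x0 (@ltr01 R); move: e0; rewrite /slope subr0.
  by move: (logd 0 x0) => m e h; nra.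
by have [->//|/mx h] := eqVneq x x0; exact: lt_trans h m0.
Qed.

(** If [ratio q x >= - (2 * x)] for all x < 0, the Riccati equation gives a slope of at least - 2 q,
    so at - y the ratio is at most r0 + 2 q y. This is below 2 y for large y because q < 1. The
    conclusion means m > x, the positivity exploited in [match_nonneg]. *)
Lemma ratio_lt_exists (q : R) : 0 < q < 1 -> exists2 x : R, x < 0 & ratio q x < - (2 * x).
Proof.
move=> /andP[q0 q1]; apply/not_exists2P => nH.
set r0 := ratio q 0; have r00 : 0 < r0 by exact: ratio_gt0.
pose y := (r0 + 1) / (2 - 2 * q); have d0 : 0 < 2 - 2 * q by lra.
have y0 : 0 < y by rewrite divr_gt0//; lra.
have yE : y * (2 - 2 * q) = r0 + 1 by rewrite /y divfK// gt_eqF.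
have ny : - y < 0 by lra.
have ge : - (2 * - y) <= ratio q (- y) by rewrite leNgt; apply/negP; case: (nH (- y)).
have [c /andP[c1 c2] e] := @mean_value _ (ratio q) _ (- y) 0 ny (fun t _ => ratio_dvx t q0).
have gc : - (2 * c) <= ratio q c by rewrite leNgt; apply/negP; case: (nH c).
have rc := ratio_gt0 c q0; rewrite -/r0 in e.
have : - (2 * q) <= ratio q c ^+ 2 + 2 * c * ratio q c - 2 * q.
  by clear -gc rc; nra.
move: e ge; move: (ratio q c ^+ 2 + _ - _) (ratio q (- y)) => s r e ge sq.
by clear -e ge sq yE y0 q0; nra.
Qed.

End Riccati.

(** * The least parameter at which an increasing family reaches zero *)

Section Attain.
Context {R : realType}.
Implicit Types (lam x y : R).

(** Shared by the line ([match_fun]) and the Neumann problem ([logd]). By monotonicity the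
    negativity of F at lam0 outside [-C, 0] passes to all smaller lam, so compactness of [-C, 0]
    shows that the infimum of the admissible lam is attained. A positive value at the infimum would
    allow a smaller lam. *)
Lemma attain (L : R) (F : R -> R -> R) (lam0 C : R) :
  (forall x lam mu, 0 <= lam -> lam < mu -> mu < L -> F lam x < F mu x) ->
  (forall lam x, 0 <= lam < L -> {for lam, continuous (F^~ x)}) ->
  (forall lam, 0 <= lam < L -> continuous (F lam)) ->
  0 <= lam0 < L -> (forall x, x < - C \/ 0 < x -> F lam0 x < 0) ->
  (exists x, 0 <= F lam0 x) -> (forall x, F 0 x < 0) ->
  exists lam x, [/\ 0 < lam, lam <= lam0, F lam x = 0 & forall y, F lam y <= 0].
Proof.
move=> Fi Fcl Fcx /[dup] l00L /andP[l00 l0L] far [x0 Fx0] F0.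
pose S := [set lam | 0 <= lam <= lam0 /\ exists x, 0 <= F lam x].
have Sl0 : S lam0 by split; [rewrite l00/=|exists x0].
have hS : has_inf S by split; [exists lam0|exists 0 => l [] /andP[]].
set bet := inf S.
have b0 : 0 <= bet by apply: lb_le_inf; [exists lam0|move=> l [] /andP[]].
have bl : bet <= lam0 by apply: ge_inf => //; case: hS.
have bL : 0 <= bet < L by rewrite b0 (le_lt_trans bl).
have Fle x l m : 0 <= l -> l <= m -> m < L -> F l x <= F m x.
  by move=> l0; rewrite le_eqVlt => /predU1P[->//|lm] mL; apply: ltW; exact: Fi.
have [xi Fxi] : exists x, 0 <= F bet x.
  move: bl; rewrite le_eqVlt => /predU1P[->|bl]; first by exists x0.
  apply/not_existsP => nH.
  have neg x : F bet x < 0 by rewrite ltNge; apply/negP; exact: nH.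
  (* Dini: F (bet + d) is negative on the whole compact interval for some d > 0. *)
  have loc s t : s <= t -> exists2 d, 0 < d <= lam0 - bet &
      forall x, s <= x <= t -> F (bet + d) x < 0.
    apply: (@interval_ind _ (fun s t => exists2 d, 0 < d <= lam0 - bet &
      forall x, s <= x <= t -> F (bet + d) x < 0)).
      move=> a b c ab bc [d1 /andP[d10 d1l] H1] [d2 /andP[d20 d2l] H2].
      exists (Num.min d1 d2); first by rewrite lt_min d10 d20 ge_min d1l.
      move=> x /andP[ax xc]; have [xb|bx] := leP x b.
        apply: le_lt_trans (H1 x _); last by rewrite ax.
        apply: Fle; [by rewrite addr_ge0// le_min !ltW|by rewrite lerD2l ge_min lexx|].
        by clear -d1l l0L; lra.
      apply: le_lt_trans (H2 x _); last by rewrite (ltW bx).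
      apply: Fle; [by rewrite addr_ge0// le_min !ltW|by rewrite lerD2l ge_min lexx orbT|].
      by clear -d2l l0L; lra.
    move=> x; have nx0 : 0 < - F bet x by rewrite oppr_gt0.
    have /cvgrPdist_lt/(_ _ nx0)[d /= d0 Hd] := Fcl bet x bL.
    pose d' := Num.min (d / 2) (lam0 - bet).
    have d'0 : 0 < d' by rewrite lt_min subr_gt0 bl andbT divr_gt0.
    have d'd : d' <= d / 2 by rewrite ge_min lexx.
    have d'l : d' <= lam0 - bet by rewrite ge_min lexx orbT.
    have bd' : 0 <= bet + d' < L by clear -b0 d'0 d'l l0L; lra.
    have Fx' : F (bet + d') x < 0.
      have := Hd (bet + d'); rewrite /= opprD addrA subrr sub0r normrN gtr0_norm//.
      have dd : d' < d by clear -d'd d0; lra.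
      move=> /(_ dd); rewrite ltr_norml => /andP[h _]; clear -h; lra.
    have nx'0 : 0 < - F (bet + d') x by rewrite oppr_gt0.
    have /cvgrPdist_lt/(_ _ nx'0)[e /= e0 He] := Fcx _ bd' x.
    exists e => // s' t' xs sx xt tx; exists d'; first by rewrite d'0.
    move=> y /andP[sy yt]; have := He y; rewrite /= ltr_norml.
    have h : - e < x - y < e by clear -xs sy yt tx; lra.
    move=> /(_ h); rewrite ltr_norml => /andP[h' _]; clear -h'; lra.
  have [d /andP[d0 dl] Hd] : exists2 d, 0 < d <= lam0 - bet & forall x, F (bet + d) x < 0.
    have [C0|C0] := leP (- C) 0.
      have [d dd Hd] := loc _ _ C0; exists d => // x.
      have [xC|Cx] := ltP x (- C).
        apply: le_lt_trans (far x (or_introl xC)).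
        by apply: Fle; clear -b0 dd l0L; lra.
      have [x0'|x0'] := leP x 0; first by apply: Hd; rewrite Cx.
      apply: le_lt_trans (far x (or_intror x0')).
      by apply: Fle; clear -b0 dd l0L; lra.
    (* Here - C > 0, and the two far regions cover the whole line. *)
    exists (lam0 - bet); first by rewrite lexx subr_gt0 bl.
    move=> x; rewrite addrC subrK; apply: far.
    by have [xC|Cx] := ltP x (- C); [left|right; exact: lt_le_trans C0 Cx].
  have [s [/andP[s0 sl] [x Fsx]] sb] := inf_adherent d0 hS.
  have : F s x < 0.
    apply: le_lt_trans (Hd x); apply: Fle => //; first exact: ltW.
    by clear -dl l0L; lra.
  by rewrite ltNge Fsx.
have bpos : 0 < bet.
  rewrite lt_neqAle b0 andbT; apply/eqP => e; have := F0 xi.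
  by rewrite ltNge => /negP; apply; move: Fxi; rewrite -e.
have Fb y : F bet y <= 0.
  rewrite leNgt; apply/negP => Fy.
  have /cvgrPdist_lt/(_ _ Fy)[d /= d0 Hd] := Fcl bet y bL.
  pose l := bet - Num.min (d / 2) bet.
  have m0 : 0 < Num.min (d / 2) bet by rewrite lt_min bpos andbT divr_gt0.
  have md : Num.min (d / 2) bet <= d / 2 by rewrite ge_min lexx.
  have mb : Num.min (d / 2) bet <= bet by rewrite ge_min lexx orbT.
  have : bet <= l.
    apply: ge_inf; first by case: hS.
    split; first by rewrite /l; clear -m0 mb bl; lra.
    exists y; have := Hd l; rewrite /= /l opprB addrC subrK gtr0_norm//.
    have h : Num.min (d / 2) bet < d by clear -md d0; lra.
    by move=> /(_ h); rewrite ltr_norml => /andP[_ h']; clear -h'; lra.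
  by rewrite /l; clear -m0; lra.
exists bet, xi; split => //.
by apply/eqP; rewrite eq_le Fb Fxi.
Qed.

End Attain.

(** * The matching function and its least zero level *)

Section Bottom.
Context {R : realType}.
Variable b : R.
Hypothesis b01 : 0 < b < 1.
Implicit Types (lam x y : R).

(* With a = - b^2, the sum of the logarithmic derivatives at 0, each in the direction away from 0, of
   the solutions decaying at +oo and at -oo; it vanishes exactly when they glue to an eigenfunction. *)
Definition match_fun lam x : R := logd lam x + b * logd (lam / b ^+ 2) (x / b).

Let b0 : 0 < b. Proof. by case/andP: b01. Qed.
Let b1 : b < 1. Proof. by case/andP: b01. Qed.
Let bb0 : 0 < b ^+ 2. Proof. by rewrite exprn_gt0. Qed.
Let bb1 : b ^+ 2 < 1. Proof. by rewrite expr_lt1// ltW. Qed.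

Lemma div_sqr_lt1 lam : lam < b ^+ 2 -> lam / b ^+ 2 < 1.
Proof. by move=> lb; rewrite ltr_pdivrMr// mul1r. Qed.

Lemma div_sqr_ge0 lam : 0 <= lam -> 0 <= lam / b ^+ 2.
Proof. by move=> l0; rewrite divr_ge0// ltW. Qed.

Lemma match_dvx lam x : lam < b ^+ 2 ->
  is_derive x 1 (match_fun lam) (slope lam x + slope (lam / b ^+ 2) (x / b)).
Proof.
move=> lb; have l1 := lt_trans lb bb1; have l1' := div_sqr_lt1 lb.
have d : is_derive x 1 (fun x => x / b) b^-1.
  by apply: (is_derive_eq (dvM (dv_id x) (dv_cst b^-1 x))); ring.
apply: (is_derive_eq (dvD (logd_dvx x l1)
  (dvZ b (@dv_comp _ (logd (lam / b ^+ 2)) (fun x => x / b) _ _ _ (logd_dvx (x / b) l1') d)))).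
by move: (slope _ _) (slope _ _) => s t; field; rewrite gt_eqF.
Qed.

Definition match_lam lam x : R := logd_lam lam x + logd_lam (lam / b ^+ 2) (x / b) / b.

Lemma match_dvlam lam x : lam < b ^+ 2 ->
  is_derive lam 1 (match_fun^~ x) (match_lam lam x).
Proof.
move=> lb; have l1 := lt_trans lb bb1; have l1' := div_sqr_lt1 lb.
have d : is_derive lam 1 (fun l => l / b ^+ 2) (b ^- 2).
  by apply: (is_derive_eq (dvM (dv_id lam) (dv_cst (b ^- 2) lam))); ring.
apply: (is_derive_eq (dvD (logd_dvlam x l1)
  (dvZ b (@dv_comp _ (logd^~ (x / b)) (fun l => l / b ^+ 2) _ _ _ (logd_dvlam (x / b) l1') d)))).
by rewrite /match_lam; move: (logd_lam _ _) (logd_lam _ _) => s t; field; rewrite gt_eqF.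
Qed.

Lemma match_lam_gt0 lam x : lam < b ^+ 2 -> 0 < match_lam lam x.
Proof.
move=> lb; have l1 := lt_trans lb bb1; have l1' := div_sqr_lt1 lb.
by apply: addr_gt0; [exact: logd_lam_gt0|apply: divr_gt0 => //; exact: logd_lam_gt0].
Qed.

Lemma match_incr lam mu x : lam < mu -> mu < b ^+ 2 -> match_fun lam x < match_fun mu x.
Proof.
move=> lm mb; apply: ltrD; first exact: logd_incr (lt_trans mb bb1).
by rewrite ltr_pM2l//; apply: logd_incr (div_sqr_lt1 mb); rewrite ltr_pM2r// invr_gt0.
Qed.

(** As lam tends to b^2 the second term tends to b (- x / b) = - x, so [match_fun] tends to m(b^2,
    x) - x. This limit is the number [e] of the proof, positive at a point given by
    [ratio_lt_exists]. *)
Lemma match_nonneg : exists lam x, [/\ 0 <= lam, lam < b ^+ 2 & 0 <= match_fun lam x].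
Proof.
have q01 : 0 < (1 - b ^+ 2) / 2 < 1 by move: bb0 bb1; move: (b ^+ 2) => c c0 c1; lra.
have [x x0 rx] := ratio_lt_exists q01.
have [C C0 HC] := ratio_small (x / b).
set e := - (2 * x) - ratio ((1 - b ^+ 2) / 2) x.
have e0 : 0 < e by rewrite subr_gt0.
have e20 : 0 < e / 2 by rewrite divr_gt0.
have := dv_continuous (logd_dvlam x bb1).
move=> /cvgrPdist_lt/(_ _ e20)[d /= d0 Hd].
(* The three bounds serve, in order: an error of at most e / 2 in the first term, nonnegativity of
   b^2 - t together with q2 <= 1, and b C q2 = t C / (2 b) <= e / 2 in the second term. *)
pose t := Num.min (d / 2) (Num.min (b ^+ 2) (e * b / C)).
have t0 : 0 < t by rewrite !lt_min divr_gt0// bb0 divr_gt0// mulr_gt0.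
have td : t <= d / 2 by rewrite ge_min lexx.
have tb : t <= b ^+ 2 by rewrite !ge_min lexx orbT.
have tC : t * C <= e * b by rewrite -ler_pdivlMr// !ge_min lexx !orbT.
exists (b ^+ 2 - t), x; split; [by rewrite subr_ge0|by rewrite gtrBl|].
have h1 : - (e / 2) < logd (b ^+ 2) x - logd (b ^+ 2 - t) x < e / 2.
  rewrite -ltr_norml; apply: Hd; rewrite /= opprB addrC subrK gtr0_norm//.
  by clear -td d0; lra.
set q2 := (1 - (b ^+ 2 - t) / b ^+ 2) / 2.
have q2E : q2 = t / b ^+ 2 / 2 by rewrite /q2; field; rewrite gt_eqF.
have q20 : 0 < q2 by rewrite q2E !divr_gt0.
have q21 : q2 <= 1.
  rewrite q2E ler_pdivrMr// mul1r; apply: (@le_trans _ _ 1); last by rewrite ler1n.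
  by rewrite ler_pdivrMr// mul1r.
have h2 : b * ratio q2 (x / b) <= e / 2.
  apply: (@le_trans _ _ (b * (C * q2))); first by rewrite ler_pM2l// HC.
  rewrite q2E (_ : b * _ = t * C / b / 2); last by field; rewrite gt_eqF.
  by rewrite ler_pM2r ?invr_gt0// ler_pdivrMr.
rewrite /match_fun; have -> : b * logd ((b ^+ 2 - t) / b ^+ 2) (x / b) = - x - b * ratio q2 (x / b).
  by rewrite /logd -/q2 mulrBr mulrN mulrCA divff ?mulr1// gt_eqF.
have E : logd (b ^+ 2) x = e + x by rewrite /e /logd; ring.
move: h1; rewrite E; move: h2; move: (ratio q2 _) (logd _ x) => r m h2 h1.
by clear -h1 h2; lra.
Qed.

Lemma match0_lt0 x : match_fun 0 x < 0.
Proof.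
rewrite /match_fun mul0r; have h1 := logd0_lt0 x; have h2 := logd0_lt0 (x / b).
have : b * logd 0 (x / b) < 0 by rewrite pmulr_rlt0.
by move: h1; move: (logd 0 x) (b * _) => s t; lra.
Qed.

Lemma match_far lam : 0 <= lam -> lam < b ^+ 2 ->
  exists C : R, forall x, x < - C \/ 0 < x -> match_fun lam x < 0.
Proof.
move=> l0 lb; have l01 : 0 <= lam < 1 by rewrite l0 (lt_trans lb).
have l01' : 0 <= lam / b ^+ 2 < 1 by rewrite div_sqr_ge0// div_sqr_lt1.
have [C1 C10 H1] := logd_far l01; have [C2 C20 H2] := logd_far l01'.
exists (Num.max C1 (b * C2)) => x H.
have [h1 h2] : logd lam x < 0 /\ logd (lam / b ^+ 2) (x / b) < 0.
  case: H => [|x0].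
    rewrite ltrNr gt_max => /andP[x1 x2]; split.
      by apply: H1; rewrite lerNr ltW.
    by apply: H2; rewrite ler_pdivrMr// mulNr lerNr mulrC ltW.
  split; first by apply: lt_trans (logd_lt x (andP l01).2) _; rewrite oppr_lt0.
  by apply: lt_trans (logd_lt _ (andP l01').2) _; rewrite oppr_lt0 divr_gt0.
have : b * logd (lam / b ^+ 2) (x / b) < 0 by rewrite pmulr_rlt0.
rewrite /match_fun; move: h1; move: (logd lam x) (b * _) => s t; lra.
Qed.

Lemma bottom_exists : exists bet zeta lamN xN : R,
  [/\ 0 < bet < b ^+ 2, zeta < 0, slope bet zeta = 0 & logd bet zeta < 0] /\
  [/\ match_fun bet zeta = 0, (forall x, match_fun bet x <= 0) &
      (forall x, match_fun bet x = 0 -> x = zeta)] /\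
  [/\ logd lamN xN = 0, (forall x, logd lamN x <= 0), bet < lamN, lamN < 1 &
      b ^+ 2 * lamN < bet].
Proof.
have [lam0 [x0 [l00 l0b nn]]] := match_nonneg.
have [C far] := match_far l00 l0b.
have [bet [zeta [bet0 betl Gz Gle]]] : exists bet zeta, [/\ 0 < bet, bet <= lam0,
    match_fun bet zeta = 0 & forall y, match_fun bet y <= 0].
  apply: (@attain _ (b ^+ 2) match_fun lam0 C).
  - by move=> x lam mu _; exact: match_incr.
  - by move=> lam x /andP[_ lb]; exact: dv_continuous (match_dvlam x lb).
  - by move=> lam /andP[_ lb] x; exact: dv_continuous (match_dvx x lb).
  - by rewrite l00.
  - exact: far.
  - by exists x0.
  - exact: match0_lt0.
have betb : bet < b ^+ 2 by exact: le_lt_trans betl l0b.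
have bet1 : bet < 1 by exact: lt_trans betb bb1.
have bet01 : 0 <= bet < 1 by rewrite ltW.
set bet' := bet / b ^+ 2.
have bet'0 : 0 < bet' by rewrite divr_gt0.
have bet'1 : bet' < 1 by exact: div_sqr_lt1.
have bet'01 : 0 <= bet' < 1 by rewrite ltW.
have bb' : bet < bet' by rewrite /bet' ltr_pdivlMr// gtr_pMr.
(* Such an x maximises [match_fun bet], so the two slopes add up to zero. Matching gives m(bet', x /
   b) = - m(bet, x) / b, so the second slope is the first divided by b^2 and both vanish. *)
have crit x : match_fun bet x = 0 -> slope bet x = 0 /\ slope bet' (x / b) = 0.
  move=> Gx; have d := match_dvx x betb.
  have : derive1 (match_fun bet) x = 0.
    have [||||_ e] := @derive1_at_max R (match_fun bet) (x - 1) (x + 1) x.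
    - by apply: (@le_trans _ _ x); rewrite ?gerBl ?lerDl ler01.
    - by move=> t _; case: (match_dvx t betb).
    - by rewrite in_itv/= gtrBl ltrDl ltr01.
    - by move=> t _; rewrite Gx.
    by rewrite derive1E e.
  rewrite (dv_derive1 d) -/bet'.
  have E : slope bet' (x / b) = slope bet x / b ^+ 2.
    have m2 : logd bet' (x / b) = - logd bet x / b.
      move: Gx; rewrite /match_fun -/bet' => /eqP; rewrite addr_eq0 => /eqP ->.
      by rewrite opprK mulrAC divff ?mul1r// gt_eqF.
    by rewrite /slope m2 /bet'; field; rewrite gt_eqF.
  rewrite E -{1}[slope bet x]mulr1 -mulrDr => /eqP; rewrite mulf_eq0 => /orP[/eqP->|].
    by rewrite mul0r.
  by rewrite gt_eqF// addr_gt0// invr_gt0.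
have [s1 s2] := crit _ Gz.
have [z [z0 _ uz _ mz]] := logd_crit bet01.
have [z' [z'0 _ uz' _ mz']] := logd_crit bet'01.
have zE : zeta = z by exact: uz.
have z'E : zeta / b = z' by exact: uz'.
(* Strict growth in lam, from bet to bet', and then the fact that zeta / b is where [logd bet'] is
   maximal. Since the matched terms have sum zero, this fixes their signs. *)
have m12 : logd bet zeta < logd bet' (zeta / b).
  apply: lt_le_trans (logd_incr zeta bb' bet'1) _.
  by rewrite z'E; have [->//|/mz'/ltW] := eqVneq zeta z'.
have Gz' : logd bet zeta + b * logd bet' (zeta / b) = 0 by [].
have mneg : logd bet zeta < 0.
  rewrite ltNge; apply/negP => m0.
  have := mulr_gt0 b0 (le_lt_trans m0 m12).
  by rewrite -(addKr (logd bet zeta) (b * _)) Gz' addr0 oppr_gt0 ltNge m0.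
have mpos : 0 < logd bet' (zeta / b).
  rewrite -(pmulr_rgt0 _ b0) -(addKr (logd bet zeta) (b * _)) Gz' addr0.
  by rewrite oppr_gt0.
have [C' C'0 far'] := logd_far bet'01.
(* The upper bound bet' is admissible because [logd bet'] is positive at zeta / b; the same
   positivity excludes lamN = bet'. *)
have [lamN [xN [lN0 lNb NE Nle]]] : exists lam x, [/\ 0 < lam, lam <= bet',
    logd lam x = 0 & forall y, logd lam y <= 0].
  apply: (@attain _ 1 logd bet' C').
  - by move=> x lam mu _; exact: logd_incr.
  - by move=> lam x /andP[_ lb]; exact: dv_continuous (logd_dvlam x lb).
  - by move=> lam /andP[_ lb] x; exact: dv_continuous (logd_dvx x lb).
  - exact: bet'01.
  - move=> x [/ltW|x0']; first exact: far'.
    by apply: lt_trans (logd_lt x bet'1) _; rewrite oppr_lt0.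
  - by exists (zeta / b); exact: ltW.
  - exact: logd0_lt0.
have lNb' : lamN < bet'.
  by rewrite lt_neqAle lNb andbT; apply/eqP => e; move: (Nle (zeta / b)); rewrite e leNgt mpos.
have lN1 : lamN < 1 by exact: lt_trans lNb' bet'1.
exists bet, zeta, lamN, xN; split; [|split]; split => //.
- by rewrite bet0.
- by rewrite zE.
- by move=> x /crit[/uz ->]; rewrite zE.
(* The maximum of [logd bet] is its negative value at zeta, so by monotonicity in lam a level lamN
   <= bet could not reach 0. *)
- rewrite ltNge; apply/negP => lNbet.
  have : logd bet xN < 0.
    by have [->|/mz h] := eqVneq xN z; [rewrite -zE|apply: lt_trans h _; rewrite -zE].
  rewrite ltNge => /negP; apply; rewrite -NE.
  move: lNbet; rewrite le_eqVlt => /predU1P[->|h]; [exact: lexx|apply: ltW; exact: logd_incr].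
- by rewrite mulrC -ltr_pdivlMr.
Qed.

End Bottom.

(** * The quadratic form *)

Section Jacobi.
Context {R : realType}.
Local Notation leb := (@lebesgue_measure R).
(** One computation for three domains: [bdry f] is [- f 0] on the right half-line, [f 0] on the left
    one and 0 on the whole line. *)
Variables (D : set R) (bdry : (R -> R) -> R).
Hypothesis mD : measurable D.
Hypothesis bdryE : forall f f' : R -> R, AC f f' -> Rint D f -> Rint D f' ->
  \int[leb]_(x in D) f' x = bdry f.

Variables (W m m' w v : R -> R) (lam C : R).
Hypothesis acw : AC w v.
Hypothesis acm : AC m m'.
Hypothesis cW : continuous W.
Hypothesis riccati : forall t, D t -> m' t = W t - lam - m t ^+ 2.
Hypothesis mC : forall t, D t -> m t ^+ 2 <= C * (1 + t ^+ 2).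
Hypothesis WC : forall t, D t -> `|W t| <= C * (1 + t ^+ 2).
Hypothesis mv : measurable_fun D v.
Hypothesis iN : Rint D (fun t => (1 + t ^+ 2) * w t ^+ 2).
Hypothesis iv : Rint D (fun t => v t ^+ 2).

Let mw : measurable_fun D w.
Proof.
apply: (measurable_funS measurableT) => //.
exact: continuous_measurable_fun (AC_continuous acw).
Qed.

Let mm : measurable_fun D m.
Proof.
apply: (measurable_funS measurableT) => //.
exact: continuous_measurable_fun (AC_continuous acm).
Qed.

Let mW : measurable_fun D W.
Proof.
by apply: (measurable_funS measurableT) => //; exact: continuous_measurable_fun.
Qed.

Let N_le (t K : R) : 0 <= K -> K <= C * (1 + t ^+ 2) -> K * w t ^+ 2 <= C * ((1 + t ^+ 2) * w t ^+ 2).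
Proof. by move=> K0 KC; rewrite mulrA ler_wpM2r// sqr_ge0. Qed.

Let Rint_w2 : Rint D (fun t => w t ^+ 2).
Proof.
apply: (Rint_le mD _ iN); first exact: measurable_funX.
move=> t _; rewrite ger0_norm ?sqr_ge0// ler_peMl ?sqr_ge0//.
by rewrite lerDl sqr_ge0.
Qed.

Let Rint_m2w2 : Rint D (fun t => m t ^+ 2 * w t ^+ 2).
Proof.
apply: (Rint_le mD _ (RintZ C mD iN)).
  by apply: measurable_funM; exact: measurable_funX.
move=> t Dt; rewrite ger0_norm; last by rewrite mulr_ge0 ?sqr_ge0.
by apply: N_le; [exact: sqr_ge0|exact: mC].
Qed.

Let Rint_Ww2 : Rint D (fun t => W t * w t ^+ 2).
Proof.
apply: (Rint_le mD _ (RintZ C mD iN)).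
  by apply: measurable_funM => //; exact: measurable_funX.
move=> t Dt; rewrite normrM (ger0_norm (sqr_ge0 (w t))).
by apply: N_le => //; exact: WC.
Qed.

Let Rint_mw2 : Rint D (fun t => m t * w t ^+ 2).
Proof.
apply: (Rint_le mD _ (RintD mD Rint_w2 Rint_m2w2)).
  by apply: measurable_funM => //; exact: measurable_funX.
move=> t Dt; rewrite normrM (ger0_norm (sqr_ge0 (w t))) -[X in _ <= X + _]mul1r -mulrDl.
rewrite ler_wpM2r ?sqr_ge0//; have := sqr_ge0 (`|m t| - 1).
have := normr_ge0 (m t); rewrite -(real_normK (num_real (m t))).
by move: `|m t| => z; nra.
Qed.

Let Rint_vwm : Rint D (fun t => (v t * w t + v t * w t) * m t).
Proof.
apply: (Rint_le mD _ (RintD mD iv Rint_m2w2)).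
  by apply: measurable_funM => //; apply: measurable_funD; exact: measurable_funM.
move=> t Dt; rewrite ler_norml.
have := sqr_ge0 (v t - m t * w t); have := sqr_ge0 (v t + m t * w t).
rewrite sqrrB sqrrD exprMn -(mulr_natl (v t * (m t * w t))).
move: (v t ^+ 2) (m t ^+ 2 * w t ^+ 2) => A B h1 h2.
have -> : (v t * w t + v t * w t) * m t = 2 * (v t * (m t * w t)) by ring.
by move: h1 h2; move: (2 * _) => z h1 h2; apply/andP; split; lra.
Qed.

Let acf : AC (fun t => w t * w t * m t) (fun t => (v t * w t + v t * w t) * m t + m' t * (w t * w t)).
Proof. exact: AC_mul (AC_mul acw acw) acm. Qed.

Let Rint_m'w2 : Rint D (fun t => m' t * (w t * w t)).
Proof.
have i := RintB mD (RintB mD Rint_Ww2 (RintZ lam mD Rint_w2)) Rint_m2w2.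
apply: (Rint_eq mD _ i) => t Dt.
by rewrite riccati//; ring.
Qed.

Lemma jacobi_Rint_energy : Rint D (fun t => v t ^+ 2 + W t * w t ^+ 2).
Proof. exact: RintD. Qed.

Lemma jacobi_Rint_defect : Rint D (fun t => (v t - m t * w t) ^+ 2).
Proof.
apply: (Rint_eq mD _ (RintB mD (RintD mD iv Rint_m2w2) Rint_vwm)) => t _.
ring.
Qed.

(* Completing the square: the cross term 2 m w v together with m' w^2 is the derivative of m w^2. *)
Lemma jacobi_identity :
  \int[leb]_(t in D) (v t - m t * w t) ^+ 2 =
  \int[leb]_(t in D) (v t ^+ 2 + W t * w t ^+ 2) - lam * \int[leb]_(t in D) w t ^+ 2
  - bdry (fun t => w t * w t * m t).
Proof.
have fi : Rint D (fun t => w t * w t * m t).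
  by apply: (Rint_eq mD _ Rint_mw2) => t _; ring.
have f'i : Rint D (fun t => (v t * w t + v t * w t) * m t + m' t * (w t * w t)).
  exact: RintD.
rewrite -(bdryE acf fi f'i) -RintegralZl// -RintegralB//; last 2 first.
- exact: RintD.
- exact: RintZ.
rewrite -RintegralB//; last by apply: RintB => //; [exact: RintD|exact: RintZ].
apply: eq_Rintegral => t /set_mem Dt; rewrite riccati//; ring.
Qed.

(* Polarised form at w = phi, where phi' = m phi makes the defect of phi vanish. *)
Variables (phi : R -> R).
Hypothesis acphi : AC phi (fun t => m t * phi t).
Hypothesis iNphi : Rint D (fun t => (1 + t ^+ 2) * phi t ^+ 2).

Lemma jacobi_polar :
  \int[leb]_(t in D) (m t * phi t * v t + W t * phi t * w t) =
  lam * (\int[leb]_(t in D) (phi t * w t)) + bdry (fun t => m t * phi t * w t).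
Proof.
have acmp := AC_mul acm acphi.
have acg := AC_mul acmp acw.
have mphi : measurable_fun D phi.
  apply: (measurable_funS measurableT) => //.
  exact: continuous_measurable_fun (AC_continuous acphi).
have C0 t : D t -> 0 <= C * (1 + t ^+ 2).
  by move=> Dt; apply: le_trans (mC Dt); exact: sqr_ge0.
have N'_le (t K : R) : K <= C * (1 + t ^+ 2) -> K * phi t ^+ 2 <= C * ((1 + t ^+ 2) * phi t ^+ 2).
  by move=> KC; rewrite mulrA ler_wpM2r// sqr_ge0.
have iphi2 : Rint D (fun t => phi t ^+ 2).
  apply: (Rint_le mD _ iNphi); first exact: measurable_funX.
  move=> t _; rewrite ger0_norm ?sqr_ge0// ler_peMl ?sqr_ge0//.
  by rewrite lerDl sqr_ge0.
have im2p2 : Rint D (fun t => m t ^+ 2 * phi t ^+ 2).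
  apply: (Rint_le mD _ (RintZ C mD iNphi)).
    by apply: measurable_funM; exact: measurable_funX.
  move=> t Dt; rewrite ger0_norm; last by rewrite mulr_ge0 ?sqr_ge0.
  by apply: N'_le; exact: mC.
have prod (f g : R -> R) : measurable_fun D f -> measurable_fun D g ->
    Rint D (fun t => f t ^+ 2) -> Rint D (fun t => g t ^+ 2) -> Rint D (fun t => f t * g t).
  move=> mf mg fi gi; apply: (Rint_le mD _ (RintD mD fi gi)); first exact: measurable_funM.
  move=> t _; rewrite normrM -(real_normK (num_real (f t))) -(real_normK (num_real (g t))).
  move: (normr_ge0 (f t)) (normr_ge0 (g t)); move: `|f t| `|g t| => x y x0 y0.
  by have := sqr_ge0 (x - y); nra.
have mmphi : measurable_fun D (fun t => m t * phi t) by exact: measurable_funM.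
have immphi : Rint D (fun t => (m t * phi t) ^+ 2).
  by apply: (Rint_eq mD _ im2p2) => t _; rewrite exprMn.
have i1 := prod _ _ mmphi mv immphi iv.
have i2 := prod _ _ mmphi mw immphi Rint_w2.
have i3 := prod _ _ mphi mw iphi2 Rint_w2.
have i4 : Rint D (fun t => W t * phi t * w t).
  apply: (Rint_le mD _ (RintD mD (RintZ C mD iNphi) (RintZ C mD iN))).
    by apply: measurable_funM => //; exact: measurable_funM.
  move=> t Dt; rewrite !normrM.
  have WCt := WC Dt; have c0 := C0 _ Dt.
  apply: (@le_trans _ _ (C * (1 + t ^+ 2) * (phi t ^+ 2 + w t ^+ 2))); last first.
    by rewrite le_eqVlt; apply/predU1P; left; ring.
  rewrite -(mulrA `|W t|); apply: ler_pM => //.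
  rewrite -(real_normK (num_real (phi t))) -(real_normK (num_real (w t))).
  move: (normr_ge0 (phi t)) (normr_ge0 (w t)); move: `|phi t| `|w t| => x y x0 y0.
  by have := sqr_ge0 (x - y); nra.
have ig' : Rint D (fun t => (m' t * phi t + m t * phi t * m t) * w t + v t * (m t * phi t)).
  apply: (Rint_eq mD _ (RintD mD (RintB mD i4 (RintZ lam mD i3)) i1)) => t Dt.
  by rewrite riccati//; ring.
rewrite -(bdryE acg i2 ig') -RintegralZl// -RintegralD//; last exact: RintZ.
apply: eq_Rintegral => t /set_mem Dt; rewrite riccati//; ring.
Qed.

End Jacobi.

(** * Gluing at the origin and weak derivatives of continuously differentiable functions *)

Section ACTools.
Context {R : realType}.
Local Notation leb := (@lebesgue_measure R).
Implicit Types (f g : R -> R) (D A B : set R).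

Lemma Rint_mkcond D f : measurable D -> Rint D f <-> Rint setT (f \_ D).
Proof. by move=> mD; have := integrable_mkcond (mu := leb) (EFin \o f) mD; rewrite restrict_EFin. Qed.

Lemma Rint_setU A B f : measurable A -> measurable B -> Rint A f -> Rint B f ->
  Rint (A `|` B) f.
Proof.
move=> mA mB iA iB; apply/Rint_mkcond; first exact: measurableU.
have jA := (Rint_mkcond f mA).1 iA; have jB := (Rint_mkcond f mB).1 iB.
apply: (Rint_le measurableT _ (RintD measurableT (Rint_abs jA) (Rint_abs jB))).
  apply/(measurable_restrictT _ _).1; first exact: measurableU.
  by apply/measurable_funU => //; split; exact: Rint_measurable.
move=> x _; rewrite !patchE in_setU.
by case: (x \in A) => /=; case: (x \in B) => /=; rewrite ?normr0 ?addr0 ?add0r// lerDl.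
Qed.

Definition glue f1 f2 (t : R) : R := if 0 <= t then f1 t else f2 t.

Lemma glue_continuous f1 f2 : continuous f1 -> continuous f2 -> f1 0 = f2 0 ->
  continuous (glue f1 f2).
Proof.
move=> c1 c2 e.
have -> : glue f1 f2 = fun t => f1 (Num.max t 0) + f2 (Num.min t 0) - f1 0.
  apply/funext => t; rewrite /glue; case: leP => t0.
    by rewrite e addrK.
  by rewrite addrC addKr.
move=> t.
have cmax : {for t, continuous (fun t : R => Num.max t (0 : R))}.
  by apply: continuous_max; [exact: cvg_id|exact: cvg_cst].
have cmin : {for t, continuous (fun t : R => Num.min t (0 : R))}.
  by apply: continuous_min; [exact: cvg_id|exact: cvg_cst].
apply: cvgB; last exact: cvg_cst.
have H1 : {for t, continuous (f1 \o (fun t : R => Num.max t (0 : R)))}.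
  by apply: continuous_comp => //; exact: c1.
have H2 : {for t, continuous (f2 \o (fun t : R => Num.min t (0 : R)))}.
  by apply: continuous_comp => //; exact: c2.
exact: cvgD H1 H2.
Qed.

Lemma AC_glue f1 f1' f2 f2' : AC f1 f1' -> AC f2 f2' -> f1 0 = f2 0 ->
  continuous f1' -> continuous f2' -> f1' 0 = f2' 0 ->
  AC (glue f1 f2) (glue f1' f2').
Proof.
move=> ac1 ac2 e c1 c2 e' a b ab.
have ig x y : Rint `[x, y] (glue f1' f2').
  by apply: Rint_continuous; exact: glue_continuous.
split => //.
have pos x y : 0 <= x -> x <= y -> glue f1 f2 y - glue f1 f2 x = \int[leb]_(t in `[x, y]) glue f1' f2' t.
  move=> x0 xy; have [_ E] := ac1 _ _ xy.
  rewrite /glue x0 (le_trans x0 xy) E; apply: eq_Rintegral => t /set_mem/=.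
  by rewrite in_itv/= => /andP[xt _]; rewrite (le_trans x0 xt).
have neg x y : x <= y -> y <= 0 -> glue f1 f2 y - glue f1 f2 x = \int[leb]_(t in `[x, y]) glue f1' f2' t.
  have gE h1 h2 (t : R) : h1 0 = h2 0 -> t <= 0 -> glue h1 h2 t = h2 t.
    by rewrite /glue => h; rewrite le_eqVlt => /predU1P[->|t0]; [rewrite lexx|rewrite leNgt t0].
  move=> xy y0; have [_ E] := ac2 _ _ xy.
  rewrite !gE// ?(le_trans xy)// E; apply: eq_Rintegral => t /set_mem/=.
  by rewrite in_itv/= => /andP[_ ty]; rewrite gE// (le_trans ty).
have [a0|a0] := leP 0 a; first exact: pos.
have [b0|b0] := leP b 0; first exact: neg.
rewrite (Rintegral_cat (ltW a0) (ltW b0) (ig _ _)) -neg ?(ltW a0)// -pos ?(ltW b0)//.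
by move: (glue _ _ b) (glue _ _ 0) (glue _ _ a) => x y z; ring.
Qed.

Lemma AC_dv f f' (x : R) : AC f f' -> continuous f' -> is_derive x 1 f (f' x).
Proof.
move=> acf cf'; have l1 : x - 1 < x by rewrite gtrBl.
have [||d e] := @continuous_FTC1_closed R f' (x - 1) x (x + 1) _ _ l1 (cf' x).
- by rewrite ltrDl.
- exact: Rint_continuous.
apply: (@near_eq_is_derive _ _ _ (fun t => f (x - 1) + \int[leb]_(s in `[x - 1, t]) f' s)).
  near=> t; have xt : x - 1 <= t by apply: ltW; near: t; exact: lt_nbhsr.
  by have [_ <-] := acf _ _ xt; rewrite addrC subrK.
have := dvD (dv_cst (f (x - 1)) x) (derivable_dv d).
by rewrite add0r e.
Unshelve. all: by end_near. Qed.

Lemma Rint_compact_support f a b : continuous f -> (forall x, x < a \/ b < x -> f x = 0) ->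
  Rint setT f.
Proof.
move=> cf f0; have := (Rint_mkcond f (measurable_itv `[a, b]%R)).1 (Rint_continuous a b cf).
apply: Rint_eq => // x _; rewrite patchE; case: ifPn => //.
rewrite notin_setE/= in_itv/= => /negP; rewrite negb_and -!ltNge => h.
by rewrite f0//; apply/orP.
Qed.

Lemma test_fun_derive0 D (phi : R -> R) m M : (forall x, x < m \/ M < x -> phi x = 0) ->
  forall x, x < m \/ M < x -> derive1 phi x = 0.
Proof.
move=> h x H; apply: dv_derive1; apply: (@near_eq_is_derive _ _ _ (fun=> 0)).
case: H => xm; near=> t; rewrite h//; [left|right]; near: t.
- exact: lt_nbhsl.
- exact: lt_nbhsr.
Unshelve. all: by end_near. Qed.

Lemma AC_weak_deriv D f f' : measurable D -> AC f f' -> continuous f' -> weak_deriv D f f'.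
Proof.
move=> mD acf cf' phi [sphi [m [M [mMD phi0]]]].
have cf := AC_continuous acf; have cp := smooth_continuous sphi.
have cp' := smooth_continuous (smooth_derive1 sphi).
have phi'0 := test_fun_derive0 D phi0.
have i1 : Rint setT (fun x => f x * derive1 phi x).
  apply: (@Rint_compact_support _ m M) => [x|x /phi'0 ->]; last by rewrite mulr0.
  by apply: cvgM; [exact: cf|exact: cp'].
have i2 : Rint setT (fun x => f' x * phi x).
  apply: (@Rint_compact_support _ m M) => [x|x /phi0 ->]; last by rewrite mulr0.
  by apply: cvgM; [exact: cf'|exact: cp].
have j1 := RintS measurableT mD (@subsetT _ _) i1.
have j2 := RintS measurableT mD (@subsetT _ _) i2.
have acphi : AC phi (derive1 phi) by apply: AC_C1 => // x; exact: smooth_dv.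
have acp := AC_mul acf acphi.
have i0 : Rint setT (fun x => f x * phi x).
  apply: (@Rint_compact_support _ m M) => [x|x /phi0 ->]; last by rewrite mulr0.
  by apply: cvgM; [exact: cf|exact: cp].
have i12 : Rint setT (fun x => f' x * phi x + derive1 phi x * f x).
  apply: (Rint_eq measurableT _ (RintD measurableT i2 i1)) => x _.
  by rewrite (mulrC (f x)).
have E := AC_integral_line acp i0 i12.
have : \int[leb]_(x in D) (f' x * phi x + f x * derive1 phi x) = 0.
  rewrite -{}E.
  have out x : ~ D x -> x < m \/ M < x.
    move=> Dx; apply/orP; rewrite !ltNge -negb_and; apply/negP => /andP[mx xM].
    by apply: Dx; apply: mMD; rewrite /= mx.
  rewrite [RHS](@Rintegral_support _ _ D)//.
    by apply: eq_Rintegral => x _; rewrite (mulrC (f x)).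
  by move=> x _ /out o; rewrite (phi0 _ o) (phi'0 _ o) mul0r mulr0 addr0.
rewrite RintegralD// => /eqP; rewrite addr_eq0 => /eqP e.
have fk g : Rint D g -> (\int[leb]_(x in D) (g x)%:E = (\int[leb]_(x in D) g x)%:E)%E.
  by move=> ig; rewrite /Rintegral fineK//; exact: integrable_fin_num ig.
by rewrite (fk _ j1) (fk _ j2) e EFinN oppeK.
Qed.

End ACTools.

(** * The form domain and the Rayleigh quotient *)

Section FormDomain.
Context {R : realType}.
Local Notation leb := (@lebesgue_measure R).
Implicit Types (u v w W m phi : R -> R) (D : set R).

Lemma Rint_ae D (f g : R -> R) : measurable D -> measurable_fun D g ->
  {ae leb, forall x, D x -> f x = g x} -> Rint D f -> Rint D g.
Proof.
move=> mD mg fg /integrableP[mf fi]; apply/integrableP; split; first exact/measurable_EFinP.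
apply: le_lt_trans fi; rewrite le_eqVlt; apply/predU1P; left.
apply: ae_eq_integral => //.
- by apply: measurableT_comp => //; exact/measurable_EFinP.
- exact: measurableT_comp.
- by apply: (@filterS _ _ (ae_filter_ringOfSetsType leb) _ _ _ fg) => x H Dx /=; rewrite H.
Qed.

Lemma Rintegral_ae D (f g : R -> R) : measurable D -> measurable_fun D f -> measurable_fun D g ->
  {ae leb, forall x, D x -> f x = g x} -> \int[leb]_(x in D) f x = \int[leb]_(x in D) g x.
Proof.
move=> mD mf mg fg; congr fine; apply: ae_eq_integral => //.
- exact/measurable_EFinP.
- exact/measurable_EFinP.
- by apply: (@filterS _ _ (ae_filter_ringOfSetsType leb) _ _ _ fg) => x H Dx /=; rewrite H.
Qed.

Lemma form_dom_AC D u v p : open D -> D p ->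
  (forall x y, D x -> D y -> `[x, y]%classic `<=` D) -> form_dom D u v ->
  exists w, [/\ AC w (v \_ D), {ae leb, forall x, D x -> u x = w x},
    measurable_fun D (v \_ D), Rint D (fun t => (1 + t ^+ 2) * w t ^+ 2) &
    Rint D (fun t => (v \_ D) t ^+ 2)].
Proof.
move=> oD Dp cD [u2 [v2 [xu2 wd]]]; have mD : measurable D by exact: open_measurable.
have [w acw uw] := weak_deriv_AC oD Dp cD u2 v2 wd.
have mw : measurable_fun D w.
  apply: (measurable_funS measurableT) => //.
  exact: continuous_measurable_fun (AC_continuous acw).
exists w; split => //.
- by apply: (measurable_funS measurableT) => //; exact: L2on_measurable_restrict.
- apply: (@Rint_ae _ (fun x => u x ^+ 2 + (x * u x) ^+ 2)) => //.
  + apply: measurable_funM; last exact: measurable_funX.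
    by apply: measurable_funD => //; exact: measurable_funX.
  + apply: (@filterS _ _ (ae_filter_ringOfSetsType leb) _ _ _ uw) => x H Dx.
    by rewrite H//; ring.
  + by apply: RintD => //; [exact: u2.2|exact: xu2.2].
- by apply: (Rint_eq mD _ v2.2) => x Dx; rewrite patchE mem_set.
Qed.

Lemma norm2_AC D u v w : measurable D -> form_dom D u v -> measurable_fun D w ->
  {ae leb, forall x, D x -> u x = w x} -> norm2 D u = \int[leb]_(x in D) w x ^+ 2.
Proof.
move=> mD [[mu_ _] _] mw uw; apply: Rintegral_ae => //; try exact: measurable_funX.
by apply: (@filterS _ _ (ae_filter_ringOfSetsType leb) _ _ _ uw) => x H Dx; rewrite H.
Qed.

Lemma qform_AC D W u v w : measurable D -> continuous W -> form_dom D u v -> measurable_fun D w ->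
  {ae leb, forall x, D x -> u x = w x} ->
  qform D W u v = \int[leb]_(x in D) ((v \_ D) x ^+ 2 + W x * w x ^+ 2).
Proof.
move=> mD cW [[mu_ _] [[mv _] _]] mw uw.
have mW : measurable_fun D W.
  by apply: (measurable_funS measurableT) => //; exact: continuous_measurable_fun.
transitivity (\int[leb]_(x in D) (v x ^+ 2 + W x * w x ^+ 2)).
  apply: Rintegral_ae => //.
  - by apply: measurable_funD; [|apply: measurable_funM => //]; exact: measurable_funX.
  - by apply: measurable_funD; [|apply: measurable_funM => //]; exact: measurable_funX.
  by apply: (@filterS _ _ (ae_filter_ringOfSetsType leb) _ _ _ uw) => x H Dx; rewrite H.
by apply: eq_Rintegral => x Dx; rewrite patchE Dx.
Qed.

(** For a solution of phi' = m phi with m of at most linear growth, the weight 1 + t^2 controls the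
    derivative as well, so a single integrability condition gives membership in the form domain. *)
Lemma trial_form_dom D phi m (C : R) : measurable D -> AC phi (fun t => m t * phi t) ->
  continuous m -> (forall t, D t -> m t ^+ 2 <= C * (1 + t ^+ 2)) ->
  Rint D (fun t => (1 + t ^+ 2) * phi t ^+ 2) -> form_dom D phi (fun t => m t * phi t).
Proof.
move=> mD acp cm mC iN; have cp := AC_continuous acp.
have cmp : continuous (fun t => m t * phi t) by move=> t; apply: cvgM; [exact: cm|exact: cp].
have meas (f : R -> R) : continuous f -> measurable_fun D f.
  by move=> cf; apply: (measurable_funS measurableT) => //; exact: continuous_measurable_fun.
split; [|split; [|split]].
- split; first exact: meas.
  apply: (Rint_le mD _ iN); first by apply: measurable_funX; exact: meas.
  by move=> t _; rewrite ger0_norm ?sqr_ge0// ler_peMl ?sqr_ge0// lerDl sqr_ge0.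
- split; first exact: meas.
  apply: (Rint_le mD _ (RintZ C mD iN)); first by apply: measurable_funX; exact: meas.
  move=> t Dt; rewrite ger0_norm ?sqr_ge0// exprMn mulrA.
  by rewrite ler_wpM2r ?sqr_ge0// mC.
- have mx : measurable_fun D (fun t => t * phi t) by apply: measurable_funM => //; exact: meas.
  split; first exact: mx.
  apply: (Rint_le mD _ iN); first exact: measurable_funX.
  move=> t _; rewrite ger0_norm ?sqr_ge0// exprMn ler_wpM2r ?sqr_ge0//.
  by rewrite lerDr.
- exact: AC_weak_deriv.
Qed.

Lemma norm2_ge0 D u : 0 <= norm2 D u.
Proof. by apply: Rintegral_ge0 => x _; exact: sqr_ge0. Qed.

(** The witness excludes the empty set of quotients, whose infimum would be a default value. *)
Lemma lowest_ge D W lam : (exists u v, form_dom D u v /\ norm2 D u != 0) ->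
  (forall u v, form_dom D u v -> lam * norm2 D u <= qform D W u v) -> lam <= lowest D W.
Proof.
move=> [u0 [v0 [d0 n0]]] H; apply: lb_le_inf.
  by exists (qform D W u0 v0 / norm2 D u0), u0, v0.
move=> _ [u [v [d [n ->]]]]; rewrite ler_pdivlMr ?H//.
by rewrite lt_neqAle eq_sym n norm2_ge0.
Qed.

Lemma lowest_le D W lam u v : (forall t, 0 <= W t) -> form_dom D u v -> norm2 D u != 0 ->
  qform D W u v = lam * norm2 D u -> lowest D W <= lam.
Proof.
move=> W0 d n E; apply: ge_inf; last by exists u, v; split => //; split => //; rewrite E mulfK.
exists 0 => _ [u' [v' [_ [_ ->]]]]; apply: divr_ge0; last exact: norm2_ge0.
by apply: Rintegral_ge0 => x _; rewrite addr_ge0 ?sqr_ge0// mulr_ge0// sqr_ge0.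
Qed.

Lemma trial_norm2 D phi : open D -> (exists p, D p) -> continuous phi -> (forall t, 0 < phi t) ->
  Rint D (fun t => (1 + t ^+ 2) * phi t ^+ 2) -> 0 < norm2 D phi.
Proof.
move=> oD [p Dp] cp p0 iN; have mD : measurable D by exact: open_measurable.
have cp2 : continuous (fun t => phi t ^+ 2).
  have -> : (fun t => phi t ^+ 2) = fun t => phi t * phi t by apply/funext => t; rewrite expr2.
  by move=> t; apply: cvgM; exact: cp.
apply: (@Rintegral_gt0 _ D _ p) => //.
- apply: (Rint_le mD _ iN).
    by apply: (measurable_funS measurableT) => //; exact: continuous_measurable_fun.
  by move=> t _; rewrite ger0_norm ?sqr_ge0// ler_peMl ?sqr_ge0// lerDl sqr_ge0.
- by move=> t; exact: sqr_ge0.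
- by rewrite exprn_gt0.
Qed.

Lemma right_open : open [set t : R | 0 < t]. Proof. exact: open_gt. Qed.

Lemma right_convex (x y : R) : 0 < x -> 0 < y -> `[x, y]%classic `<=` [set t : R | 0 < t].
Proof. by move=> x0 y0 t /=; rewrite in_itv/= => /andP[xt _]; exact: lt_le_trans xt. Qed.

Lemma boundary_right (f f' : R -> R) : AC f f' -> Rint [set t | 0 < t] f ->
  Rint [set t | 0 < t] f' -> \int[leb]_(t in [set t | 0 < t]) f' t = - f 0.
Proof.
have -> : [set t : R | 0 < t] = `]0, +oo[%classic by rewrite set_itvoy.
move=> acf fi f'i; rewrite Rintegral_itv_obnd_cbnd//.
have cl g : Rint `[0, 1] g -> Rint `]0, +oo[ g -> Rint `[0, +oo[ g.
  move=> i1 i2; have i := Rint_setU (measurable_itv _) (measurable_itv _) i1 i2.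
  apply: RintS i => //; first exact: measurableU.
  move=> t /=; rewrite !in_itv/= !andbT => t0.
  by have [t1|t1] := leP t 1; [left; rewrite t0|right; exact: lt_trans ltr01 t1].
apply: AC_integral_right => //; apply: cl => //.
- exact: Rint_continuous (AC_continuous acf).
- exact: AC_Rint acf.
Qed.

Lemma boundary_left (f f' : R -> R) : AC f f' -> Rint `]-oo, 0] f ->
  Rint `]-oo, 0] f' -> \int[leb]_(t in `]-oo, 0]) f' t = f 0.
Proof. exact: AC_integral_left. Qed.

End FormDomain.

(** * The Neumann problem on the half-line *)

Section Branch.
Context {R : realType}.
Local Notation leb := (@lebesgue_measure R).
Variables (lam c d : R).
Hypothesis lam1 : lam < 1.

(** Logarithmic derivative of t -> psi(lam, c t + d), a solution for the potential c^2 (c t + d)^2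
    at energy c^2 lam. The right branch has c = 1, d = xi. The left one has c = - b, d = xi / b and
    lam / b^2 for lam, which gives the potential (xi - b^2 t)^2 at energy lam. *)
Definition branch_m (t : R) : R := c * logd lam (c * t + d).
Definition branch_m' (t : R) : R := c ^+ 2 * slope lam (c * t + d).
Definition branch_phi (t : R) : R := psi lam (c * t + d).

Lemma affine_continuous (f : R -> R) : continuous f -> continuous (fun t => f (c * t + d)).
Proof.
move=> cf t; have cl : {for t, continuous (fun t => c * t + d)}.
  by apply: cvgD; [apply: cvgMr; exact: cvg_id|exact: cvg_cst].
have : {for t, continuous (f \o (fun t => c * t + d))} by apply: continuous_comp => //; exact: cf.
by [].
Qed.

Lemma branch_m'_continuous : continuous branch_m'.
Proof. by move=> t; apply: cvgMr; exact: (affine_continuous (slope_continuous lam1)). Qed.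

Lemma branch_m_AC : AC branch_m branch_m'.
Proof.
apply: AC_C1; last exact: branch_m'_continuous.
move=> t; rewrite /branch_m' expr2 -mulrA; apply/dvZ/dv_affine; exact: logd_dvx.
Qed.

Lemma branch_m_continuous : continuous branch_m.
Proof. exact: AC_continuous branch_m_AC. Qed.

Lemma branch_phi_AC : AC branch_phi (fun t => branch_m t * branch_phi t).
Proof.
have cp : continuous branch_phi.
  by apply: affine_continuous => x; exact: dv_continuous (psi_dv x lam1).
apply: AC_C1; last by move=> t; apply: cvgM; [exact: branch_m_continuous|exact: cp].
by move=> t; rewrite /branch_m -mulrA; apply: dv_affine; exact: psi_dv.
Qed.

Lemma branch_phi_gt0 t : 0 < branch_phi t. Proof. exact: psi_gt0. Qed.

Lemma branch_riccati t : branch_m' t =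
  c ^+ 2 * (c * t + d) ^+ 2 - c ^+ 2 * lam - branch_m t ^+ 2.
Proof. by rewrite /branch_m' /branch_m /slope exprMn; ring. Qed.

Lemma affine_sqr (t : R) : (c * t + d) ^+ 2 <= (2 * c ^+ 2 + 2 * d ^+ 2) * (1 + t ^+ 2).
Proof.
have := sqr_ge0 (c * t - d); have := sqr_ge0 c; have := sqr_ge0 (d * t).
rewrite sqrrB sqrrD !exprMn.
move: (c ^+ 2) (d ^+ 2) (t ^+ 2) (c * t * d *+ 2) => C D T E h1 h2 h3; nra.
Qed.

Lemma branch_m_bound : exists C : R, forall t, 0 <= c * t -> branch_m t ^+ 2 <= C * (1 + t ^+ 2).
Proof.
have [C0 H] := logd_bound d lam1.
exists (c ^+ 2 * (2 * C0 ^+ 2 + 2 * (2 * c ^+ 2 + 2 * d ^+ 2))) => t ct.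
rewrite /branch_m exprMn -mulrA ler_wpM2l ?sqr_ge0//.
have := H (c * t + d); rewrite lerDr => /(_ ct).
have := affine_sqr t; set x := c * t + d; move: (2 * c ^+ 2 + _) => K.
rewrite -(real_normK (num_real (logd _ _))) -(real_normK (num_real x)).
move: (normr_ge0 (logd lam x)) (normr_ge0 x); move: `|logd lam x| `|x| => m y m0 y0 hy hm.
have : m ^+ 2 <= (C0 + y) ^+ 2 by rewrite ler_sqr ?nnegrE ?(le_trans m0).
have := sqr_ge0 (C0 - y); have := sqr_ge0 (C0 * t); rewrite exprMn sqrrB sqrrD.
move: hy; move: (C0 ^+ 2) (y ^+ 2) (t ^+ 2) (m ^+ 2) (C0 * y *+ 2) => A Y T M E *; nra.
Qed.

End Branch.

(** * Gaussian decay of the branches *)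

Section Decay.
Context {R : realType}.
Implicit Types (lam c d t : R).

Lemma Iker_nincr q (x y : R) : 0 < q -> x <= y -> Iker q y <= Iker q x.
Proof.
move=> q0; rewrite le_eqVlt => /predU1P[->//|xy].
have [z _ e] := @mean_value _ (Iker q) _ x y xy (fun t _ => Iker_dvx t q0).
rewrite -subr_le0 e; apply: mulr_le0_ge0; last by rewrite subr_ge0 ltW.
rewrite oppr_le0; apply: ltW; apply: Iker_gt0; exact: addr_gt0 q0 ltr01.
Qed.

Lemma psi_decay lam c d : lam < 1 -> 0 < c -> exists K : R, forall t, 0 <= t ->
  (1 + t ^+ 2) * psi lam (c * t + d) ^+ 2 <= K * hump 1 t.
Proof.
move=> l1 c0; set q := (1 - lam) / 2; have q0 : 0 < q by rewrite /q; lra.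
(* Completes a square: A - 2 t + (c t + d)^2 = (c t + d - 1 / c)^2, so the Gaussian absorbs the
   factor e^t and still leaves e^(-t). *)
set A := c ^- 2 - 2 * d / c.
exists (8 * Iker q d ^+ 2 * expR A) => t t0.
have x0 : d <= c * t + d by rewrite lerDr mulr_ge0// ltW.
have I0 := Iker_gt0 (c * t + d) q0.
have h1 : 1 + t ^+ 2 <= 2 * expR t.
  have := expR_ge1Dxn 1 t0; rewrite (_ : 2`!%:R = 2 :> R)// => h.
  by have := sqr_ge0 t; clear -h; lra.
have h2 : psi lam (c * t + d) ^+ 2 <= Iker q d ^+ 2 * expR (- (c * t + d) ^+ 2).
  rewrite /psi -/q exprMn -expRM_natl mulrN mulrC.
  rewrite (_ : 2%:R * ((c * t + d) ^+ 2 / 2) = (c * t + d) ^+ 2); last by field.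
  apply: ler_wpM2r; first exact: expR_ge0.
  by rewrite ler_sqr; [exact: Iker_nincr|exact: ltW I0|exact: ltW (Iker_gt0 _ q0)].
have h3 : expR t * expR (- (c * t + d) ^+ 2) <= expR A * expR (- t).
  rewrite -!expRD ler_expR.
  have cn : c != 0 by rewrite gt_eqF.
  have E : A - t - (t - (c * t + d) ^+ 2) = (c * t + d - c^-1) ^+ 2 by rewrite /A; field.
  by rewrite -subr_ge0 (_ : _ - _ = (c * t + d - c^-1) ^+ 2) ?sqr_ge0// -E; ring.
have h4 : expR (- t) <= 4 * hump 1 t.
  rewrite /hump mul1r mulrA ler_pdivlMr ?exprn_gt0 ?addr_gt0 ?expR_gt0//.
  have e1 : 1 <= expR t by rewrite -expR0 ler_expR.
  rewrite expRN ler_pdivrMl ?expR_gt0//.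
  by move: (expR t) e1 => e e1; nra.
apply: (@le_trans _ _ (2 * expR t * (Iker q d ^+ 2 * expR (- (c * t + d) ^+ 2)))).
  by apply: ler_pM => //; rewrite ?sqr_ge0// addr_ge0// sqr_ge0.
have I2 : 0 <= 2 * Iker q d ^+ 2 by rewrite mulr_ge0// sqr_ge0.
rewrite (_ : 2 * expR t * _ = 2 * Iker q d ^+ 2 * (expR t * expR (- (c * t + d) ^+ 2))); last by ring.
apply: (le_trans (ler_wpM2l I2 h3)).
rewrite (_ : 8 * _ * _ * _ = 2 * Iker q d ^+ 2 * (expR A * (4 * hump 1 t))); last by ring.
by apply: ler_wpM2l => //; rewrite ler_wpM2l// expR_ge0.
Qed.

Lemma branch_phi_right lam c d D : measurable D -> (forall t, D t -> 0 <= t) -> lam < 1 -> 0 < c ->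
  Rint D (fun t => (1 + t ^+ 2) * branch_phi lam c d t ^+ 2).
Proof.
move=> mD D0 l1 c0; have [K HK] := psi_decay d l1 c0.
apply: (Rint_le mD _ (RintZ K mD (RintS measurableT mD (@subsetT _ _) (hump_Rint ltr01)))).
  have mp : measurable_fun D (branch_phi lam c d).
    apply: (measurable_funS measurableT) => //; apply: continuous_measurable_fun.
    exact: AC_continuous (branch_phi_AC c d l1).
  by apply: measurable_funM; [exact: measurable_funD|exact: measurable_funX].
move=> t /D0 t0; rewrite ger0_norm; first exact: HK.
by rewrite mulr_ge0 ?sqr_ge0// addr_ge0// sqr_ge0.
Qed.

Lemma branch_phi_left lam c d D : measurable D -> (forall t, D t -> t <= 0) -> lam < 1 -> c < 0 ->
  Rint D (fun t => (1 + t ^+ 2) * branch_phi lam c d t ^+ 2).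
Proof.
move=> mD D0 l1 c0; have c0' : 0 < - c by rewrite oppr_gt0.
have [K HK] := psi_decay d l1 c0'.
apply: (Rint_le mD _ (RintZ K mD (RintS measurableT mD (@subsetT _ _) (hump_Rint ltr01)))).
  have mp : measurable_fun D (branch_phi lam c d).
    apply: (measurable_funS measurableT) => //; apply: continuous_measurable_fun.
    exact: AC_continuous (branch_phi_AC c d l1).
  by apply: measurable_funM; [exact: measurable_funD|exact: measurable_funX].
move=> t /D0 t0; rewrite ger0_norm; last by rewrite mulr_ge0 ?sqr_ge0// addr_ge0// sqr_ge0.
have := HK (- t); rewrite oppr_ge0 mulrNN sqrrN => /(_ t0).
by have /= -> := hump_even 1 t.
Qed.

End Decay.

Section HalfLine.
Context {R : realType}.
Local Notation leb := (@lebesgue_measure R).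
Implicit Types (lam xi : R) (u v w : R -> R).

Lemma shift_sqr_continuous (c d : R) : continuous (fun t => (c * t + d) ^+ 2).
Proof.
move=> t; apply: (dv_continuous (a := 2 * (c * t + d) * c)).
apply: dv_sqr; rewrite -[X in is_derive _ _ _ X]addr0 -[X in X + 0]mulr1.
exact: dvD (dvZ c (dv_id t)) (dv_cst d t).
Qed.

Lemma half_jacobi (D : set R) (bdry : (R -> R) -> R) lam (c d : R) (W w v : R -> R) :
  measurable D ->
  (forall f f', AC f f' -> Rint D f -> Rint D f' -> \int[leb]_(x in D) f' x = bdry f) ->
  lam < 1 -> (forall t, D t -> 0 <= c * t) ->
  (forall t, D t -> W t = c ^+ 2 * (c * t + d) ^+ 2) -> AC w v ->
  measurable_fun D v -> Rint D (fun t => (1 + t ^+ 2) * w t ^+ 2) -> Rint D (fun t => v t ^+ 2) ->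
  Rint D (fun t => v t ^+ 2 + W t * w t ^+ 2) /\
  \int[leb]_(t in D) (v t - branch_m lam c d t * w t) ^+ 2 =
  \int[leb]_(t in D) (v t ^+ 2 + W t * w t ^+ 2) - c ^+ 2 * lam * \int[leb]_(t in D) w t ^+ 2
  - bdry (fun t => w t * w t * branch_m lam c d t).
Proof.
move=> mD bE l1 ct WE acw mv iN iv; have [C HC] := @branch_m_bound _ lam c d l1.
(* A polynomial that agrees with [W] on [D]; it supplies the potential continuous on the whole line
   that the Jacobi identity asks for. *)
set W' := fun t : R => c ^+ 2 * (c * t + d) ^+ 2.
have WW' t : D t -> v t ^+ 2 + W' t * w t ^+ 2 = v t ^+ 2 + W t * w t ^+ 2 by move=> /WE ->.
have cW : continuous W' by move=> t; apply: cvgMr; exact: shift_sqr_continuous.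
pose K := `|C| + c ^+ 2 * (2 * c ^+ 2 + 2 * d ^+ 2).
have K1 : 0 <= c ^+ 2 * (2 * c ^+ 2 + 2 * d ^+ 2).
  by rewrite mulr_ge0 ?sqr_ge0// addr_ge0// mulr_ge0// sqr_ge0.
have ric t : D t -> branch_m' lam c d t = W' t - c ^+ 2 * lam - branch_m lam c d t ^+ 2.
  by move=> _; exact: branch_riccati.
have pt t : 0 <= 1 + t ^+ 2 :> R by rewrite addr_ge0// sqr_ge0.
have mC t : D t -> branch_m lam c d t ^+ 2 <= K * (1 + t ^+ 2).
  move=> Dt; apply: le_trans (HC _ (ct _ Dt)) _; rewrite ler_wpM2r//.
  by rewrite /K; have := ler_norm C; clear -K1; lra.
have WC t : D t -> `|W' t| <= K * (1 + t ^+ 2).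
  move=> _; rewrite ger0_norm; last by rewrite mulr_ge0 ?sqr_ge0.
  apply: (@le_trans _ _ (c ^+ 2 * (2 * c ^+ 2 + 2 * d ^+ 2) * (1 + t ^+ 2))).
    by rewrite -mulrA ler_wpM2l ?sqr_ge0//; exact: affine_sqr.
  by rewrite ler_wpM2r// lerDr.
have acm := branch_m_AC c d l1.
split.
  apply: (Rint_eq mD WW').
  exact: (jacobi_Rint_energy mD acw cW WC iN iv).
rewrite (jacobi_identity mD bE acw acm cW ric mC WC mv iN iv).
congr (_ - _ - _); apply: eq_Rintegral => t /set_mem; exact: WW'.
Qed.

Definition half_line : set R := [set t | 0 < t].

Lemma half_measurable : measurable half_line.
Proof. by rewrite /half_line -set_itvoy. Qed.

Lemma half_form_dom u v : form_dom half_line u v ->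
  exists w, [/\ AC w (v \_ half_line), {ae leb, forall x, half_line x -> u x = w x},
    measurable_fun half_line (v \_ half_line), Rint half_line (fun t => (1 + t ^+ 2) * w t ^+ 2) &
    Rint half_line (fun t => (v \_ half_line) t ^+ 2)].
Proof.
by apply: (form_dom_AC (p := 1) right_open) => //; [exact: ltr01|exact: right_convex].
Qed.

Lemma half_trial lam xi : lam < 1 ->
  form_dom half_line (branch_phi lam 1 xi) (fun t => branch_m lam 1 xi t * branch_phi lam 1 xi t) /\
  0 < norm2 half_line (branch_phi lam 1 xi).
Proof.
move=> l1; have [C HC] := @branch_m_bound _ lam 1 xi l1.
have iN : Rint half_line (fun t => (1 + t ^+ 2) * branch_phi lam 1 xi t ^+ 2).
  by apply: branch_phi_right => //; [exact: half_measurable|move=> t /ltW].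
split.
  have mC t : half_line t -> branch_m lam 1 xi t ^+ 2 <= C * (1 + t ^+ 2).
    by move=> Dt; apply: HC; rewrite mul1r ltW.
  exact: (trial_form_dom half_measurable (branch_phi_AC 1 xi l1)
    (branch_m_continuous (c := 1) (d := xi) l1) mC iN).
have h1 : exists p, half_line p by exists 1; exact: ltr01.
apply: (trial_norm2 right_open h1 _ _ iN).
- exact: AC_continuous (branch_phi_AC 1 xi l1).
- by move=> t; exact: branch_phi_gt0.
Qed.

(** The defect integral is nonnegative, so the sign of [logd lam xi] decides the comparison of the
    form with lam times the norm. The number [w 0] is the boundary value of the continuous
    representative. *)
Lemma half_energy lam xi u v : lam < 1 -> form_dom half_line u v -> exists w,
  [/\ AC w (v \_ half_line), {ae leb, forall x, half_line x -> u x = w x} &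
  qform half_line (fun t => (t + xi) ^+ 2) u v = lam * norm2 half_line u - logd lam xi * w 0 ^+ 2 +
    \int[leb]_(t in half_line) ((v \_ half_line) t - branch_m lam 1 xi t * w t) ^+ 2].
Proof.
move=> l1 d; have [w [acw uw mv iN iv]] := half_form_dom d.
exists w; split => //.
have mw : measurable_fun half_line w.
  apply: (measurable_funS measurableT) => //.
  exact: continuous_measurable_fun (AC_continuous acw).
have cW : continuous (fun t : R => (t + xi) ^+ 2).
  rewrite (_ : (fun _ => _) = fun t => (1 * t + xi) ^+ 2); first exact: shift_sqr_continuous.
  by apply/funext => t; rewrite mul1r.
rewrite (qform_AC half_measurable cW d mw uw) (norm2_AC half_measurable d mw uw).
have [||_ ->] := @half_jacobi half_line (fun f => - f 0) lam 1 xi (fun t => (t + xi) ^+ 2) w _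
  half_measurable (@boundary_right R) l1 _ _ acw mv iN iv.
- by move=> t /ltW; rewrite mul1r.
- by move=> t _; rewrite expr1n !mul1r.
rewrite /branch_m mulr0 add0r expr1n !mul1r.
by move: (\int[leb]_(t in half_line) _) (\int[leb]_(t in half_line) _) => E N; ring.
Qed.

Lemma lambdaN_ge lam xi : lam < 1 -> logd lam xi <= 0 -> lam <= lambdaN xi.
Proof.
move=> l1 m0; apply: lowest_ge.
  have [d n] := half_trial xi l1.
  by exists (branch_phi lam 1 xi), (fun t => branch_m lam 1 xi t * branch_phi lam 1 xi t);
    split => //; rewrite gt_eqF.
move=> u v d; have [w [_ _ ->]] := half_energy xi l1 d.
rewrite -addrA lerDl addr_ge0//.
  by rewrite -mulNr mulr_ge0 ?oppr_ge0// sqr_ge0.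
by apply: Rintegral_ge0 => t _; exact: sqr_ge0.
Qed.

Lemma lambdaN_le lam xi : lam < 1 -> logd lam xi = 0 -> lambdaN xi <= lam.
Proof.
move=> l1 m0; have [d n] := half_trial xi l1.
apply: (lowest_le _ d); first by move=> t; exact: sqr_ge0.
  by rewrite gt_eqF.
have [w [acw uw ->]] := half_energy xi l1 d.
rewrite m0 mul0r subr0 -[RHS]addr0; congr (_ + _).
(* The defect of the trial function is known to vanish only almost everywhere, since [w] is merely
   some representative of it. *)
rewrite (_ : \int[leb]_(t in half_line) _ = \int[leb]_(t in half_line) 0); last first.
  apply: Rintegral_ae => //; first exact: half_measurable.
  - apply: measurable_funX; apply: measurable_funB.
    + apply: (measurable_funS measurableT) => //; apply: L2on_measurable_restrict.
        exact: half_measurable.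
      exact: d.2.1.
    + apply: measurable_funM; apply: (measurable_funS measurableT) => //.
        exact: continuous_measurable_fun (branch_m_continuous (c := 1) (d := xi) l1).
      exact: continuous_measurable_fun (AC_continuous acw).
  - apply: (@filterS _ _ (ae_filter_ringOfSetsType leb) _ _ _ uw) => x H Dx.
    by rewrite -H// patchE mem_set// subrr expr0n.
by rewrite Rintegral_cst ?mul0r//; exact: half_measurable.
Qed.

End HalfLine.

(** * The problem on the line *)

Section ACae.
Context {R : realType}.
Local Notation leb := (@lebesgue_measure R).

Lemma AC_ae (f f' g' : R -> R) : AC f f' -> continuous g' -> measurable_fun setT f' ->
  {ae leb, forall x, f' x = g' x} -> AC f g'.
Proof.
move=> acf cg mf' fg a b ab; split; first exact: Rint_continuous.
have [_ ->] := acf _ _ ab; apply: Rintegral_ae => //.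
- exact: (measurable_funS measurableT).
- by apply: (measurable_funS measurableT) => //; exact: continuous_measurable_fun.
- by apply: (@filterS _ _ (ae_filter_ringOfSetsType leb) _ _ _ fg) => x H _.
Qed.

Lemma AC_eq (f f' g' : R -> R) : (forall t, f' t = g' t) -> AC f f' -> AC f g'.
Proof. by move=> e; rewrite (_ : f' = g')//; apply/funext. Qed.

Lemma AC_scale (k : R) (f f' : R -> R) : AC f f' -> AC (fun t => k * f t) (fun t => k * f' t).
Proof.
move=> acf a b ab; have [i e] := acf _ _ ab.
by split; [exact: RintZ|rewrite RintegralZl// -e mulrBr].
Qed.

Lemma ae_eq_continuous (u w : R -> R) : continuous u -> continuous w ->
  {ae leb, forall x, u x = w x} -> u = w.
Proof.
move=> cu cw uw; apply/funext => x; apply/eqP; rewrite -subr_eq0; apply/negPn/negP => n0.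
pose g t := `|u t - w t|.
have cg : continuous g.
  move=> t; have cb : {for t, continuous (fun t => u t - w t)}.
    by apply: cvgB; [exact: cu|exact: cw].
  exact: (cvg_norm cb).
have og : open [set t | 0 < g t].
  have -> : [set t | 0 < g t] = g @^-1` [set z | 0 < z] by [].
  by apply: open_comp; [move=> t _; exact: cg|exact: open_gt].
have gx : 0 < g x by rewrite normr_gt0.
have [t] := ae_exists og gx uw.
by rewrite /= /g => + e; rewrite e subrr normr0 ltxx.
Qed.

Lemma Rintegral_sqr_eq0 (f : R -> R) : measurable_fun setT f ->
  Rint setT (fun t => f t ^+ 2) -> \int[leb]_t f t ^+ 2 = 0 -> {ae leb, forall t, f t = 0}.
Proof.
move=> mf fi f0.
have mf2 : measurable_fun setT (EFin \o (fun t => f t ^+ 2)).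
  by apply/measurable_EFinP; exact: measurable_funX.
pose g : R -> R := fun t => f t ^+ 2.
have : (\int[leb]_t `|(EFin \o g) t| = 0)%E.
  rewrite -[RHS]/(0%:E) -f0 /Rintegral fineK; last exact: integrable_fin_num fi.
  by apply: eq_integral => t _ /=; rewrite ger0_norm// sqr_ge0.
move=> /(ae_eq_integral_abs leb measurableT mf2).1.
apply: (@filterS _ _ (ae_filter_ringOfSetsType leb)) => t /(_ I) /= [] /eqP.
by rewrite sqrf_eq0 => /eqP.
Qed.

End ACae.

Lemma glue_ge {R : realType} (f g : R -> R) t : 0 <= t -> glue f g t = f t.
Proof. by rewrite /glue => ->. Qed.

Lemma glue_le {R : realType} (f g : R -> R) t : f 0 = g 0 -> t <= 0 -> glue f g t = g t.
Proof. by move=> e; rewrite /glue; case: (ltgtP t 0) => // ->. Qed.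

Section Line.
Context {R : realType}.
Local Notation leb := (@lebesgue_measure R).
Variable b : R.
Hypothesis b01 : 0 < b < 1.
Implicit Types (lam xi : R) (u v w : R -> R).

Lemma unit_gt0 : 0 < b. Proof. by case/andP: b01. Qed.
Lemma unit_neq0 : b != 0. Proof. by rewrite gt_eqF// unit_gt0. Qed.
Lemma unit_opp_lt0 : - b < 0. Proof. by rewrite oppr_lt0 unit_gt0. Qed.
Lemma unit_lt1 lam : lam < b ^+ 2 -> lam < 1.
Proof. by move/lt_trans; apply; rewrite expr_lt1// ?(ltW unit_gt0)//; case/andP: b01. Qed.

Local Notation a := (- b ^+ 2).

Definition left_half_line : set R := `]-oo, 0]%classic.

Lemma Wa_right xi t : half_line t -> Wa a xi t = 1 ^+ 2 * (1 * t + xi) ^+ 2.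
Proof. by rewrite /half_line /= => t0; rewrite /Wa /sigma t0 expr1n !mul1r addrC. Qed.

Lemma Wa_left xi t : left_half_line t -> Wa a xi t = (- b) ^+ 2 * (- b * t + xi / b) ^+ 2.
Proof.
rewrite /left_half_line /= in_itv/= => t0; rewrite /Wa /sigma ltNge t0 /=.
by field; exact: unit_neq0.
Qed.

Lemma Wa_glue xi : Wa a xi = glue (fun t => (1 * t + xi) ^+ 2) (fun t => (- b ^+ 2 * t + xi) ^+ 2).
Proof.
apply/funext => t; rewrite /glue /Wa /sigma le_eqVlt.
by have [<-|_] := eqVneq 0 t; case: ltP => _ /=; rewrite ?mulr0 ?add0r ?addr0 ?mul1r ?(addrC xi).
Qed.

Lemma Wa_continuous xi : continuous (Wa a xi).
Proof.
rewrite Wa_glue; apply: glue_continuous; try exact: shift_sqr_continuous.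
by rewrite !mulr0.
Qed.

Lemma patch_setT (f : R -> R) : f \_ setT = f.
Proof. by apply/funext => x; rewrite patchE in_setT. Qed.

Lemma line_form_dom u v : form_dom setT u v ->
  exists w, [/\ AC w v, {ae leb, forall x, setT x -> u x = w x},
    measurable_fun setT v, Rint setT (fun t => (1 + t ^+ 2) * w t ^+ 2) &
    Rint setT (fun t => v t ^+ 2)].
Proof.
move=> d; have := form_dom_AC (p := 0) openT I _ d.
by rewrite patch_setT; apply.
Qed.

(** Sum of the two half-line identities with the squares dropped. Their boundary terms at 0 combine
    into [match_fun b lam xi * w 0 ^+ 2], whether or not xi is matched to lam. *)
Lemma line_energy lam xi u v : lam < b ^+ 2 -> form_dom setT u v -> exists w,
  lam * norm2 setT u - match_fun b lam xi * w 0 ^+ 2 <= qform setT (Wa a xi) u v.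
Proof.
move=> lb d; have [w [acw uw mv iN iv]] := line_form_dom d.
exists (w : R -> R).
have l1 := unit_lt1 lb.
have l1' := div_sqr_lt1 b01 lb.
have mw : measurable_fun setT w by exact: continuous_measurable_fun (AC_continuous acw).
rewrite (qform_AC measurableT (@Wa_continuous xi) d mw uw) (norm2_AC measurableT d mw uw) patch_setT.
have mR := @half_measurable R.
have mL : measurable left_half_line by exact: measurable_itv.
have sT (D : set R) : D `<=` setT by [].
have [|iR eR] := @half_jacobi _ half_line (fun f => - f 0) lam 1 xi (Wa a xi) w v
  mR (@boundary_right R) l1 _ (@Wa_right xi) acw (measurable_funS measurableT (sT _) mv)
  (RintS measurableT mR (sT _) iN) (RintS measurableT mR (sT _) iv).
  by move=> t /ltW; rewrite mul1r.
have [|iL eL] := @half_jacobi _ left_half_line (fun f => f 0) (lam / b ^+ 2) (- b) (xi / b) (Wa a xi) w v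
  mL (@boundary_left R) l1' _ (@Wa_left xi) acw (measurable_funS measurableT (sT _) mv)
  (RintS measurableT mL (sT _) iN) (RintS measurableT mL (sT _) iv).
  move=> t; rewrite /left_half_line /= in_itv/= => t0; exact: mulr_le0 (ltW unit_opp_lt0) t0.
have i2 : Rint setT (fun t => w t ^+ 2).
  apply: (Rint_le measurableT _ iN); first exact: measurable_funX.
  by move=> t _; rewrite ger0_norm ?sqr_ge0// ler_peMl ?sqr_ge0// lerDl sqr_ge0.
have iE : Rint setT (fun t => v t ^+ 2 + Wa a xi t * w t ^+ 2).
  rewrite setT_halves; apply: Rint_setU => //.
  by rewrite set_itvoy.
rewrite (Rintegral_halves iE) (Rintegral_halves i2) set_itvoy.
have pR : 0 <= \int[leb]_(t in half_line) (v t - branch_m lam 1 xi t * w t) ^+ 2.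
  by apply: Rintegral_ge0 => t _; exact: sqr_ge0.
have pL : 0 <= \int[leb]_(t in left_half_line) (v t - branch_m (lam / b ^+ 2) (- b) (xi / b) t * w t) ^+ 2.
  by apply: Rintegral_ge0 => t _; exact: sqr_ge0.
move: pR pL; rewrite eR eL /branch_m !mulr0 !add0r /match_fun.
rewrite (_ : (- b) ^+ 2 * (lam / b ^+ 2) = lam); last by field; exact: unit_neq0.
rewrite -/half_line -/left_half_line expr1n !mul1r.
move: (\int[leb]_(t in half_line) _) (\int[leb]_(t in half_line) _) => N E.
move: (\int[leb]_(t in left_half_line) _) (\int[leb]_(t in left_half_line) _) => N' E'.
move: (logd _ _) (logd _ _) (w 0) => m' m z h1 h2.
rewrite -subr_ge0.
have -> : E' + E - (lam * (N' + N) - (m + b * m') * z ^+ 2) =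
  (E - lam * N - - (z * z * m)) + (E' - lam * N' - z * z * (- b * m')) by ring.
exact: addr_ge0.
Qed.

Lemma mu_ge lam xi : (exists u v, form_dom (@setT R) u v /\ norm2 setT u != 0) ->
  lam < b ^+ 2 -> match_fun b lam xi <= 0 -> lam <= mu_a a xi.
Proof.
move=> ne lb m0; apply: lowest_ge => // u v d.
have [w] := line_energy xi lb d; apply: le_trans.
by rewrite lerDl -mulNr mulr_ge0 ?oppr_ge0// sqr_ge0.
Qed.

Section Matched.
Variables (lam xi : R).
Hypothesis lamb : lam < b ^+ 2.
Hypothesis matched : match_fun b lam xi = 0.

Let l1 : lam < 1 := unit_lt1 lamb.
Let l1' : lam / b ^+ 2 < 1 := div_sqr_lt1 b01 lamb.

Definition ground_mR := branch_m lam 1 xi.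
Definition ground_mL := branch_m (lam / b ^+ 2) (- b) (xi / b).
Definition ground_mR' := branch_m' lam 1 xi.
Definition ground_mL' := branch_m' (lam / b ^+ 2) (- b) (xi / b).

Lemma ground_m_match : ground_mR 0 = ground_mL 0.
Proof.
clear l1 l1'; rewrite /ground_mR /ground_mL /branch_m !mulr0 !add0r mul1r mulNr.
by move: matched => /eqP; rewrite /match_fun addr_eq0 => /eqP.
Qed.

(** Both Riccati equations have the potential xi^2 and the energy lam at 0, so equal values of m
    force equal slopes. *)
Lemma ground_m'_match : ground_mR' 0 = ground_mL' 0.
Proof.
rewrite /ground_mR' /ground_mL' !branch_riccati -/ground_mR -/ground_mL ground_m_match !mulr0 !add0r.
by field; exact: unit_neq0.
Qed.

(** Each branch is scaled to the value 1 at 0, which makes the glued function continuous; its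
    derivative is then continuous by [ground_m_match]. *)
Definition ground_phiR t := (psi lam xi)^-1 * branch_phi lam 1 xi t.
Definition ground_phiL t :=
  (psi (lam / b ^+ 2) (xi / b))^-1 * branch_phi (lam / b ^+ 2) (- b) (xi / b) t.

Lemma ground_phi_match : ground_phiR 0 = ground_phiL 0.
Proof.
have nR : psi lam xi != 0 by rewrite gt_eqF//; exact: psi_gt0 l1.
have nL : psi (lam / b ^+ 2) (xi / b) != 0 by rewrite gt_eqF//; exact: psi_gt0 l1'.
by rewrite /ground_phiR /ground_phiL /branch_phi !mulr0 !add0r (mulVf nR) (mulVf nL).
Qed.

Definition ground_m := glue ground_mR ground_mL.
Definition ground_m' := glue ground_mR' ground_mL'.
Definition ground_phi := glue ground_phiR ground_phiL.

Lemma ground_m0 : ground_m 0 = logd lam xi.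
Proof. by rewrite /ground_m /glue lexx /ground_mR /branch_m mulr0 add0r mul1r. Qed.

Lemma ground_m_AC : AC ground_m ground_m'.
Proof.
exact: (AC_glue (branch_m_AC 1 xi l1) (branch_m_AC (- b) (xi / b) l1') ground_m_match
  (branch_m'_continuous (c := 1) (d := xi) l1)
  (branch_m'_continuous (c := - b) (d := xi / b) l1') ground_m'_match).
Qed.

Lemma ground_m_continuous : continuous ground_m.
Proof. exact: AC_continuous ground_m_AC. Qed.

Lemma ground_phi_AC : AC ground_phi (fun t => ground_m t * ground_phi t).
Proof.
have acR := AC_scale (psi lam xi)^-1 (branch_phi_AC 1 xi l1).
have acL := AC_scale (psi (lam / b ^+ 2) (xi / b))^-1 (branch_phi_AC (- b) (xi / b) l1').
have cR : continuous (fun t => (psi lam xi)^-1 * (branch_m lam 1 xi t * branch_phi lam 1 xi t)).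
  move=> t; apply: cvgMr; apply: cvgM; first exact: (branch_m_continuous (c := 1) (d := xi) l1).
  exact: (AC_continuous (branch_phi_AC 1 xi l1)).
have cL : continuous (fun t => (psi (lam / b ^+ 2) (xi / b))^-1 *
    (branch_m (lam / b ^+ 2) (- b) (xi / b) t * branch_phi (lam / b ^+ 2) (- b) (xi / b) t)).
  move=> t; apply: cvgMr; apply: cvgM; first exact: (branch_m_continuous (c := - b) (d := xi / b) l1').
  exact: (AC_continuous (branch_phi_AC (- b) (xi / b) l1')).
have e0 : (psi lam xi)^-1 * (branch_m lam 1 xi 0 * branch_phi lam 1 xi 0) =
  (psi (lam / b ^+ 2) (xi / b))^-1 *
    (branch_m (lam / b ^+ 2) (- b) (xi / b) 0 * branch_phi (lam / b ^+ 2) (- b) (xi / b) 0).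
  by rewrite !(mulrCA _ (branch_m _ _ _ _)) -/ground_mR -/ground_mL ground_m_match; congr (_ * _); exact: ground_phi_match.
apply: AC_eq (AC_glue acR acL ground_phi_match cR cL e0) => t.
by rewrite /ground_m /ground_phi /glue; case: (0 <= t); rewrite [RHS]mulrCA.
Qed.

Lemma ground_phi_gt0 t : 0 < ground_phi t.
Proof.
have pR := psi_gt0 xi l1; have pL := psi_gt0 (xi / b) l1'.
have pR' : 0 < (psi lam xi)^-1 by rewrite invr_gt0; exact: pR.
have pL' : 0 < (psi (lam / b ^+ 2) (xi / b))^-1 by rewrite invr_gt0; exact: pL.
rewrite /ground_phi; case: (leP 0 t) => t0.
  rewrite (glue_ge _ _ t0); exact: mulr_gt0 pR' (branch_phi_gt0 _ _ l1 t).
rewrite (glue_le ground_phi_match (ltW t0)); exact: mulr_gt0 pL' (branch_phi_gt0 _ _ l1' t).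
Qed.

Lemma ground_riccati t : setT t -> ground_m' t = Wa a xi t - lam - ground_m t ^+ 2.
Proof.
move=> _; rewrite /ground_m' /ground_m /glue; case: leP => t0.
  rewrite /ground_mR' branch_riccati -/ground_mR expr1n !mul1r; congr (_ - _ - _).
  by rewrite Wa_glue /glue t0 mul1r.
rewrite /ground_mL' branch_riccati -/ground_mL (_ : (- b) ^+ 2 * (lam / b ^+ 2) = lam); last by field; exact: unit_neq0.
by rewrite -Wa_left//; exact: ltW t0.
Qed.

Lemma ground_bounds : exists C : R, (forall t, setT t -> ground_m t ^+ 2 <= C * (1 + t ^+ 2)) /\
  (forall t, setT t -> `|Wa a xi t| <= C * (1 + t ^+ 2)).
Proof.
have [C1 H1] := @branch_m_bound _ lam 1 xi l1.
have [C2 H2] := @branch_m_bound _ (lam / b ^+ 2) (- b) (xi / b) l1'.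
pose K1 := 2 * 1 ^+ 2 + 2 * xi ^+ 2; pose K2 := 2 * (- b ^+ 2) ^+ 2 + 2 * xi ^+ 2.
have pt t : 0 <= 1 + t ^+ 2 :> R by exact: addr_ge0 ler01 (sqr_ge0 _).
have K10 : 0 <= K1 by exact: addr_ge0 (mulr_ge0 (ler0n _ _) (sqr_ge0 _)) (mulr_ge0 (ler0n _ _) (sqr_ge0 _)).
have K20 : 0 <= K2 by exact: addr_ge0 (mulr_ge0 (ler0n _ _) (sqr_ge0 _)) (mulr_ge0 (ler0n _ _) (sqr_ge0 _)).
have n1 := normr_ge0 C1; have n2 := normr_ge0 C2; have m1 := ler_norm C1; have m2 := ler_norm C2.
have [C [c1 c2 c3 c4]] : exists C, [/\ C1 <= C, C2 <= C, K1 <= C & K2 <= C].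
  exists (`|C1| + `|C2| + K1 + K2).
  by clearbody K1 K2; clear -n1 n2 m1 m2 K10 K20; split; lra.
have up (x y z t : R) : x <= y * (1 + t ^+ 2) -> y <= z -> x <= z * (1 + t ^+ 2).
  by move=> h yz; apply: le_trans h (ler_wpM2r (pt t) yz).
exists C; split => t _.
  rewrite /ground_m /glue; case: (leP 0 t) => t0.
    have t0' : 0 <= 1 * t by rewrite mul1r t0.
    exact: up (H1 _ t0') c1.
  have t0' : 0 <= - b * t := mulr_le0 (ltW unit_opp_lt0) (ltW t0).
  exact: up (H2 _ t0') c2.
rewrite Wa_glue /glue; case: (leP 0 t) => _; rewrite (ger0_norm (sqr_ge0 _)).
  exact: up (affine_sqr 1 xi t) c3.
exact: up (affine_sqr (- b ^+ 2) xi t) c4.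
Qed.

Lemma ground_phi_Rint : Rint setT (fun t => (1 + t ^+ 2) * ground_phi t ^+ 2).
Proof.
have mL : measurable left_half_line by exact: measurable_itv.
have mR : measurable (`]0, +oo[%classic : set R) by exact: measurable_itv.
have L0 t : left_half_line t -> t <= 0 by rewrite /left_half_line /= in_itv.
have R0 t : (`]0, +oo[%classic : set R) t -> 0 <= t by rewrite /= in_itv/= andbT => /ltW.
have scale (k p q : R) : k ^+ 2 * (p * q ^+ 2) = p * (k * q) ^+ 2 by ring.
rewrite setT_halves; apply: (Rint_setU mL mR).
  have iL := branch_phi_left (xi / b) mL L0 l1' unit_opp_lt0.
  apply: (Rint_eq mL _ (RintZ ((psi (lam / b ^+ 2) (xi / b))^-1 ^+ 2) mL iL)) => t /L0 t0.
  rewrite /ground_phi (glue_le ground_phi_match t0); exact: scale.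
have iR := branch_phi_right xi mR R0 l1 ltr01.
apply: (Rint_eq mR _ (RintZ ((psi lam xi)^-1 ^+ 2) mR iR)) => t /R0 t0.
rewrite /ground_phi (glue_ge _ _ t0); exact: scale.
Qed.

Lemma line_boundary (f f' : R -> R) : AC f f' -> Rint setT f -> Rint setT f' ->
  \int[leb]_(x in setT) f' x = 0.
Proof. exact: AC_integral_line. Qed.

Lemma ground_form_dom k : form_dom setT (fun t => k * ground_phi t)
  (fun t => ground_m t * (k * ground_phi t)).
Proof.
have [C [mC _]] := ground_bounds.
have ac : AC (fun t => k * ground_phi t) (fun t => ground_m t * (k * ground_phi t)).
  by apply: AC_eq (AC_scale k ground_phi_AC) => t; rewrite mulrCA.
apply: (trial_form_dom measurableT ac ground_m_continuous mC).
apply: (Rint_eq _ _ (RintZ (k ^+ 2) _ ground_phi_Rint)) => // t _.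
by rewrite exprMn; ring.
Qed.

Lemma ground_norm_gt0 : 0 < norm2 setT ground_phi.
Proof.
apply: (trial_norm2 openT _ (AC_continuous ground_phi_AC) ground_phi_gt0 ground_phi_Rint).
by exists 0.
Qed.

Lemma line_identity w v : AC w v -> measurable_fun setT v ->
  Rint setT (fun t => (1 + t ^+ 2) * w t ^+ 2) -> Rint setT (fun t => v t ^+ 2) ->
  Rint setT (fun t => (v t - ground_m t * w t) ^+ 2) /\
  \int[leb]_t (v t - ground_m t * w t) ^+ 2 =
  \int[leb]_t (v t ^+ 2 + Wa a xi t * w t ^+ 2) - lam * \int[leb]_t w t ^+ 2.
Proof.
move=> acw mv iN iv; have [C [mC WC]] := ground_bounds.
split; first exact: (jacobi_Rint_defect measurableT acw ground_m_AC mC mv iN iv).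
rewrite (jacobi_identity measurableT line_boundary acw ground_m_AC (@Wa_continuous xi)
  ground_riccati mC WC mv iN iv).
by rewrite subr0.
Qed.

Lemma ground_form_dom1 : form_dom setT ground_phi (fun t => ground_m t * ground_phi t).
Proof.
have := ground_form_dom 1.
by under eq_fun do rewrite mul1r; under [X in form_dom _ _ X]eq_fun do rewrite mul1r.
Qed.

Lemma form_dom_nonempty : exists u v, form_dom (@setT R) u v /\ norm2 setT u != 0.
Proof.
exists ground_phi, (fun t => ground_m t * ground_phi t); split; first exact: ground_form_dom1.
by rewrite gt_eqF// ground_norm_gt0.
Qed.

End Matched.
End Line.

(** * Existence and logarithmic derivative of the ground state *)

Section GroundState.
Context {R : realType}.
Local Notation leb := (@lebesgue_measure R).
Variables b lam xi : R.
Hypothesis b01 : 0 < b < 1.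
Hypothesis lamb : lam < b ^+ 2.
Hypothesis matched : match_fun b lam xi = 0.

Local Notation a := (- b ^+ 2).
Local Notation gm := (ground_m b lam xi).
Local Notation gphi := (ground_phi b lam xi).

Let cm : continuous gm := ground_m_continuous b01 lamb matched.
Let acm : AC gm (ground_m' b lam xi).
Proof. exact: ground_m_AC. Qed.
Let acp : AC gphi (fun t => gm t * gphi t).
Proof. exact: ground_phi_AC. Qed.
Let ip : Rint setT (fun t => (1 + t ^+ 2) * gphi t ^+ 2).
Proof. exact: ground_phi_Rint. Qed.

(** By [line_identity] the form minus lam times the norm is the integral of (v - m w)^2; equality
    makes this square vanish almost everywhere. *)
Lemma form_dom_defect u v : form_dom setT u v -> qform setT (Wa a xi) u v = lam * norm2 setT u ->
  exists w, [/\ AC w v, {ae leb, forall x, u x = w x}, measurable_fun setT v &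
    {ae leb, forall t, v t - gm t * w t = 0}].
Proof.
move=> d e; have [w [acw uw mv iN iv]] := line_form_dom d.
have cw := AC_continuous acw.
have mw : measurable_fun setT w by exact: continuous_measurable_fun.
have uw' : {ae leb, forall x, u x = w x}.
  by apply: (@filterS _ _ (ae_filter_ringOfSetsType leb) _ _ _ uw) => x; apply.
have [iD eD] := line_identity b01 lamb matched acw mv iN iv.
exists w; split => //; apply: Rintegral_sqr_eq0 iD _.
  apply: measurable_funB => //; apply: measurable_funM => //.
  exact: continuous_measurable_fun cm.
rewrite eD; move: e.
rewrite (qform_AC measurableT (@Wa_continuous R b xi) d mw uw) (norm2_AC measurableT d mw uw) patch_setT => ->.
by rewrite subrr.
Qed.

Lemma ground_energy : qform setT (Wa a xi) gphi (fun t => gm t * gphi t) = lam * norm2 setT gphi.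
Proof.
have [_ [[mv iv] _]] := (ground_form_dom1 b01 lamb matched).
have [_ e] := line_identity b01 lamb matched acp mv
  ip iv.
apply/eqP; rewrite -subr_eq0; apply/eqP; rewrite -[LHS]e.
have -> : (fun t => (gm t * gphi t - gm t * gphi t) ^+ 2) = fun=> 0.
  by apply/funext => t; rewrite subrr expr0n.
by rewrite /Rintegral integral0.
Qed.

Lemma mu_eq : mu_a a xi = lam.
Proof.
apply/eqP; rewrite eq_le; apply/andP; split; last first.
  apply: (mu_ge b01 (form_dom_nonempty b01 lamb matched) lamb).
  by rewrite matched.
apply: (lowest_le _ (ground_form_dom1 b01 lamb matched) _ ground_energy).
  by move=> t; exact: sqr_ge0.
by rewrite gt_eqF//; exact: ground_norm_gt0.
Qed.

Lemma ground_state_exists : exists u, ground_state a xi u.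
Proof.
have N0 := ground_norm_gt0 b01 lamb matched.
pose k := (Num.sqrt (norm2 setT gphi))^-1.
have k0 : 0 < k by rewrite invr_gt0 sqrtr_gt0.
have d := ground_form_dom b01 lamb matched k.
pose u t := k * gphi t.
have acu : AC u (fun t => gm t * u t).
  by apply: AC_eq (AC_scale k acp) => t; rewrite mulrCA.
have cu := AC_continuous acu.
have iu : Rint setT (fun t => (1 + t ^+ 2) * u t ^+ 2).
  apply: (Rint_eq measurableT _ (RintZ (k ^+ 2) measurableT ip)) => t _.
  by rewrite /u exprMn mulrCA.
have [C [mC WC]] := ground_bounds b01 xi lamb.
exists u; split; first exact: cu.
split; first by move=> t; apply: mulr_gt0 k0 _; exact: ground_phi_gt0.
split.
  have -> : norm2 setT u = k ^+ 2 * norm2 setT gphi.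
    rewrite /norm2 -[X in _ = _ * X]/(\int[leb]_t gphi t ^+ 2) -RintegralZl//; last first.
      by have [[_ i] _] := (ground_form_dom1 b01 lamb matched).
    by apply: congr1; apply: eq_integral => t _; rewrite /u exprMn.
  by rewrite /k exprVn sqr_sqrtr ?(ltW N0)// mulVf// gt_eqF.
rewrite mu_eq; exists (fun t => gm t * u t); split; first exact: d.
move=> w w' dw; have [w1 [acw ww1 mw' iN iw']] := line_form_dom dw.
have mw1 : measurable_fun setT w1 by exact: continuous_measurable_fun (AC_continuous acw).
have mw : measurable_fun setT w by case: dw => -[].
have mu : measurable_fun setT u by exact: continuous_measurable_fun.
have mm : measurable_fun setT gm by exact: continuous_measurable_fun.
have mW : measurable_fun setT (Wa a xi) by exact: continuous_measurable_fun (@Wa_continuous R b xi).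
have mmu := measurable_funM mm mu; have mWu := measurable_funM mW mu.
have bd0 (f f' : R -> R) : AC f f' -> Rint setT f -> Rint setT f' -> \int[leb]_(x in setT) f' x = (fun=> 0) f.
  exact: line_boundary.
(* The polarised identity, without boundary term on the line, is the weak eigenvalue equation for
   the representative [w1]; it is then carried back to [w]. *)
have J := jacobi_polar measurableT bd0 acw acm (@Wa_continuous R b xi)
  (ground_riccati b01 lam xi) mC WC mw' iN iw' acu iu.
rewrite -[LHS]/(\int[leb]_t (gm t * u t * w' t + Wa a xi t * u t * w t)).
rewrite -[X in _ = _ * X]/(\int[leb]_t (u t * w t)).
transitivity (\int[leb]_t (gm t * u t * w' t + Wa a xi t * u t * w1 t)).
  apply: Rintegral_ae => //.
  - exact: measurable_funD (measurable_funM mmu mw') (measurable_funM mWu mw).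
  - exact: measurable_funD (measurable_funM mmu mw') (measurable_funM mWu mw1).
  - by apply: (@filterS _ _ (ae_filter_ringOfSetsType leb) _ _ _ ww1) => x e xT; rewrite e.
rewrite J addr0; congr (_ * _); apply: Rintegral_ae => //.
- exact: measurable_funM.
- exact: measurable_funM.
- by apply: (@filterS _ _ (ae_filter_ringOfSetsType leb) _ _ _ ww1) => x e xT; rewrite e.
Qed.

(** Testing the weak equation with [u] itself gives equality of energies, so [form_dom_defect]
    applies and u' = m u almost everywhere. As m and u are continuous, u is differentiable
    everywhere. This treats every ground state at once, not just the glued one. *)
Lemma ground_state_derive u : ground_state a xi u -> is_derive (0 : R) 1 u (logd lam xi * u 0).
Proof.
move=> [cu [_ [_ [v [d H]]]]].
have e : qform setT (Wa a xi) u v = lam * norm2 setT u.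
  rewrite -mu_eq; transitivity (fine (\int[leb]_x (v x * v x + Wa a xi x * u x * u x)%:E)).
    by congr fine; apply: eq_integral => t _; rewrite !expr2 mulrA.
  exact: H d.
have [w [acw uw mv vw]] := form_dom_defect d e.
have uwE := ae_eq_continuous cu (AC_continuous acw) uw; rewrite -uwE in acw vw.
have cmu : continuous (fun t => gm t * u t) by move=> t; apply: cvgM; [exact: cm|exact: cu].
have acu : AC u (fun t => gm t * u t).
  apply: (AC_ae acw cmu mv).
  apply: (@filterS _ _ (ae_filter_ringOfSetsType leb) _ _ _ vw) => t /eqP.
  by rewrite subr_eq0 => /eqP.
by have := AC_dv 0 acu cmu; rewrite ground_m0.
Qed.

End GroundState.

(** * Dependence on the parameter *)

Section ImplicitFunction.
Context {R : realType}.

Variables (F F' : R -> R -> R) (L l0 x0 : R) (g : R -> R).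
Hypothesis l0L : l0 < L.
Hypothesis dF : forall l x : R, l < L -> is_derive l 1 (F^~ x) (F' l x).
Hypothesis cF' : {for (l0, x0), continuous (fun z : R * R => F' z.1 z.2)}.
Hypothesis cg : {for x0, continuous g}.
Hypothesis g0 : g x0 = l0.

(** [E] is the difference quotient of F in its first variable between l0 and g x, completed by the
    partial derivative where g x = l0. The mean value theorem and joint continuity of F' make it
    continuous at x0. *)
Lemma partial_quotient : exists E : R -> R, [/\ {for x0, continuous E}, E x0 = F' l0 x0 &
  forall x, F (g x) x - F l0 x = E x * (g x - l0)].
Proof.
pose E x := if g x == l0 then F' l0 x else (F (g x) x - F l0 x) / (g x - l0).
have E0 : E x0 = F' l0 x0 by rewrite /E g0 eqxx.
exists E; split => //; last first.
  move=> x; rewrite /E; case: eqP => [->|/eqP gl]; first by rewrite !subrr mulr0.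
  by rewrite divfK// subr_eq0.
apply/cvgrPdist_lt => e e0; rewrite E0.
have /cvgrPdist_lt/(_ _ e0) [[U V] /= [Ul Vx] UV] := cF'.
have [d /= d0 dU] := Ul.
pose r := Num.min d (L - l0).
have r0 : 0 < r by rewrite lt_min d0 subr_gt0.
have gr : \forall x \near x0, `|g x0 - g x| < r by move/cvgrPdist_lt: cg; apply.
near=> x.
have Vxx : V x by near: x.
have gxr : `|g x - l0| < r by rewrite -g0 distrC; near: x.
have hit c : `|c - l0| <= `|g x - l0| -> `|F' l0 x0 - F' c x| < e.
  move=> c1; apply: (UV (c, x)); split => //=; apply: dU; rewrite /= distrC.
  by apply: le_lt_trans c1 (lt_le_trans gxr _); rewrite ge_min lexx.
have gL : g x < L.
  rewrite -(ltrD2r (- l0)); apply: le_lt_trans (ler_norm _) (lt_le_trans gxr _).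
  by rewrite ge_min lexx orbT.
rewrite /E; case: eqP => [gE|/eqP gl]; first by apply: hit; rewrite subrr normr0.
have n0 : g x - l0 != 0 by rewrite subr_eq0.
have [gl'|gl'|e1] := ltgtP (g x) l0; last by rewrite e1 eqxx in gl.
  have [c /andP[c1 c2] eF] := @mean_value _ (F^~ x) (F'^~ x) _ _ gl'
    (fun t tl => dF x (le_lt_trans (andP tl).2 l0L)).
  have -> : (F (g x) x - F l0 x) / (g x - l0) = F' c x.
    by apply: (canLR (mulfK n0)); rewrite -opprB eF -mulrN opprB.
  apply: hit.
  by rewrite !ltr0_norm ?subr_lt0// lerN2 lerD2r ltW.
have [c /andP[c1 c2] eF] := @mean_value _ (F^~ x) (F'^~ x) _ _ gl'
  (fun t tl => dF x (le_lt_trans (andP tl).2 gL)).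
rewrite eF mulfK//; apply: hit.
by rewrite !gtr0_norm ?subr_gt0// lerD2r ltW.
Unshelve. all: by end_near. Qed.

Lemma dv_along (f' g' : R) : is_derive x0 1 (F l0) f' -> is_derive x0 1 g g' ->
  is_derive x0 1 (fun x => F (g x) x) (F' l0 x0 * g' + f').
Proof.
move=> /is_derive1_caratheodory[A [eA cA A0]] /is_derive1_caratheodory[B [eB cB B0]].
have [E [cE E0 eE]] := partial_quotient.
apply/is_derive1_caratheodory; exists (fun x => E x * B x + A x); split.
- move=> x; rewrite g0 mulrDl -mulrA -eB -eA g0 -eE.
  by rewrite addrA subrK.
- by apply: cvgD cA; exact: cvgM cE cB.
- by rewrite E0 A0 B0.
Qed.

(** Assumes only continuity of g. With F l0 x = A x (x - x0) in Caratheodory form, the equation F (g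
    x) x = 0 becomes g x - l0 = - (A x / E x) (x - x0), again a Caratheodory form. *)
Lemma dv_implicit (f' : R) : 0 < F' l0 x0 -> is_derive x0 1 (F l0) f' ->
  (\forall x \near x0, F (g x) x = 0) -> is_derive x0 1 g (- f' / F' l0 x0).
Proof.
move=> F'0 /is_derive1_caratheodory[A [eA cA A0]] F0.
have [E [cE E0 eE]] := partial_quotient.
have F00 : F l0 x0 = 0 by rewrite -g0; exact: (nbhs_singleton F0).
have En0 : E x0 != 0 by rewrite E0 gt_eqF.
have En : \forall x \near x0, E x != 0 by exact: (@cvgr_neq0 _ _ _ _ _ E (E x0) cE En0).
apply: (@near_eq_is_derive _ _ _ (fun x => l0 + - A x / E x * (x - x0))).
  near=> x; have Ex : E x != 0 by near: x.
  have Fx : F (g x) x = 0 by near: x.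
  have := eE x; rewrite Fx sub0r -[F l0 x]subr0 -F00 eA => h.
  have -> : - A x / E x * (x - x0) = g x - l0.
    by rewrite mulrAC; apply: (canLR (mulfK Ex)); rewrite mulNr h mulrC.
  by rewrite addrC subrK.
apply/is_derive1_caratheodory; exists (fun x => - A x / E x); split.
- by move=> x; rewrite subrr mulr0 addr0 addrAC subrr add0r.
- by apply: cvgM; [exact: cvgN cA|exact: cvgV En0 cE].
- by rewrite E0 A0.
Unshelve. all: by end_near. Qed.

End ImplicitFunction.

(** Where f vanishes, the product is differentiable for a merely continuous k. This lets mu' be
    differentiated although only continuity of [match_lam] along mu has been established. *)
Lemma dv_vanishing {R : realType} (f k : R -> R) (x f' : R) : f x = 0 -> {for x, continuous k} ->
  is_derive x 1 f f' -> is_derive x 1 (fun t => f t * k t) (f' * k x).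
Proof.
move=> fx ck /is_derive1_caratheodory[A [eA cA A0]].
apply/is_derive1_caratheodory; exists (fun t => A t * k t); split.
- by move=> t; rewrite fx mul0r subr0 mulrAC -eA fx subr0.
- exact: cvgM cA ck.
- by rewrite A0.
Qed.

(** * Derivatives of the eigenvalue in the parameter *)

Section BottomOfSpectrum.
Context {R : realType}.
Variable b : R.
Hypothesis b01 : 0 < b < 1.
Implicit Types (lam xi : R).

Local Notation a := (- b ^+ 2).

Lemma match_lam_continuous2 lam xi : lam < b ^+ 2 ->
  {for (lam, xi), continuous (fun z : R * R => match_lam b z.1 z.2)}.
Proof.
move=> lb.
have c1 : {for (lam, xi), continuous (fun z : R * R => logd_lam z.1 z.2)}.
  exact: logd_lam_continuous2 (unit_lt1 b01 lb).
have c2 : {for (lam, xi), continuous (fun z : R * R => logd_lam (z.1 / b ^+ 2) (z.2 / b))}.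
  apply: (@continuous_comp _ _ _ (fun z : R * R => (z.1 / b ^+ 2, z.2 / b)) (fun z => logd_lam z.1 z.2)).
    have d1 : z.1 / b ^+ 2 @[z --> (lam, xi)] --> lam / b ^+ 2 by apply: cvgMl; exact: cvg_fst.
    have d2 : z.2 / b @[z --> (lam, xi)] --> xi / b by apply: cvgMl; exact: cvg_snd.
    exact: cvg_pair d1 d2.
  exact: logd_lam_continuous2 (div_sqr_lt1 b01 lb).
exact: (cvgD c1 (cvgMl c2)).
Qed.

(** By monotonicity [match_fun] is negative at lam - d and positive at lam + d. These signs persist
    for x near xi, the intermediate value theorem gives a zero l in between, and [mu_eq] identifies
    l with the eigenvalue at x. *)
Lemma mu_near lam xi e : lam < b ^+ 2 -> match_fun b lam xi = 0 -> 0 < e ->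
  \forall x \near xi, [/\ `|mu_a a x - lam| < e, mu_a a x < b ^+ 2 & match_fun b (mu_a a x) x = 0].
Proof.
move=> lb m0 e0; pose d := Num.min (e / 2) ((b ^+ 2 - lam) / 2).
have d0 : 0 < d by rewrite lt_min !divr_gt0// subr_gt0.
have de : d < e.
  by apply: (@le_lt_trans _ _ (e / 2)); [rewrite ge_min lexx|rewrite ltr_pdivrMr// mulr_natr mulr2n ltrDl].
have db : lam + d < b ^+ 2.
  have : d <= (b ^+ 2 - lam) / 2 by rewrite ge_min lexx orbT.
  by move: lb; move: (b ^+ 2) => B; clear; lra.
have lo : match_fun b (lam - d) xi < 0.
  by rewrite -m0; apply: match_incr => //; rewrite gtrBl.
have hi : 0 < match_fun b (lam + d) xi.
  by rewrite -[X in X < _]m0; apply: match_incr => //; rewrite ltrDl.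
have lb' : lam - d < b ^+ 2 by apply: lt_trans lb; rewrite gtrBl.
have clo := dv_continuous (match_dvx b01 xi lb').
have chi := dv_continuous (match_dvx b01 xi db).
near=> x.
have lox : match_fun b (lam - d) x < 0 by near: x; exact: (cvgr_lt _ clo).
have hix : 0 < match_fun b (lam + d) x by near: x; exact: (cvgr_gt _ chi).
have [l + ml] : exists2 l, l \in `[lam - d, lam + d] & match_fun b l x = 0.
  apply: (@IVT _ (match_fun b ^~ x)).
  - by rewrite lerD2l ge0_cp ?ltW.
  - apply: derivable_within_continuous => t; rewrite in_itv/= => /andP[_ td].
    by case: (match_dvlam b01 x (le_lt_trans td db)).
  - by apply/andP; split; [rewrite ge_min; apply/orP; left|rewrite le_max; apply/orP; right]; exact: ltW.
rewrite in_itv/= => /andP[l1 l2].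
have lB : l < b ^+ 2 by exact: le_lt_trans l2 db.
rewrite (mu_eq b01 lB ml); split => //; apply: le_lt_trans de.
by rewrite ler_norml lerBlDl l2 andbT lerBrDl.
Unshelve. all: by end_near. Qed.

Lemma mu_continuous lam xi : lam < b ^+ 2 -> match_fun b lam xi = 0 -> {for xi, continuous (mu_a a)}.
Proof.
move=> lb m0; apply/cvgrPdist_lt => e e0; rewrite (mu_eq b01 lb m0).
by near do rewrite distrC; near=> x; near: x; apply: filterS (mu_near lb m0 e0) => x [].
Unshelve. all: by end_near. Qed.

Lemma slope_matched lam xi : match_fun b lam xi = 0 ->
  slope lam xi + slope (lam / b ^+ 2) (xi / b) = (1 + b ^- 2) * slope lam xi.
Proof.
move=> m0; have n0 := unit_neq0 b01.
have m2 : logd (lam / b ^+ 2) (xi / b) = - logd lam xi / b.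
  move: m0; rewrite /match_fun => /eqP; rewrite addr_eq0 => /eqP ->.
  by rewrite opprK mulrAC divff ?mul1r.
by rewrite /slope m2; move: (logd lam xi) => m; field.
Qed.

Lemma mu_dv lam xi : lam < b ^+ 2 -> match_fun b lam xi = 0 ->
  is_derive xi 1 (mu_a a) (- ((1 + b ^- 2) * slope lam xi) / match_lam b lam xi).
Proof.
move=> lb m0; rewrite -(slope_matched m0).
have m0n : \forall x \near xi, match_fun b (mu_a a x) x = 0.
  by apply: filterS (mu_near lb m0 ltr01) => x [].
exact: (@dv_implicit R (match_fun b) (match_lam b) (b ^+ 2) lam xi (mu_a a) lb
  (fun l x => match_dvlam b01 x) (match_lam_continuous2 lb) (mu_continuous lb m0)
  (mu_eq b01 lb m0) _ (match_lam_gt0 b01 xi lb) (match_dvx b01 xi lb) m0n).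
Qed.

(** At such a point the derivatives of mu and of m(mu(x), x) both vanish, so the slope x^2 - mu -
    m^2 along mu has derivative 2 xi. By [mu_dv], mu' is this slope times a continuous factor. *)
Lemma mu_second_derivative lam xi : lam < b ^+ 2 -> match_fun b lam xi = 0 -> slope lam xi = 0 ->
  derive1 (derive1 (mu_a a)) xi = - ((1 + b ^- 2) * (2 * xi)) / match_lam b lam xi.
Proof.
move=> lb m0 s0; have muE := mu_eq b01 lb m0.
have dmu : is_derive xi 1 (mu_a a) 0.
  by have := mu_dv lb m0; rewrite s0 mulr0 oppr0 mul0r.
have l1 := unit_lt1 b01 lb.
have dl : is_derive xi 1 (fun x => logd (mu_a a x) x) 0.
  have := @dv_along R logd logd_lam 1 lam xi (mu_a a) l1 (fun l x => logd_dvlam x)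
    (logd_lam_continuous2 (x:=xi) l1) (mu_continuous lb m0) muE _ _ (logd_dvx xi l1) dmu.
  by rewrite mulr0 add0r s0.
have ds : is_derive xi 1 (fun x => slope (mu_a a x) x) (2 * xi).
  apply: (is_derive_eq (dvB (dvB (dv_sqr (dv_id xi)) dmu) (dv_sqr dl))).
  by rewrite mulr1 mulr0 !subr0.
have ck : {for xi, continuous (fun x => (match_lam b (mu_a a x) x)^-1)}.
  have cz := match_lam_continuous2 (xi := xi) lb.
  have cp : (mu_a a x, x) @[x --> xi] --> (lam, xi).
    have c1 : mu_a a x @[x --> xi] --> lam by rewrite -[X in _ --> X]muE; exact: mu_continuous lb m0.
    have c2 : x @[x --> xi] --> xi by exact: cvg_id.
    exact: cvg_pair c1 c2.
  have cm : {for xi, continuous (fun x => match_lam b (mu_a a x) x)}.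
    by move: (cvg_comp _ _ cp cz); rewrite -muE.
  have n0 : match_lam b (mu_a a xi) xi != 0 by rewrite muE gt_eqF//; exact: match_lam_gt0.
  exact: cvgV n0 cm.
have sx0 : slope (mu_a a xi) xi = 0 by rewrite muE.
have d2 := dvZ (- (1 + b ^- 2)) (@dv_vanishing R (fun x => slope (mu_a a x) x)
  (fun x => (match_lam b (mu_a a x) x)^-1) xi (2 * xi) sx0 ck ds).
have d3 : is_derive xi 1 (derive1 (mu_a a)) (- (1 + b ^- 2) * (2 * xi * (match_lam b lam xi)^-1)).
  rewrite muE in d2; apply: (near_eq_is_derive _ d2); near=> x.
  have [_ mb mm] : [/\ `|mu_a a x - lam| < 1, mu_a a x < b ^+ 2 & match_fun b (mu_a a x) x = 0].
    by near: x; exact: mu_near.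
  by rewrite (dv_derive1 (mu_dv mb mm)) mulrA mulNr.
by rewrite (dv_derive1 d3) mulrA mulNr.
Unshelve. all: by end_near. Qed.

(** Strictness comes from moving lam slightly to the right: [match_fun] stays negative by continuity
    and [mu_ge] applies at the larger value. *)
Lemma mu_gt lam xi : (exists u v, form_dom (@setT R) u v /\ norm2 setT u != 0) ->
  lam < b ^+ 2 -> match_fun b lam xi < 0 -> lam < mu_a a xi.
Proof.
move=> ne lb m0; have cm := dv_continuous (match_dvlam b01 xi lb).
have H : \forall l \near lam^'+, [/\ lam < l, l < b ^+ 2 & match_fun b l xi < 0].
  near=> l; split.
  - by near: l; exact: nbhs_right_gt.
  - by near: l; exact: nbhs_right_lt.
  - near: l; apply: cvg_within; exact: (cvgr_lt _ cm).
have [l [ll lB ml]] := filter_ex H.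
by apply: lt_le_trans ll (mu_ge b01 ne lB (ltW ml)).
Unshelve. all: by end_near. Qed.

End BottomOfSpectrum.

Lemma inf_range_attained {R : realType} (f : R -> R) (m x : R) :
  (forall t, m <= f t) -> f x = m -> inf (range f) = m.
Proof.
move=> mf fx; apply/eqP; rewrite eq_le; apply/andP; split.
  rewrite -fx; apply: ge_inf; last by exists x.
  by exists m => _ [t _ <-].
by apply: lb_le_inf; [exists (f x), x|move=> _ [t _ <-]].
Qed.

Theorem theorem1p1 (R : realType) (a : R) (ha : -1 < a < 0) :
  (exists! zeta : R, beta a = mu_a a zeta) /\
  forall zeta : R, beta a = mu_a a zeta ->
    [/\ zeta < 0 /\ 0 < derive1 (derive1 (mu_a a)) zeta,
        `|a| * Theta0 < beta a /\ beta a < Theta0 &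
        (exists u : R -> R, ground_state a zeta u) /\
        (forall u : R -> R, ground_state a zeta u ->
           derivable u 0 1 /\ derive1 u 0 < 0)].
Proof.
have [b b01 aE] : exists2 b : R, 0 < b < 1 & a = - b ^+ 2.
  move: ha => /andP[a1 a0]; exists (Num.sqrt (- a)).
    rewrite sqrtr_gt0 oppr_gt0 a0 /= -[X in _ < X](@sqrtr1 R) ltr_sqrt// ltrNl//.
  by rewrite sqr_sqrtr ?opprK// oppr_ge0 ltW.
rewrite {ha}aE {a}.
have b0 := unit_gt0 b01.
have [bet [z [lN [xN [[/andP[bet0 betb] z0 sz mz] [[Gz Gle Guniq] [mN mNle betN lN1 Nbet]]]]]]] :=
  bottom_exists b01.
have ne := form_dom_nonempty b01 betb Gz.
have muz : mu_a (- b ^+ 2) z = bet by exact: mu_eq.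
have betaE : beta (- b ^+ 2) = bet.
  by apply: (inf_range_attained _ muz) => t; exact: mu_ge.
have ThetaE : Theta0 = lN.
  apply: (@inf_range_attained R lambdaN lN xN) => [t|]; first exact: lambdaN_ge.
  by apply/eqP; rewrite eq_le lambdaN_le// lambdaN_ge// mN.
(* A point with [match_fun bet x < 0] would have an eigenvalue strictly above bet, so minimality
   forces the value 0, which is taken only at z. *)
have uniq x : beta (- b ^+ 2) = mu_a (- b ^+ 2) x -> x = z.
  rewrite betaE => e; apply: Guniq; apply/eqP; rewrite eq_le Gle /= leNgt; apply/negP => m0.
  by have := mu_gt b01 ne betb m0; rewrite -e ltxx.
split; first by exists z; split; [rewrite betaE muz|move=> x /uniq].
move=> x /uniq ->; split.
- split=> //; rewrite (mu_second_derivative b01 betb Gz sz).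
  rewrite divr_gt0 ?match_lam_gt0// -mulrN mulr_gt0//.
    by rewrite addr_gt0// invr_gt0 exprn_gt0.
  by rewrite oppr_gt0 pmulr_rlt0.
- by rewrite betaE ThetaE normrN ger0_norm ?sqr_ge0.
- split; first exact: ground_state_exists b01 betb Gz.
  move=> u /[dup] gu [_ [u0 _]]; have d := ground_state_derive b01 betb Gz gu.
  by split; [case: d|rewrite (dv_derive1 d) pmulr_llt0].
Qed.
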